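(* Let $\sigma>0$, let $k\ge1$ be an integer, and let $X=\{x_i:i\in\mathbb{Z}\}$, $\cdots<x_{i-1}<x_i<x_{i+1}<\cdots$, be a separated set of real numbers such that $\delta:=\sup_i(x_{i+1}-x_i)<\frac{\nu_k}{\sigma}$. Then there exists a Bessel sequence $\{g_{i,l}:i\in\mathbb{Z},\ l=0,\dots,k-1\}$ in $\mathcal{B}_\sigma$ such that $$f^{(k-1)}(x)=\sum_{i\in\mathbb{Z}}\sum_{l=0}^{k-1}f^{(l)}(x_i)\,g_{i,l}(x)$$ for every $f\in\mathcal{B}_\sigma$. The function $f$ can be computed using the relation $$f^{(l-1)}(x)=\int_{x_i}^x f^{(l)}(t)\,\mathrm{d}t+f^{(l-1)}(x_i),\qquad l=k-1,k-2,\dots,1.$$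
   Context: The Fourier transform is $\widehat f(w)=\int_{\mathbb{R}} f(x)e^{-2\pi i w x}\,\mathrm{d}x$, extended to $L^2(\mathbb{R})$. For $\sigma>0$, $\mathcal{B}_\sigma=\{f\in L^2(\mathbb{R}):\operatorname{supp}\widehat f\subseteq[-\frac{\sigma}{2\pi},\frac{\sigma}{2\pi}]\}$, a closed subspace of $L^2(\mathbb{R})$; its elements are identified with entire functions of exponential type $\le\sigma$ that are square integrable on the real axis. A set $\{x_i:i\in\mathbb{Z}\}$ of real numbers is separated if there is $\gamma>0$ with $\inf_{i\neq j}|x_i-x_j|\ge\gamma$. A family $\{h_n\}$ in a Hilbert space $\mathcal{H}$ is a Bessel sequence if there is $B>0$ with $\sum_n|\langle f,h_n\rangle|^2\le B\|f\|^2$ for all $f\in\mathcal{H}$. The constant $\nu_k>0$ (Wirtinger-Cimmino constant): $\nu_k^2$ is the first (smallest) eigenvalue $\lambda>0$ of the boundary value problem $$u^{(2k)}(x)+\lambda u^{(2k-2)}(x)=0,\ x\in[0,1],\qquad u^{(l)}(0)=u^{(l)}(1)=0,\ 0\le l\le k-1,\qquad u\in C^{2k}[0,1],$$ i.e. the smallest $\lambda>0$ for which a non-zero solution $u$ exists. (For instance $\nu_1=\pi$ and $\nu_2=2\pi$.) *)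

(* Defs.v *)
From HB Require Import structures.
From mathcomp Require Import all_boot all_order all_algebra finmap.
From mathcomp Require Import complex.
From mathcomp Require Import all_classical all_reals all_analysis.
From mathcomp Require Import summability.
Import Order.TTheory GRing.Theory Num.Theory.
Import numFieldNormedType.Exports.

Set Implicit Arguments.
Unset Strict Implicit.
Unset Printing Implicit Defensive.

Local Open Scope classical_set_scope.
Local Open Scope ring_scope.
Local Open Scope complex_scope.

Section ComplexValued.
Context {R : realType}.
Implicit Types f g h : R -> R[i].

Notation mu := (@lebesgue_measure R).

Definition re f : R -> R := fun x => complex.Re (f x).
Definition im f : R -> R := fun x => complex.Im (f x).

Definition ccontinuous f := continuous (re f) /\ continuous (im f).

Definition cderiven n f : R -> R[i] :=
  fun x => derive1n n (re f) x +i* derive1n n (im f) x.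

Definition cintegral (D : set R) f : R[i] :=
  (\int[mu]_(x in D) re f x) +i* (\int[mu]_(x in D) im f x).

(* oriented: a may exceed b *)
Definition cintegral_from_to (a b : R) f : R[i] :=
  if a <= b then cintegral `[a, b] f else - cintegral `[b, a] f.

Definition cLfun (p : \bar R) : set (R -> R[i]) :=
  [set f | re f \in Lfun mu p /\ im f \in Lfun mu p].

Definition L2norm f : \bar R :=
  Lnorm mu 2%:E (fun x => (ComplexField.Normc.normc (f x))%:E).

Definition inner f g : R[i] := cintegral setT (fun x => f x * (g x)^*).

Definition expi (t : R) : R[i] := cos t +i* sin t.

Definition fourier f : R -> R[i] :=
  fun w => cintegral setT (fun x => f x * expi (- (2 * pi * w * x))).

(* Extension of the Fourier transform from L^1 /\ L^2 to L^2: the graph of the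
   extension is the closure of the graph of [fourier]. By Plancherel, [F] is
   determined by [f] up to a null set. *)
Definition fourierL2 f (F : R -> R[i]) :=
  cLfun 2%:E F /\
  exists u : nat -> R -> R[i],
    [/\ forall n, cLfun 1%:E (u n) /\ cLfun 2%:E (u n),
        (fun n => L2norm (fun x => u n x - f x)) @ \oo --> 0%E
      & (fun n => L2norm (fun w => fourier (u n) w - F w)) @ \oo --> 0%E].

(* B_sigma. Each class of square-integrable functions whose transform has
   compact support contains exactly one continuous function, the restriction
   to the real axis of the entire function with which the class is identified;
   continuity selects that representative. *)
Definition bandlimited (sigma : R) : set (R -> R[i]) :=
  [set f | [/\ ccontinuous f, cLfun 2%:E f
    & exists2 F, fourierL2 f F &
        {ae mu, forall w, ~ `[- (sigma / (2 * pi)), sigma / (2 * pi)]%classic w ->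
                          F w = 0}]].

Definition bessel_sequence (I : choiceType) (H : set (R -> R[i]))
    (h : I -> R -> R[i]) :=
  (forall n, H (h n)) /\
  exists2 B : R, 0 < B & forall f, H f ->
    (\esum_(n in [set: I]) (ComplexField.Normc.normc (inner f (h n)) ^+ 2)%:E
     <= B%:E * L2norm f ^+ 2)%E.

End ComplexValued.

Definition separated_nodes (R : realType) (x : int -> R) :=
  exists2 gamma : R, 0 < gamma & forall i j, i <> j -> gamma <= `|x i - x j|.

Section WirtingerCimmino.
Context (R : realType).

(* [v 0] is of class C^n on [0, 1] with successive derivatives [v 1], ...,
   [v n]; at the end points these are the one-sided derivatives, i.e. the
   continuous extensions of the derivatives on ]0, 1[. *)
Definition Cn_on_unit_interval (n : nat) (v : nat -> R -> R) :=
  (forall j, (j <= n)%N -> {within `[0, 1], continuous (v j)}) /\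
  (forall j (t : R), (j < n)%N -> t \in `]0, 1[ ->
     is_derive t 1 (v j) (v j.+1 t)).

Definition bvp_eigenvalue (k : nat) (lambda : R) :=
  exists v : nat -> R -> R,
    [/\ Cn_on_unit_interval (2 * k) v,
        forall t, t \in `[0, 1] ->
          v (2 * k)%N t + lambda * v (2 * k - 2)%N t = 0,
        forall l, (l <= k - 1)%N -> v l 0 = 0 /\ v l 1 = 0
      & exists2 t, t \in `[0, 1] & v 0%N t != 0].

Definition first_bvp_eigenvalue (k : nat) : set R :=
  [set lambda | [/\ 0 < lambda, bvp_eigenvalue k lambda
    & forall lambda', 0 < lambda' -> bvp_eigenvalue k lambda' ->
        lambda <= lambda']].

Definition wirtinger_cimmino (k : nat) : R :=
  Num.sqrt (xget 0 (first_bvp_eigenvalue k)).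

End WirtingerCimmino.

(* Main.v *)
Require Import Defs.
From HB Require Import structures.
From mathcomp Require Import all_boot all_order all_algebra finmap.
From mathcomp Require Import complex.
From mathcomp Require Import all_classical all_reals all_analysis.
From mathcomp Require Import summability measurable_realfun zify ring lra.
Import Order.TTheory GRing.Theory Num.Theory.
Import numFieldNormedType.Exports.

(* Splitting into real and imaginary parts and replacing exp(-2 pi i w x) by
   cas = cos + sin reduces the problem to the real Hartley transform, for which
   Plancherel's identity on the band follows by Poisson regularisation.

   On each cell [x_i, x_(i+1)] let Hf be the polynomial of degree < 2k with the
   same jets of order < k as f at both end points. The Wirtinger-Cimmino
   inequality applies to f - Hf, and (f - Hf)^(k) is orthogonal to (Hf)^(k), so
   lam |(f - Hf)^(k-1)|^2 <= |f^(k)|^2 for some lam > sigma^2, whereas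
   |f^(k)| <= sigma |f^(k-1)| by Bernstein. Hence, if A f denotes the
   orthogonal projection of Hf onto the band-limited functions, 1 - A is a
   contraction for the seminorm |f^(k-1)|, and the Neumann series
   U = sum_n D^(k-1) (1 - A)^n satisfies U A f = f^(k-1). The functions g_(i,l)
   are the images under U of the projected Hermite basis functions; the latter
   have boundedly overlapping supports, which gives the Bessel bound.

   The Wirtinger-Cimmino inequality is the classical sufficiency argument for
   quadratic functionals: below the first eigenvalue there are no conjugate
   points, so the Jacobi fields solve a Riccati equation that completes the
   square. *)

Set Implicit Arguments.
Unset Strict Implicit.
Unset Printing Implicit Defensive.

Local Open Scope classical_set_scope.
Local Open Scope ring_scope.

(** * Square-integrable functions *)

Section SquareIntegrable.
Context {R : realType}.
Notation mu := (@lebesgue_measure R).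
Implicit Types (f g h : R -> R) (c : R).

(** For k > 1 low frequencies make the seminorm |f^(k-1)| much weaker than |f|, so [1 - A] need not
    shrink |f| and the Neumann series is formed after differentiating. This is why the expansion
    returns f^(k-1), and f is recovered by integration from a node.

    The contraction factor is sigma / sqrt lam. Strictness of delta < nu_k / sigma leaves room for
    lam between sigma^2 and nu_k^2 / delta^2; the upper bound keeps cells strictly shorter than the
    first conjugate distance, so the Jacobi fields can start outside the cell.

    The interpolant is only piecewise polynomial. Its cellwise derivative of order k-1 is exchanged
    with the projection because jets agree at the nodes, so integration by parts leaves no boundary
    terms.

    The transform is an integral, hence lives on integrable functions. Infinite sums are reached as
    L2 limits of finite ones, and the complex L2 class, whose transform is itself a limit, is
    handled by identities that are continuous in L2. Pointwise values survive these limits because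
    evaluation is bounded on band-limited functions. *)

Definition itg f := mu.-integrable setT (EFin \o f).
Definition L2 f := measurable_fun [set: R] f /\ itg (fun x => f x ^+ 2).
Definition dot f g : R := \int[mu]_x (f x * g x).
Definition nrm f : R := Num.sqrt (dot f f).

Lemma itg_meas f : itg f -> measurable_fun [set: R] f.
Proof. by move=> /integrableP[/measurable_EFinP]. Qed.

Lemma itg_dom f g : measurable_fun [set: R] f ->
  (forall x, `|f x| <= g x) -> itg g -> itg f.
Proof.
move=> mf fg ig; apply: (le_integrable measurableT) ig.
  exact/measurable_EFinP.
by move=> x _ /=; rewrite lee_fin (le_trans (fg x))// ler_norm.
Qed.

Lemma itgD f g : itg f -> itg g -> itg (fun x => f x + g x).
Proof. by move=> If Ig; exact: (integrableD measurableT If Ig). Qed.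

Lemma itgZ c f : itg f -> itg (fun x => c * f x).
Proof. by move=> If; apply: (integrableZl measurableT c If). Qed.

Lemma itgN f : itg f -> itg (fun x => - f x).
Proof. by move=> /(itgZ (-1)); under eq_fun do rewrite mulN1r. Qed.

Lemma itgB f g : itg f -> itg g -> itg (fun x => f x - g x).
Proof. by move=> If /itgN; apply: itgD. Qed.

Lemma itg0 : itg (fun=> 0).
Proof. exact: integrable0. Qed.

Lemma itg_norm f : itg f -> itg (fun x => `|f x|).
Proof. by move=> /integrable_norm. Qed.

Lemma itg_sum (I : Type) (s : seq I) (F : I -> R -> R) :
  (forall i, itg (F i)) -> itg (fun x => \sum_(i <- s) F i x).
Proof.
move=> FI; elim: s => [|i s IH].
  by under eq_fun do rewrite big_nil; exact: itg0.
by under eq_fun do rewrite big_cons; apply: itgD.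
Qed.

Lemma Rint_sum (I : Type) (s : seq I) (F : I -> R -> R) :
  (forall i, itg (F i)) ->
  \int[mu]_x (\sum_(i <- s) F i x) = \sum_(i <- s) \int[mu]_x F i x.
Proof.
move=> FI; elim: s => [|i s IH].
  rewrite big_nil; under eq_Rintegral do rewrite big_nil.
  by rewrite /Rintegral integral0.
rewrite big_cons -IH -RintegralD//; [|exact: FI|exact: itg_sum].
by apply: eq_Rintegral => x _; rewrite big_cons.
Qed.

Lemma IntZl c f : itg f -> \int[mu]_x (c * f x) = c * \int[mu]_x f x.
Proof. exact: RintegralZl. Qed.

Lemma IntZr c f : itg f -> \int[mu]_x (f x * c) = (\int[mu]_x f x) * c.
Proof. exact: RintegralZr. Qed.

Lemma IntD f g : itg f -> itg g ->
  \int[mu]_x (f x + g x) = \int[mu]_x f x + \int[mu]_x g x.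
Proof. exact: RintegralD. Qed.

Lemma IntB f g : itg f -> itg g ->
  \int[mu]_x (f x - g x) = \int[mu]_x f x - \int[mu]_x g x.
Proof. exact: RintegralB. Qed.

Lemma le_Int f g : itg f -> itg g -> (forall x, f x <= g x) ->
  \int[mu]_x f x <= \int[mu]_x g x.
Proof. by move=> If Ig fg; apply: le_Rintegral. Qed.

Lemma norm_Int f : itg f -> `|\int[mu]_x f x| <= \int[mu]_x `|f x|.
Proof. exact: le_normr_Rintegral. Qed.

Lemma Int_ext f g : (forall x, f x = g x) -> \int[mu]_x f x = \int[mu]_x g x.
Proof. by move=> fg; apply: eq_Rintegral. Qed.

Lemma itg_bounded_mul f g (M : R) : measurable_fun [set: R] f ->
  (forall x, `|f x| <= M) -> itg g -> itg (fun x => f x * g x).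
Proof.
move=> mf fM ig; apply: (@itg_dom _ (fun x => M * `|g x|)).
- by apply: measurable_funM => //; exact: itg_meas.
- by move=> x; rewrite normrM ler_wpM2r.
- exact/itgZ/itg_norm.
Qed.

Lemma meas_sq f : measurable_fun [set: R] f ->
  measurable_fun [set: R] (fun x => f x ^+ 2).
Proof. by move=> mf; apply: measurable_funX. Qed.

Lemma L2_dom f g : measurable_fun [set: R] f ->
  (forall x, `|f x| <= `|g x|) -> L2 g -> L2 f.
Proof.
move=> mf fg [mg ig]; split=> //; apply: itg_dom ig => //; first exact: meas_sq.
move=> x; rewrite normrX -[leRHS]ger0_norm ?sqr_ge0// normrX.
by rewrite lerXn2r ?nnegrE.
Qed.

Lemma L2_itgM f g : L2 f -> L2 g -> itg (fun x => f x * g x).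
Proof.
move=> [mf If] [mg Ig].
apply: (@itg_dom _ (fun x => f x ^+ 2 + g x ^+ 2)); last exact: itgD.
  exact: measurable_funM.
move=> x; rewrite ler_norml; apply/andP; split.
  have := sqr_ge0 (f x + g x); have := sqr_ge0 (f x); have := sqr_ge0 (g x).
  by nra.
have := sqr_ge0 (f x - g x); have := sqr_ge0 (f x); have := sqr_ge0 (g x).
by nra.
Qed.

Lemma L2D f g : L2 f -> L2 g -> L2 (fun x => f x + g x).
Proof.
move=> Lf Lg; split; first by case: Lf; case: Lg => *; exact: measurable_funD.
under eq_fun do rewrite sqrrD mulr2n.
apply: itgD; last by case: Lg.
apply: itgD; first by case: Lf.
by apply: itgD; apply: L2_itgM.
Qed.

Lemma L2Z c f : L2 f -> L2 (fun x => c * f x).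
Proof.
move=> [mf If]; split; first exact: measurable_funM.
by under eq_fun do rewrite exprMn; exact: itgZ.
Qed.

Lemma L2N f : L2 f -> L2 (fun x => - f x).
Proof. by move=> /(L2Z (-1)); under eq_fun do rewrite mulN1r. Qed.

Lemma L2B f g : L2 f -> L2 g -> L2 (fun x => f x - g x).
Proof. by move=> Lf /L2N; apply: L2D. Qed.

Lemma L2_0 : L2 (fun=> 0).
Proof. by split => //; under eq_fun do rewrite expr0n/=; exact: itg0. Qed.

Lemma L2_sum (I : Type) (s : seq I) (F : I -> R -> R) :
  (forall i, L2 (F i)) -> L2 (fun x => \sum_(i <- s) F i x).
Proof.
move=> FI; elim: s => [|i s IH].
  by under eq_fun do rewrite big_nil; exact: L2_0.
by under eq_fun do rewrite big_cons; apply: L2D.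
Qed.

Lemma L2_indic (D : set R) f : measurable D -> L2 f -> L2 (fun x => \1_D x * f x).
Proof.
move=> mD Lf; apply: L2_dom (Lf).
  by apply: measurable_funM => //; case: Lf.
move=> x; rewrite normrM ler_piMl// indicE.
by case: (_ \in _); rewrite ?normr1 ?normr0.
Qed.

Lemma dotC f g : dot f g = dot g f.
Proof. by apply: eq_Rintegral => x _; rewrite mulrC. Qed.

Lemma dotDl f g h : L2 f -> L2 g -> L2 h ->
  dot (fun x => f x + g x) h = dot f h + dot g h.
Proof.
move=> Lf Lg Lh; rewrite -RintegralD//; try exact: L2_itgM.
by apply: eq_Rintegral => x _; rewrite mulrDl.
Qed.

Lemma dotZl c f h : L2 f -> L2 h -> dot (fun x => c * f x) h = c * dot f h.
Proof.
move=> Lf Lh; rewrite -RintegralZl//; last exact: L2_itgM.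
by apply: eq_Rintegral => x _; rewrite mulrA.
Qed.

Lemma dotNl f h : L2 f -> L2 h -> dot (fun x => - f x) h = - dot f h.
Proof.
move=> Lf Lh; rewrite -mulN1r -dotZl//.
by congr dot; apply/funext => x; rewrite mulN1r.
Qed.

Lemma dotBl f g h : L2 f -> L2 g -> L2 h ->
  dot (fun x => f x - g x) h = dot f h - dot g h.
Proof. by move=> Lf Lg Lh; rewrite dotDl ?dotNl//; exact: L2N. Qed.

Lemma dotDr f g h : L2 f -> L2 g -> L2 h ->
  dot h (fun x => f x + g x) = dot h f + dot h g.
Proof. by move=> *; rewrite dotC dotDl// ![dot h _]dotC. Qed.

Lemma dotZr c f h : L2 f -> L2 h -> dot h (fun x => c * f x) = c * dot h f.
Proof. by move=> *; rewrite dotC dotZl// [dot h _]dotC. Qed.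

Lemma dotBr f g h : L2 f -> L2 g -> L2 h ->
  dot h (fun x => f x - g x) = dot h f - dot h g.
Proof. by move=> *; rewrite dotC dotBl// ![dot h _]dotC. Qed.

Lemma dot_suml (I : Type) (s : seq I) (F : I -> R -> R) h :
  (forall i, L2 (F i)) -> L2 h ->
  dot (fun x => \sum_(i <- s) F i x) h = \sum_(i <- s) dot (F i) h.
Proof.
move=> LF Lh; rewrite /dot; under eq_Rintegral do rewrite mulr_suml.
by rewrite Rint_sum// => i; exact: L2_itgM.
Qed.

Lemma dot_ge0 f : 0 <= dot f f.
Proof. by apply: Rintegral_ge0 => x _; rewrite -expr2 sqr_ge0. Qed.

Lemma nrm_ge0 f : 0 <= nrm f. Proof. exact: sqrtr_ge0. Qed.

Lemma sqr_nrm f : nrm f ^+ 2 = dot f f.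
Proof. by rewrite sqr_sqrtr// dot_ge0. Qed.

Lemma le_nrm f g : measurable_fun [set: R] f -> L2 g ->
  (forall x, `|f x| <= `|g x|) -> nrm f <= nrm g.
Proof.
move=> mf Lg fg; have Lf := L2_dom mf fg Lg.
rewrite ler_sqrt ?dot_ge0//; apply: le_Rintegral => //; try exact: L2_itgM.
move=> x _; rewrite -!expr2 -[leLHS]ger0_norm ?sqr_ge0//.
by rewrite -[leRHS]ger0_norm ?sqr_ge0// !normrX lerXn2r ?nnegrE.
Qed.

Lemma dot_sqrD f g : L2 f -> L2 g ->
  dot (fun x => f x + g x) (fun x => f x + g x)
  = dot f f + 2 * dot f g + dot g g.
Proof.
move=> Lf Lg; have Lfg := L2D Lf Lg.
rewrite dotDl// !dotDr// [dot g f]dotC; ring.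
Qed.

Lemma cauchy_schwarz f g : L2 f -> L2 g -> `|dot f g| <= nrm f * nrm g.
Proof.
move=> Lf Lg.
have H c : 0 <= dot f f + 2 * c * dot f g + c ^+ 2 * dot g g.
  have := dot_ge0 (fun x => f x + c * g x).
  have Lc : L2 (fun x => c * g x) by exact: L2Z.
  by rewrite dot_sqrD// !dotZr// dotZl// expr2 !mulrA.
have ff := dot_ge0 f; have gg := dot_ge0 g.
rewrite -sqrtrM// -sqrtr_sqr ler_sqrt; last by rewrite mulr_ge0.
have [gg0|gg0] := eqVneq (dot g g) 0.
  rewrite gg0 mulr0; have [->|fg0] := eqVneq (dot f g) 0; first by rewrite expr0n.
  have := H (- (dot f f + 1) / (2 * dot f g)); rewrite gg0 mulr0 addr0.
  have -> : 2 * (- (dot f f + 1) / (2 * dot f g)) * dot f g = - (dot f f + 1).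
    by field.
  by lra.
have := H (- dot f g / dot g g).
have -> : dot f f + 2 * (- dot f g / dot g g) * dot f g
  + (- dot f g / dot g g) ^+ 2 * dot g g = dot f f - dot f g ^+ 2 / dot g g by field.
by rewrite subr_ge0 ler_pdivrMr// lt_neqAle eq_sym gg0.
Qed.

Lemma nrmD f g : L2 f -> L2 g -> nrm (fun x => f x + g x) <= nrm f + nrm g.
Proof.
move=> Lf Lg; rewrite -(ler_pXn2r (ltn0Sn 1)) ?nnegrE ?nrm_ge0 ?addr_ge0 ?nrm_ge0//.
rewrite sqr_nrm dot_sqrD// sqrrD !sqr_nrm mulr2n.
have := le_trans (ler_norm _) (cauchy_schwarz Lf Lg); lra.
Qed.

Lemma nrmZ c f : L2 f -> nrm (fun x => c * f x) = `|c| * nrm f.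
Proof.
move=> Lf; rewrite /nrm dotZl//; last exact: L2Z.
rewrite dotC dotZl// mulrA -expr2 sqrtrM ?sqr_ge0// sqrtr_sqr//.
Qed.

Lemma nrmN f : nrm (fun x => - f x) = nrm f.
Proof.
by rewrite /nrm /dot; under eq_Rintegral do rewrite mulrNN.
Qed.

Lemma nrmB f g : L2 f -> L2 g -> nrm (fun x => f x - g x) <= nrm f + nrm g.
Proof. by move=> Lf Lg; rewrite -[nrm g]nrmN; apply: nrmD => //; exact: L2N. Qed.

Lemma nrm_distC f g : nrm (fun x => f x - g x) = nrm (fun x => g x - f x).
Proof. by rewrite -nrmN; congr nrm; apply/funext => x; rewrite opprB. Qed.

Lemma nrm_tri g f h : L2 f -> L2 g -> L2 h ->
  nrm (fun x => f x - h x) <= nrm (fun x => f x - g x) + nrm (fun x => g x - h x).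
Proof.
move=> Lf Lg Lh; apply: le_trans (nrmD (L2B Lf Lg) (L2B Lg Lh)).
by rewrite le_eqVlt; apply/orP; left; apply/eqP; congr nrm; apply/funext => x; ring.
Qed.

Lemma nrm_sum (I : Type) (s : seq I) (F : I -> R -> R) :
  (forall i, L2 (F i)) ->
  nrm (fun x => \sum_(i <- s) F i x) <= \sum_(i <- s) nrm (F i).
Proof.
move=> FI; elim: s => [|i s IH].
  under eq_fun do rewrite big_nil.
  by rewrite big_nil /nrm /dot; under eq_Rintegral do rewrite mulr0;
    rewrite /Rintegral integral0 sqrtr0.
under eq_fun do rewrite big_cons.
by rewrite big_cons (le_trans (nrmD _ _))// ?lerD2l//; exact: L2_sum.
Qed.

(** Fatou's lemma along a pointwise limit. Integrability of the limit is part of the conclusion;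
    square integrability of limits below rests on it. *)
Lemma itg_fatou (f_ : nat -> R -> R) f (M : R) :
  (forall n, itg (f_ n)) -> (forall n x, 0 <= f_ n x) ->
  (forall x, f_ ^~ x @ \oo --> f x) ->
  (\forall n \near \oo, \int[mu]_x f_ n x <= M) ->
  itg f /\ \int[mu]_x f x <= M.
Proof.
move=> If f0 cf [N _ fM].
have f_ge0 x : 0 <= f x.
  by apply: (@limr_ge _ _ _ _ _ 0 (f_ ^~ x)) => //; [exact: cvgP (cf x) | exact: nearW]
  || (have /cvg_lim <- // := cf x; apply: limr_ge; [exact: cvgP (cf x)|exact: nearW]).
have mf : measurable_fun [set: R] f.
  by apply: (measurable_fun_cvg (fun n => itg_meas (If n))) => x _; exact: cf.
have H : (\int[mu]_x (f x)%:E <= M%:E)%E.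
  have -> : (\int[mu]_x (f x)%:E = \int[mu]_x (limn_einf (fun n => (f_ n x)%:E)))%E.
    apply: eq_integral => x _.
    have := @cvg_limn_einf_sup _ (fun n => (f_ n x)%:E) (f x)%:E.
    by case => // /=; apply: cvg_EFin => //; [exact: nearW|exact: cf].
  apply: le_trans (fatou mu measurableT _ _) _.
  - by move=> n; apply/measurable_EFinP; exact: itg_meas.
  - by move=> n x _; rewrite lee_fin.
  rewrite limn_einf_lim; apply: lime_le; first exact: is_cvg_einfs.
  exists N => // n /= Nn; apply: le_trans (ereal_inf_lbound _) _.
    by exists n => //=.
  rewrite -[leLHS]fineK ?lee_fin; first exact: fM.
  exact: integrable_fin_num (If n).
have Ifi : itg f.
  apply/integrableP; split; first exact/measurable_EFinP.
  under eq_integral do rewrite /= ger0_norm//.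
  by rewrite (le_lt_trans H)// ltry.
split=> //; rewrite -lee_fin /Rintegral fineK//.
exact: integrable_fin_num Ifi.
Qed.

Lemma Rint_dct (f_ : nat -> R -> R) f g :
  (forall n, measurable_fun [set: R] (f_ n)) -> itg g ->
  (forall x, f_ ^~ x @ \oo --> f x) -> (forall n x, `|f_ n x| <= g x) ->
  itg f /\ (fun n => \int[mu]_x f_ n x) @ \oo --> (\int[mu]_x f x : R).
Proof.
move=> mf Ig cf fg.
have mlim : measurable_fun [set: R] f.
  by apply: (measurable_fun_cvg mf) => x _; exact: cf.
have [] := @dominated_convergence _ _ R mu setT measurableT
  (fun n => EFin \o f_ n) (EFin \o f) (EFin \o g) _ _ _ _ _ => //.
- by move=> n; apply/measurable_EFinP; exact: mf.
- exact/measurable_EFinP.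
- by apply: aeW => x _; apply: cvg_EFin; [exact: nearW|exact: cf].
- by apply: aeW => x n _; rewrite lee_fin.
move=> If _ H; split => //; apply: fine_cvg.
rewrite fineK//; last exact: integrable_fin_num If.
Qed.

End SquareIntegrable.

(** * Completeness of L2 (Riesz-Fischer) *)

Section RieszFischer.
Context {R : realType}.
Notation mu := (@lebesgue_measure R).
Implicit Types (f g h : R -> R) (c : R).

Lemma cvg_of_geometric (u : nat -> R) (c : R) :
  (forall n, `|u n.+1 - u n| <= c * 2^-1 ^+ n) -> cvgn u.
Proof.
move=> H.
have c0 : 0 <= c by have := le_trans (normr_ge0 _) (H 0%N); rewrite expr0 mulr1.
have Hs : cvgn (series (fun n => u n.+1 - u n)).
  apply: normed_cvg; apply: (@series_le_cvg _ _ (geometric c 2^-1)).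
  - by move=> n; exact: normr_ge0.
  - by move=> n /=; rewrite mulr_ge0// exprn_ge0.
  - by move=> n /=; exact: H.
  apply: is_cvg_geometric_series.
  by rewrite ger0_norm ?invr_ge0// invf_lt1 // ltr1n.
have -> : u = (fun n => u 0%N + series (fun n => u n.+1 - u n) n).
  by apply/funext => n; rewrite -eq_sum_telescope.
by apply: is_cvgD => //; exact: is_cvg_cst.
Qed.

(** A subsequence with increments [d j] of norm at most 4^-j is extracted. The series of 4^j |d j|^2
    then has finite integral, so it converges off a null set; there the increments are O(2^-j) and
    the subsequence converges. Fatou's lemma bounds the distance to the limit. *)
Lemma L2_complete (u : nat -> R -> R) : (forall n, L2 (u n)) ->
  (forall e, 0 < e -> exists N, forall m n, (N <= m)%N -> (N <= n)%N ->
     nrm (fun x => u m x - u n x) <= e) ->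
  exists v, L2 v /\ forall e, 0 < e -> exists N, forall n, (N <= n)%N ->
     nrm (fun x => u n x - v x) <= e.
Proof.
move=> Lu Cu.
pose e_ j : R := 4^-1 ^+ j.
have e_gt0 j : 0 < e_ j by rewrite exprn_gt0 ?invr_gt0.
have /choice[N0 HN0] := fun j => Cu (e_ j) (e_gt0 j).
(* Summing the thresholds makes [M] monotone with [N0 j <= M j]; the summand [j] makes it
   unbounded. *)
pose M j := (\sum_(i < j.+1) N0 i + j)%N.
have MS j : (M j <= M j.+1)%N.
  by rewrite /M [leqRHS]addnS leqW// [X in (_ <= X + _)%N]big_ord_recr/= leq_add2r leq_addr.
have MN j : (N0 j <= M j)%N by rewrite /M big_ord_recr/= addnAC leq_addl.
have Mj j : (j <= M j)%N by rewrite /M leq_addl.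
pose d j x := u (M j.+1) x - u (M j) x.
have Ld j : L2 (d j) by exact: L2B.
have nd j : nrm (d j) <= e_ j.
  by apply: HN0; rewrite ?MN// (leq_trans (MN _))// MS.
have mEd j : measurable_fun [set: R] (fun x => (4 ^+ j * d j x ^+ 2)%:E).
  by apply/measurable_EFinP; apply: measurable_funM => //; apply: meas_sq; case: (Ld j).
pose G x := (\sum_(0 <= j <oo) (4 ^+ j * d j x ^+ 2)%:E)%E.
have IG : mu.-integrable setT G.
  apply/integrableP; split.
    apply: ge0_emeasurable_sum => //.
      by move=> k x _ _; rewrite lee_fin mulr_ge0 ?sqr_ge0// exprn_ge0.
    by move=> k _; exact: mEd.
  under eq_integral => x _.
    rewrite gee0_abs; last first.
      by apply: nneseries_ge0 => k _ _; rewrite lee_fin mulr_ge0 ?sqr_ge0// exprn_ge0.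
    over.
  rewrite integral_nneseries//; last first.
    by move=> k x _; rewrite lee_fin mulr_ge0 ?sqr_ge0// exprn_ge0.
  apply: (@le_lt_trans _ _ (\sum_(0 <= j <oo) (2 / (2 ^ (j + 1))%:R)%:E)%E).
    apply: lee_nneseries => j _.
      by move=> _; apply: integral_ge0 => x _; rewrite lee_fin mulr_ge0 ?sqr_ge0// exprn_ge0.
    have -> : (\int[mu]_x (4 ^+ j * d j x ^+ 2)%:E)%E = (4 ^+ j * nrm (d j) ^+ 2)%:E.
      rewrite sqr_nrm /dot -RintegralZl//; last exact: L2_itgM.
      rewrite /Rintegral fineK; first by apply: eq_integral => x _; rewrite expr2.
      by apply: integrable_fin_num => //; apply: itgZ; exact: L2_itgM.
    rewrite lee_fin; apply: (@le_trans _ _ (4 ^+ j * (e_ j) ^+ 2)).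
      by rewrite ler_wpM2l ?exprn_ge0// lerXn2r ?nnegrE ?nrm_ge0// ltW.
    rewrite addn1 natrX /e_ -exprM mulnC exprM -exprMn.
    have -> : (4 * 4^-1 ^+ 2 : R) = 2^-1 * 2^-1 by field.
    have -> : 2 / 2 ^+ j.+1 = 2^-1 ^+ j :> R.
      by rewrite exprS invfM mulrA divff// mul1r exprVn.
    by rewrite lerXn2r ?nnegrE// ?mulr_ge0 ?invr_ge0//; lra.
  have := @cvg_geometric_eseries_half R 2 0; rewrite expr0 divr1.
  by move=> /cvg_lim -> //; rewrite ltry.
have [Z [mZ Z0 ZG]] := integrable_ae measurableT IG.
have GZ x : ~ Z x -> G x \is a fin_num.
  by move=> nZ; apply: contrapT => h; apply: nZ; apply: ZG => /= /(_ Logic.I).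
(* Set to 0 on the null set [Z], the subsequence converges everywhere, so its limit is measurable as
   a pointwise limit. *)
pose w j x := \1_(~` Z) x * u (M j) x.
have mZC : measurable (~` Z) by exact: measurableC.
have cw x : cvgn (w ^~ x).
  rewrite /w indicE; case: (boolP (x \in _)) => xZ; last first.
    by under eq_fun do rewrite mul0r; exact: is_cvg_cst.
  under eq_fun do rewrite mul1r.
  have {}xZ : ~ Z x by move: xZ; rewrite inE.
  apply: (@cvg_of_geometric _ (Num.sqrt (fine (G x)))) => j.
  have G0 : 0 <= fine (G x).
    by apply: fine_ge0; apply: nneseries_ge0 => k _ _; rewrite lee_fin mulr_ge0 ?sqr_ge0// exprn_ge0.
  rewrite -sqrtr_sqr -[X in _ * X]ger0_norm ?exprn_ge0//.
  rewrite -[X in _ * X]sqrtr_sqr -sqrtrM// ler_wsqrtr// -exprM mulnC exprM.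
  have -> : (2^-1 ^+ 2 = 4^-1 :> R) by field.
  rewrite exprVn ler_pdivlMr ?exprn_gt0//.
  rewrite -lee_fin fineK ?GZ//.
  apply: (@le_trans _ _ (\sum_(0 <= i < j.+1) (4 ^+ i * d i x ^+ 2)%:E)%E).
    rewrite big_nat_recr//= mulrC leeDr//; apply: sume_ge0 => i _.
    by rewrite lee_fin mulr_ge0 ?sqr_ge0// exprn_ge0.
  apply: nneseries_lim_ge => i _ _.
  by rewrite lee_fin mulr_ge0 ?sqr_ge0// exprn_ge0.
pose v x := limn (w ^~ x).
have cv x : w ^~ x @ \oo --> v x by exact: cw.
have Lw j : L2 (w j) by exact: L2_indic.
have mv : measurable_fun [set: R] v.
  by apply: (@measurable_fun_cvg _ _ R _ w) => [m|x _]; [case: (Lw m)|exact: cv].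
have nw f j : L2 f -> dot (fun x => f x - w j x) (fun x => f x - w j x) =
   dot (fun x => f x - u (M j) x) (fun x => f x - u (M j) x).
  move=> Lf; have L1 := L2B Lf (Lw j); have L3 := L2B Lf (Lu (M j)).
  rewrite /dot /Rintegral; congr fine; apply: ae_eq_integral => //.
  - by case/integrableP: (L2_itgM L1 L1).
  - by case/integrableP: (L2_itgM L3 L3).
  exists Z; split => // x /= nx; apply: contrapT => xZ; apply: nx => _.
  by rewrite /w indicE mem_set// mul1r.
have key n e N : 0 < e -> (forall m k, (N <= m)%N -> (N <= k)%N ->
     nrm (fun x => u m x - u k x) <= e) -> (N <= n)%N ->
   itg (fun x => (u n x - v x) ^+ 2) /\ \int[mu]_x ((u n x - v x) ^+ 2) <= e ^+ 2.
  move=> e0 HN Nn.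
  apply: (@itg_fatou _ (fun j x => (u n x - w j x) ^+ 2)).
  - by move=> j; case: (L2B (Lu n) (Lw j)).
  - by move=> j x; exact: sqr_ge0.
  - move=> x; rewrite expr2; under eq_fun do rewrite expr2.
    by apply: cvgM; (apply: cvgB; [exact: cvg_cst|exact: cv]).
  - exists N => // j /= Nj.
    rewrite (_ : \int[mu]_x _ = dot (fun x => u n x - w j x) (fun x => u n x - w j x)).
      rewrite nw// -sqr_nrm lerXn2r ?nnegrE ?nrm_ge0 ?(ltW e0)// HN//.
      exact: leq_trans Nj (Mj j).
    by apply: eq_Rintegral => x _; rewrite expr2.
have Lv : L2 v.
  have [N HN] := Cu 1 ltr01.
  have [I1 _] := key N 1 N ltr01 HN (leqnn N).
  have L1 : L2 (fun x => u N x - v x).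
    by split => //; apply: measurable_funB => //; case: (Lu N).
  have := L2B (Lu N) L1; congr L2; apply/funext => x; ring.
exists v; split => // e e0; have [N HN] := Cu e e0.
exists N => n Nn; have [_ I1] := key n e N e0 HN Nn.
rewrite -(ler_pXn2r (ltn0Sn 1)) ?nnegrE ?nrm_ge0 ?(ltW e0)// sqr_nrm.
by apply: le_trans I1; rewrite le_eqVlt; apply/orP; left; apply/eqP;
  apply: eq_Rintegral => x _; rewrite expr2.
Qed.

End RieszFischer.

(** * Integration over the line: fundamental theorem, reflection, Fubini *)

Section RealLine.
Context {R : realType}.
Notation mu := (@lebesgue_measure R).
Implicit Types (f g h F : R -> R) (c e : R).

Lemma cont_meas f : continuous f -> measurable_fun [set: R] f.
Proof. exact: continuous_measurable_fun. Qed.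

Lemma is_derive_cont f (f' x : R) : is_derive x 1 f f' -> {for x, continuous f}.
Proof. by move=> [df _]; apply/differentiable_continuous; apply/derivable1_diffP. Qed.

Lemma FTC_halfline f F (l : R) : continuous f -> (forall x, 0 <= x -> 0 <= f x) ->
  (forall x : R, is_derive x 1 F (f x)) -> F x @[x --> +oo] --> l ->
  (\int[mu]_(x in `[0%R, +oo[) (f x)%:E = (l - F 0)%:E)%E.
Proof.
move=> cf f0 dF Fl; rewrite EFinB; apply: ge0_continuous_FTC2y => //.
- by apply: continuous_subspaceT => x; exact: cf.
- by apply: cvg_at_right_filter; exact: is_derive_cont (dF 0).
- by move=> x _; rewrite derive1E; case: (dF x).
Qed.

(** The left half-line is reflected onto the right one. Nonnegativity turns the finite value of the
    extended integral into integrability. *)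
Lemma FTC_line f F (l m : R) : continuous f -> (forall x, 0 <= f x) ->
  (forall x : R, is_derive x 1 F (f x)) -> F x @[x --> +oo] --> l ->
  F x @[x --> -oo] --> m -> itg f /\ \int[mu]_x f x = l - m.
Proof.
move=> cf f0 dF Fl Fm; have mf := cont_meas cf.
have H : (\int[mu]_x (f x)%:E = (l - m)%:E)%E.
  have -> : [set: measurableTypeR R] = `]-oo, 0%R[%classic `|` `[0%R, +oo[%classic.
    by rewrite -itv_bndbnd_setU ?bnd_simp// set_itvE.
  rewrite ge0_integral_setU//=; last 3 first.
  - by apply/measurable_EFinP; exact: measurable_funS mf.
  - by move=> x _; rewrite lee_fin.
  - by apply/disj_setPS => x [] /=; rewrite !in_itv/= andbT => /lt_le_trans H /H; rewrite ltxx.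
  rewrite (FTC_halfline cf _ dF Fl)//.
  rewrite integral_itv_bndo_bndc; last by apply/measurable_EFinP; exact: measurable_funS mf.
  rewrite -{1}oppr0 ge0_integration_by_substitutionNy//; last first.
  - by apply: continuous_subspaceT => x; exact: cf.
  have -> : (\int[mu]_(x in `[0%R, +oo[) ((f \o -%R) x)%:E = (- m - - F (- 0))%:E)%E.
    apply: (@FTC_halfline _ (fun x => - F (- x))).
    - by move=> x; apply: continuous_comp; [exact: opp_continuous|exact: cf].
    - by move=> x _ /=.
    - move=> x /=; have dFx := dF (- x).
      have d1 : is_derive (x : R) 1 (fun y : R => - y) (-1) by apply: is_derive_eq.
      have d2 := @is_derive1_comp _ F (fun y : R => - y) x _ _ dFx d1.
      by apply: is_derive_eq; rewrite mulrN1 opprK.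
    - by apply: cvgN; apply/cvgy_compNP; under eq_fun do rewrite /= opprK.
  by rewrite -EFinD; congr EFin; rewrite oppr0; ring.
have If : itg f.
  apply/integrableP; split; first exact/measurable_EFinP.
  by under eq_integral do rewrite /= ger0_norm//; rewrite H ltry.
by split => //; rewrite /Rintegral H.
Qed.

Lemma integral_reflect f : itg f -> itg (fun x => f (- x)) /\ \int[mu]_x f (- x) = \int[mu]_x f x.
Proof.
move=> If; have mf := itg_meas If.
have mN : measurable_fun [set: measurableTypeR R] (-%R : R -> measurableTypeR R).
  by apply: cont_meas; exact: opp_continuous.
have E (g : R -> \bar R) : measurable_fun [set: R] g -> (forall x, 0 <= g x)%E ->
    (\int[mu]_x g (- (x : R))%R = \int[mu]_x g x)%E.
  move=> mg g0; have := @ge0_integral_pushforward _ _ _ _ R _ mN mu setT g measurableT mg.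
  rewrite preimage_setT => /(_ _)/=; move=> <- //.
  by apply: eq_measure_integral => A mA _; exact: lebesgue_measureN.
have I2 : itg (fun x => f (- x)).
  apply/integrableP; split.
    by apply/measurable_EFinP; exact: (measurableT_comp mf mN).
  rewrite /= (E (fun x => `|(f x)%:E|)%E) //.
    by case/integrableP: If.
  by apply: measurableT_comp => //; exact/measurable_EFinP.
split => //; rewrite /Rintegral; congr fine.
rewrite integralE [RHS]integralE; congr (_ - _)%E.
  have mp : measurable_fun [set: R] ((EFin \o f)^\+)%E.
    by apply: measurable_funepos; exact/measurable_EFinP.
  apply: etrans (E _ mp _); last by move=> x; exact: funepos_ge0.
  by apply: eq_integral => x _; rewrite !funeposE.
have mn : measurable_fun [set: R] ((EFin \o f)^\-)%E.
  by apply: measurable_funeneg; exact/measurable_EFinP.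
apply: etrans (E _ mn _); last by move=> x; exact: funeneg_ge0.
by apply: eq_integral => x _; rewrite !funenegE.
Qed.

Definition meas2 (F : R -> R -> R) :=
  measurable_fun [set: measurableTypeR R * measurableTypeR R] (fun z => F z.1 z.2).

(** Tonelli, integrating in [x] first, gives integrability on the product: [G] dominates the inner
    integrals of [|F x y|]. This asymmetric form suits Poisson convolutions, whose integrand is in
    general not dominated by a product. *)
Lemma Rint_fubini (F : R -> R -> R) (G : R -> R) : meas2 F ->
  (forall x, itg (F x)) -> (forall y, itg (F ^~ y)) -> itg G ->
  (forall y, \int[mu]_x `|F x y| <= G y) ->
  [/\ itg (fun x => \int[mu]_y F x y), itg (fun y => \int[mu]_x F x y)
    & \int[mu]_x (\int[mu]_y F x y) = \int[mu]_y (\int[mu]_x F x y)].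
Proof.
move=> mF I1 I2 IG FG.
pose f z := (F z.1 z.2)%:E.
have mf : measurable_fun [set: measurableTypeR R * measurableTypeR R] f.
  exact/measurable_EFinP.
have If : (mu \x mu)%E.-integrable [set: measurableTypeR R * measurableTypeR R] f.
  apply/integrable21ltyP => //.
  apply: (@le_lt_trans _ _ (\int[mu]_y (G y)%:E)%E).
    apply: ge0_le_integral => //.
    - by move=> y _; exact: integral_ge0.
    - apply: (@measurable_fun_fubini_tonelli_G _ _ _ _ R mu (fun z => `|f z|)%E) => //.
      exact: measurableT_comp.
    - by apply/measurable_EFinP; exact: itg_meas.
    move=> y _; apply: (@le_trans _ _ (\int[mu]_x `|F x y|)%:E); last by rewrite lee_fin FG.
    rewrite /Rintegral fineK//; apply: integrable_fin_num => //.
    exact: (itg_norm (I2 y)).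
  have := integrable_fin_num measurableT IG.
  by rewrite ltey_eq => ->.
have E1 x : (\int[mu]_y f (x, y) = (\int[mu]_y F x y)%:E)%E.
  by rewrite /Rintegral fineK//; exact: integrable_fin_num (I1 x).
have E2 y : (\int[mu]_x f (x, y) = (\int[mu]_x F x y)%:E)%E.
  by rewrite /Rintegral fineK//; exact: integrable_fin_num (I2 y).
split.
- have := integrable_fubini_F If; rewrite /itg; congr (mu.-integrable _ _).
  by apply/funext => x; rewrite /fubini_F E1.
- apply: (itg_dom _ _ IG); last first.
    move=> y; apply: le_trans (FG y); apply: le_normr_Rintegral => //; exact: I2.
  apply/measurable_EFinP; have := measurable_fubini_G If.
  by congr measurable_fun; apply/funext => y; rewrite /fubini_G E2.
rewrite /Rintegral; congr fine.
transitivity (\int[mu]_x \int[mu]_y f (x, y))%E.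
  by apply: eq_integral => x _; rewrite E1.
by rewrite (Fubini If); apply: eq_integral => x _; rewrite E2.
Qed.

Lemma Rint_fubini_prod (F : R -> R -> R) f g : meas2 F -> itg f -> itg g ->
  (forall x y, `|F x y| <= f x * g y) ->
  [/\ itg (fun x => \int[mu]_y F x y), itg (fun y => \int[mu]_x F x y)
    & \int[mu]_x (\int[mu]_y F x y) = \int[mu]_y (\int[mu]_x F x y)].
Proof.
move=> mF If Ig FG.
have m1 x : measurable_fun [set: R] (F x).
  exact: (measurableT_comp mF (@measurable_pair1 _ _ (measurableTypeR R) (measurableTypeR R) x)).
have m2 y : measurable_fun [set: R] (F ^~ y).
  exact: (measurableT_comp mF (@measurable_pair2 _ _ (measurableTypeR R) (measurableTypeR R) y)).
have I1 x : itg (F x) by apply: (@itg_dom _ _ (fun y => f x * g y)) => //; exact: itgZ.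
have I2 y : itg (F ^~ y).
  by apply: (@itg_dom _ _ (fun x => g y * f x)) => // [x|]; [rewrite mulrC|exact: itgZ].
apply: (@Rint_fubini _ (fun y => (\int[mu]_x f x) * g y)) => //; first exact: itgZ.
move=> y; rewrite -RintegralZr//; apply: le_Rintegral => //.
- exact: itg_norm.
- by have := itgZ (g y) If; under eq_fun do rewrite mulrC.
Qed.

End RealLine.

(** * The Poisson kernel and the Hartley transform *)

Section Poisson.
Context {R : realType}.
Notation mu := (@lebesgue_measure R).
Implicit Types (f g h F : R -> R) (c e : R).

Definition cas (t : R) : R := cos t + sin t.
(** The cosine transform of [edecay e] at frequency [t] (see [edecay_cos]): a probability density in
    [t] that concentrates at 0 as [e] tends to 0. *)
Definition poisson e (t : R) : R := 2 * e / (e ^+ 2 + (2 * pi * t) ^+ 2).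
Definition edecay e (x : R) : R := expR (- (e * `|x|)).

Lemma cas_mul (a b : R) : cas a * cas b = cos (a - b) + sin (a + b).
Proof. by rewrite /cas cosB sinD; ring. Qed.

Lemma cos_bound (x : R) : `|cos x| <= 1.
Proof. by rewrite ler_norml cos_geN1 cos_le1. Qed.

Lemma sin_bound (x : R) : `|sin x| <= 1.
Proof. by rewrite ler_norml sin_geN1 sin_le1. Qed.

Lemma cas_bound (x : R) : `|cas x| <= 2.
Proof.
rewrite (le_trans (ler_normD _ _))//.
by rewrite (_ : 2 = 1 + 1) ?lerD ?cos_bound ?sin_bound//; ring.
Qed.

Lemma continuous_cas : continuous cas.
Proof.
by move=> x; apply: cvgD; [exact: continuous_cos|exact: continuous_sin].
Qed.

Lemma continuous_mull c : continuous (fun x : R => c * x).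
Proof. by move=> x; apply: cvgMr; exact: cvg_id. Qed.

Lemma continuous_scale f c : continuous f -> continuous (fun x => f (c * x)).
Proof.
by move=> cf x; apply: (@continuous_comp _ _ _ (fun x : R => c * x)); [exact: continuous_mull|exact: cf].
Qed.

Lemma is_derive_scale f (f' c x : R) :
  is_derive (c * x) 1 f f' -> is_derive x 1 (fun y => f (c * y)) (c * f').
Proof.
move=> df; have d1 : is_derive (x : R) 1 (fun y : R => c * y) c.
  by apply: is_derive_eq; rewrite /GRing.scale /= mulr1.
have := @is_derive1_comp _ f (fun y : R => c * y) x _ _ df d1.
by rewrite mulrC.
Qed.

Lemma poisson_gt0 e t : 0 < e -> 0 < poisson e t.
Proof.
move=> e0; rewrite divr_gt0 ?mulr_gt0//.
by rewrite ltr_pwDl ?exprn_gt0// sqr_ge0.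
Qed.

Lemma poisson_ge0 e t : 0 < e -> 0 <= poisson e t.
Proof. by move=> /poisson_gt0 => /(_ t)/ltW. Qed.

Lemma poissonN e t : poisson e (- t) = poisson e t.
Proof. by rewrite /poisson mulrN sqrrN. Qed.

Lemma poissonC e x y : poisson e (x - y) = poisson e (y - x).
Proof. by rewrite -poissonN opprB. Qed.

Lemma poisson_le e t : 0 < e -> poisson e t <= 2 / e.
Proof.
move=> e0; rewrite /poisson ler_pdivrMr; last by rewrite ltr_pwDl ?exprn_gt0// sqr_ge0.
have -> : 2 / e * (e ^+ 2 + (2 * pi * t) ^+ 2) = 2 * e + 2 / e * (2 * pi * t) ^+ 2.
  by field; rewrite gt_eqF.
by rewrite lerDl mulr_ge0 ?sqr_ge0// divr_ge0// ltW.
Qed.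

Lemma continuous_poisson e : 0 < e -> continuous (poisson e).
Proof.
move=> e0 t; apply: cvgM; first exact: cvg_cst.
apply: cvgV; first by rewrite gt_eqF// ltr_pwDl ?exprn_gt0// sqr_ge0.
apply: cvgD; first exact: cvg_cst.
rewrite expr2; under eq_fun do rewrite expr2.
by apply: cvgM; exact: continuous_mull.
Qed.

Lemma is_derive_poisson e (x t : R) : 0 < e ->
  is_derive t 1 (fun y => pi^-1 * atan (2 * pi / e * (y - x))) (poisson e (t - x)).
Proof.
move=> e0; have p0 := pi_gt0 R.
have d1 : is_derive t 1 (fun y : R => 2 * pi / e * (y - x)) (2 * pi / e).
  by apply: is_derive_eq; rewrite /GRing.scale /= subr0 mulr1.
have d2 := @is_derive1_comp _ atan (fun y : R => 2 * pi / e * (y - x)) t _ _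
  (is_derive1_atan _) d1.
apply: is_derive_eq; rewrite /GRing.scale /= /poisson.
have H1 : e ^+ 2 + (2 * pi * (t - x)) ^+ 2 != 0 by rewrite gt_eqF// ltr_pwDl ?exprn_gt0// sqr_ge0.
have H2 : 1 + (2 * pi / e * (t - x)) ^+ 2 != 0 by rewrite gt_eqF// ltr_pwDl// sqr_ge0.
have H3 : 1 + (2 * pi / e * (t - x)) ^+ 2 = (e ^+ 2 + (2 * pi * (t - x)) ^+ 2) / e ^+ 2.
  by field; rewrite gt_eqF.
rewrite H3; clear H2 H3 d1 d2; move: H1; move: (e ^+ 2 + _) => q H1.
by move: (pi) p0 => p p0; field; rewrite H1 !gt_eqF.
Qed.

Lemma cvgy_affine c x : 0 < c -> (c * (y - x)) @[y --> +oo] --> +oo.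
Proof. by move=> c0; apply: gt0_cvgMry => //; exact: cvg_addrr. Qed.

Lemma poisson_int e x : 0 < e ->
  itg (fun y => poisson e (y - x)) /\ \int[mu]_y poisson e (y - x) = 1.
Proof.
move=> e0; have p0 := pi_gt0 R.
have -> : 1 = pi^-1 * (pi / 2) - (pi^-1 * (- (pi / 2))) :> R.
  by rewrite mulrN opprK -mulrDr -splitr mulVf// gt_eqF.
have c0 : 0 < 2 * pi / e by rewrite divr_gt0// mulr_gt0.
apply: FTC_line.
- by move=> y; apply: (@continuous_comp _ _ _ (fun y => y - x) (poisson e));
    [apply: cvgB; [exact: cvg_id|exact: cvg_cst]|exact: continuous_poisson].
- by move=> y; exact: poisson_ge0.
- by move=> t; exact: is_derive_poisson.
- by apply: cvgMr; apply: cvg_comp (cvgy_affine x c0) (@cvgy_atan R).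
- apply: cvgMr; apply/cvgNy_compNP => /=.
  have -> : (fun y : R => atan (2 * pi / e * (- y - x))) = (fun y => - atan (2 * pi / e * (y - (- x)))).
    by apply/funext => y; rewrite -atanN; congr atan; ring.
  by apply: cvgN; apply: cvg_comp (cvgy_affine _ c0) (@cvgy_atan R).
Qed.

Lemma itg_poisson_mul e x g : 0 < e -> L2 g -> itg (fun y => poisson e (x - y) * g y).
Proof.
move=> e0 Lg; have [I1 _] := poisson_int x e0.
have cP : continuous (fun y => poisson e (x - y)).
  move=> y; apply: (@continuous_comp _ _ _ (fun y => x - y) (poisson e)).
    by apply: cvgB; [exact: cvg_cst|exact: cvg_id].
  exact: continuous_poisson.
apply: L2_itgM => //; split; first exact: cont_meas.
apply: (@itg_dom _ _ (fun y => 2 / e * poisson e (y - x))); last exact: itgZ.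
  by apply: meas_sq; exact: cont_meas.
move=> y; rewrite normrX ger0_norm ?poisson_ge0// expr2 [in leRHS]poissonC.
by rewrite ler_wpM2r ?poisson_ge0 ?poisson_le.
Qed.

Lemma exp_bounded_cvg0 e (b : R -> R) (K : R) : 0 < e -> (forall x, `|b x| <= K) ->
  expR (- (e * x)) * b x @[x --> +oo] --> 0.
Proof.
move=> e0 bK.
have E0 : expR (- (e * x)) @[x --> +oo] --> 0.
  apply: (@cvg_comp _ _ _ (fun x => e * x) (fun x => expR (- x))); last exact: cvgr_expR.
  by apply: gt0_cvgMry => //; exact: cvg_id.
apply: (@squeeze_cvgr _ _ _ _ (fun x => - (K * expR (- (e * x)))) (fun x => K * expR (- (e * x)))).
- apply: nearW => x; rewrite -ler_norml normrM (ger0_norm (expR_ge0 _)) mulrC.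
  by rewrite ler_wpM2r ?expR_ge0.
- by rewrite -[X in _ --> X]oppr0 -(mulr0 K); apply: cvgN; apply: cvgMr.
- by rewrite -(mulr0 K); apply: cvgMr.
Qed.

Lemma continuous_edecay e : continuous (edecay e).
Proof.
move=> x; apply: (@continuous_comp _ _ _ (fun x => - (e * `|x|)) expR); last exact: continuous_expR.
by apply: cvgN; apply: cvgMr; exact: norm_continuous.
Qed.

(** Adding 1 makes the integrand nonnegative, so that the fundamental theorem on the half-line
    yields integrability and value together; [edecay_cos] subtracts the 1 again. *)
Lemma edecay_cos1 e c : 0 < e ->
  itg (fun x => edecay e x * (1 + cos (c * x))) /\
  \int[mu]_x (edecay e x * (1 + cos (c * x))) = 2 * (e^-1 + e / (e ^+ 2 + c ^+ 2)).
Proof.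
move=> e0.
have d0 : 0 < e ^+ 2 + c ^+ 2 by rewrite ltr_pwDl ?exprn_gt0// sqr_ge0.
have cc : continuous (fun x : R => 1 + cos (c * x)).
  move=> x; apply: cvgD; first exact: cvg_cst.
  exact: (continuous_scale (@continuous_cos R)).
have f0 x : 0 <= 1 + cos (c * x) by rewrite -lerBlDl sub0r cos_geN1.
have cf : continuous (fun x => edecay e x * (1 + cos (c * x))).
  by move=> x; apply: cvgM; [exact: continuous_edecay|exact: cc].
have H : (\int[mu]_x (edecay e x * (1 + cos (c * x)))%:E
    = (2 * (e^-1 + e / (e ^+ 2 + c ^+ 2)))%:E)%E.
  rewrite ge0_symfun_integralT//; last 2 first.
  - by move=> x; rewrite mulr_ge0// expR_ge0.
  - by move=> x /=; rewrite /edecay normrN mulrN cosN.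
  rewrite EFinM; congr (_ * _)%E; rewrite -set_itvcy.
  have -> : (\int[mu]_(x in `[0%R, +oo[) (edecay e x * (1 + cos (c * x)))%:E
      = \int[mu]_(x in `[0%R, +oo[) (expR (- (e * x)) * (1 + cos (c * x)))%:E)%E.
    apply: eq_integral => x; rewrite inE/= in_itv/= andbT => x0.
    by rewrite /edecay ger0_norm.
  (* The primitive that vanishes at infinity. *)
  pose F (x : R) := expR (- (e * x)) *
    (- e^-1 + (c * sin (c * x) - e * cos (c * x)) / (e ^+ 2 + c ^+ 2)).
  have -> : e^-1 + e / (e ^+ 2 + c ^+ 2) = 0 - F 0.
    by rewrite /F !mulr0 oppr0 expR0 sin0 cos0; ring.
  apply: FTC_halfline.
  - move=> x; apply: cvgM; last exact: cc.
    apply: (@continuous_comp _ _ _ (fun x => - (e * x)) expR); last exact: continuous_expR.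
    by apply: cvgN; exact: continuous_mull.
  - by move=> x _; rewrite mulr_ge0// expR_ge0.
  - move=> x; have := @is_derive_scale expR _ (- e) x (is_derive_expR _).
    under eq_fun do rewrite mulNr.
    move=> d1; have d2 := @is_derive_scale sin _ c x (is_derive_sin _).
    have d3 := @is_derive_scale cos _ c x (is_derive_cos _).
    apply: is_derive_eq; rewrite /GRing.scale /=.
    by rewrite !mulNr; field; rewrite !gt_eqF.
  - apply: (@exp_bounded_cvg0 _ _ (e^-1 + (`|c| + e) / (e ^+ 2 + c ^+ 2))) => // x.
    rewrite (le_trans (ler_normD _ _))// normrN gtr0_norm ?invr_gt0// lerD2l.
    rewrite normrM (gtr0_norm (_ : 0 < (_ : R)^-1)) ?invr_gt0// ler_wpM2r ?invr_ge0 ?(ltW d0)//.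
    rewrite (le_trans (ler_normB _ _))// !normrM lerD//.
      by rewrite ler_piMr// sin_bound.
    by rewrite gtr0_norm// ler_piMr ?cos_bound// ltW.
split; last by rewrite /Rintegral H.
apply/integrableP; split; first by apply/measurable_EFinP; exact: cont_meas.
under eq_integral do rewrite /= ger0_norm ?mulr_ge0 ?expR_ge0//.
by rewrite H ltry.
Qed.

Lemma itg_edecay e : 0 < e -> itg (edecay e).
Proof.
move=> e0; have [I1 _] := edecay_cos1 0 e0.
apply: itg_dom I1; first by apply: cont_meas; exact: continuous_edecay.
by move=> x; rewrite mul0r cos0 ger0_norm ?expR_ge0// ler_peMr ?expR_ge0// lerDl.
Qed.

Lemma edecay_int e : 0 < e -> \int[mu]_x edecay e x = 2 / e.
Proof.
move=> e0; have [_ E] := edecay_cos1 0 e0.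
have I0 := itg_edecay e0.
have : \int[mu]_x (2 * edecay e x) = 4 / e.
  have -> : 4 / e = 2 * (e^-1 + e / (e ^+ 2 + 0 ^+ 2)) by field; rewrite gt_eqF.
  by rewrite -E; apply: eq_Rintegral => x _; rewrite mul0r cos0 mulrC.
rewrite RintegralZl// => H; have : 2 * (\int[mu]_x edecay e x) = 2 * (2 / e).
  by rewrite H; field; rewrite gt_eqF.
by apply: mulfI.
Qed.

Lemma edecay_cos e c : 0 < e ->
  itg (fun x => edecay e x * cos (c * x)) /\
  \int[mu]_x (edecay e x * cos (c * x)) = 2 * e / (e ^+ 2 + c ^+ 2).
Proof.
move=> e0; have [I1 E1] := edecay_cos1 c e0.
have I0 := itg_edecay e0.
have d0 : 0 < e ^+ 2 + c ^+ 2 by rewrite ltr_pwDl ?exprn_gt0// sqr_ge0.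
have E x : edecay e x * cos (c * x) = edecay e x * (1 + cos (c * x)) - edecay e x by ring.
under eq_fun do rewrite E; split; first exact: itgB.
rewrite RintegralB// E1 edecay_int//.
by field; rewrite !gt_eqF.
Qed.

Lemma edecay_sin e c : 0 < e ->
  itg (fun x => edecay e x * sin (c * x)) /\
  \int[mu]_x (edecay e x * sin (c * x)) = 0.
Proof.
move=> e0; have I1 : itg (fun x => edecay e x * sin (c * x)).
  apply: itg_dom (itg_edecay e0).
    apply: cont_meas => x; apply: cvgM; first exact: continuous_edecay.
    exact: (continuous_scale (@continuous_sin R)).
  move=> x; rewrite normrM (ger0_norm (expR_ge0 _)) ler_piMr ?expR_ge0//.
  exact: sin_bound.
split => //; have [_ ] := integral_reflect I1.
have -> : \int[mu]_x (edecay e (- x) * sin (c * - x)) = - \int[mu]_x (edecay e x * sin (c * x)).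
  rewrite -mulN1r -RintegralZl//; apply: eq_Rintegral => x _.
  by rewrite /edecay normrN mulrN sinN; ring.
lra.
Qed.

(** The product of the two kernels is a cosine of the difference plus a sine of the sum; against the
    even weight the sine integrates to 0. *)
Lemma edecay_cas e v w : 0 < e ->
  \int[mu]_x (edecay e x * (cas (2 * pi * v * x) * cas (2 * pi * w * x))) = poisson e (v - w).
Proof.
move=> e0; have [I1 E1] := edecay_cos (2 * pi * (v - w)) e0.
have [I2 E2] := edecay_sin (2 * pi * (v + w)) e0.
rewrite -[RHS]addr0 -[in RHS]E2 /poisson -E1 -RintegralD//.
apply: eq_Rintegral => x _; rewrite cas_mul mulrDr.
by congr (_ * cos _ + _ * sin _); ring.
Qed.

End Poisson.

(** * The Hartley transform and Poisson means *)

Section Hartley.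
Context {R : realType}.
Notation mu := (@lebesgue_measure R).
Implicit Types (f g h a b : R -> R) (c e : R).

(** With the kernel [cas] and frequency [2 pi w] the transform is real and its own inverse, so the
    same operator serves for analysis and for synthesis. *)
Definition hartley f (w : R) : R := \int[mu]_x (f x * cas (2 * pi * w * x)).
Definition conv_poisson e a (v : R) : R := \int[mu]_w (poisson e (v - w) * a w).

Lemma meas2_fst f : measurable_fun [set: R] f -> @meas2 R (fun x y => f x).
Proof. by move=> mf; apply: (measurableT_comp mf); exact: measurable_fst. Qed.

Lemma meas2_snd f : measurable_fun [set: R] f -> @meas2 R (fun x y => f y).
Proof. by move=> mf; apply: (measurableT_comp mf); exact: measurable_snd. Qed.

Lemma meas2M F G : @meas2 R F -> meas2 G -> meas2 (fun x y => F x y * G x y).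
Proof. by move=> mF mG; apply: measurable_funM. Qed.

Lemma meas2_comp f F : measurable_fun [set: R] f -> @meas2 R F -> meas2 (fun x y => f (F x y)).
Proof. by move=> mf mF; apply: (measurableT_comp mf). Qed.

Lemma meas2_cas : @meas2 R (fun x y => cas (2 * pi * x * y)).
Proof.
apply: (@meas2_comp cas (fun x y => 2 * pi * x * y)).
  by apply: cont_meas; exact: continuous_cas.
apply: (@meas2M (fun x y => 2 * pi * x) (fun x y => y)); last exact: meas2_snd.
by apply: (@meas2_fst (fun x => 2 * pi * x)); apply: cont_meas; exact: continuous_mull.
Qed.

Lemma meas2_cas_sym : @meas2 R (fun x y => cas (2 * pi * y * x)).
Proof.
have := meas2_cas; congr meas2; apply/funext => x; apply/funext => y.
by congr cas; ring.
Qed.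

Lemma meas2_poisson e : 0 < e -> @meas2 R (fun x y => poisson e (x - y)).
Proof.
move=> e0; apply: (@meas2_comp (poisson e) (fun x y => x - y)).
  by apply: cont_meas; exact: continuous_poisson.
by apply: measurable_funB; [exact: measurable_fst|exact: measurable_snd].
Qed.

Lemma meas_cas (w : R) : measurable_fun [set: R] (fun x => cas (2 * pi * w * x)).
Proof. by apply: cont_meas; exact: (continuous_scale continuous_cas). Qed.

Lemma casC (w x : R) : cas (2 * pi * w * x) = cas (2 * pi * x * w).
Proof. by congr cas; ring. Qed.

Lemma itg_cas f (w : R) : itg f -> itg (fun x => f x * cas (2 * pi * w * x)).
Proof.
move=> If; have := @itg_bounded_mul _ _ _ 2 (meas_cas w) (fun x => cas_bound _) If.
by under eq_fun do rewrite mulrC.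
Qed.

(** Fubini with a bounded kernel that is symmetric in its two variables: the transform is its own
    adjoint. *)
Lemma hartley_mult f g : itg f -> itg g ->
  itg (fun x => f x * hartley g x) /\
  \int[mu]_x (f x * hartley g x) = \int[mu]_x (hartley f x * g x).
Proof.
move=> If Ig.
pose F x y := f x * g y * cas (2 * pi * x * y).
have mF : meas2 F.
  apply: (@meas2M (fun x y => f x * g y)); last exact: meas2_cas.
  apply: (@meas2M (fun x y => f x) (fun x y => g y)).
    by apply: (@meas2_fst f); exact: itg_meas.
  by apply: (@meas2_snd g); exact: itg_meas.
have FG x y : `|F x y| <= (2 * `|f x|) * `|g y|.
  rewrite (_ : F x y = cas (2 * pi * x * y) * f x * g y); last by rewrite /F; ring.
  by rewrite !normrM; do 2 apply: ler_wpM2r => //; exact: cas_bound.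
have [I1 I2 E] := Rint_fubini_prod mF (itgZ 2 (itg_norm If)) (itg_norm Ig) FG.
have E1 x : \int[mu]_y F x y = f x * hartley g x.
  rewrite -IntZl; last exact: itg_cas.
  by apply: Int_ext => y; rewrite /F mulrA.
have E2 y : \int[mu]_x F x y = hartley f y * g y.
  rewrite mulrC -IntZl; last exact: itg_cas.
  by apply: Int_ext => x; rewrite /F casC; ring.
split; first by move: I1; congr itg; apply/funext => x; rewrite E1.
transitivity (\int[mu]_x \int[mu]_y F x y).
  by apply: Int_ext => x; rewrite E1.
by rewrite E; apply: Int_ext => y; rewrite E2.
Qed.

Lemma hartley_bound f (x : R) : itg f -> `|hartley f x| <= 2 * \int[mu]_w `|f w|.
Proof.
move=> If; apply: le_trans (norm_Int (itg_cas _ If)) _.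
rewrite -IntZl; last exact: itg_norm.
apply: le_Int; [exact/itg_norm/itg_cas|exact/itgZ/itg_norm|].
by move=> w; rewrite normrM mulrC ler_wpM2r// cas_bound.
Qed.

(** Fubini already gives measurability of the transform times a decaying weight; dividing by this
    positive continuous weight removes it. *)
Lemma hartley_meas f : itg f -> measurable_fun [set: R] (hartley f).
Proof.
move=> If; have [I1 _] := hartley_mult (itg_edecay (@ltr01 R)) If.
have -> : hartley f = (fun x => (edecay 1 x)^-1 * (edecay 1 x * hartley f x)).
  by apply/funext => x; rewrite mulKf// gt_eqF// expR_gt0.
apply: measurable_funM; last exact: itg_meas.
apply: cont_meas => x; apply: cvgV; last exact: continuous_edecay.
by rewrite gt_eqF// expR_gt0.
Qed.

Lemma edecay_le1 e (x : R) : 0 <= e -> edecay e x <= 1.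
Proof. by move=> e0; rewrite /edecay -expR0 ler_expR oppr_le0 mulr_ge0. Qed.

(** Regularised inversion. The weight makes the double integral absolutely convergent, and
    [edecay_cas] evaluates the inner integral as the Poisson kernel. *)
Lemma edecay_hartley e a (v : R) : 0 < e -> itg a ->
  itg (fun x => edecay e x * hartley a x) /\
  hartley (fun x => edecay e x * hartley a x) v = conv_poisson e a v.
Proof.
move=> e0 Ia.
have mE : measurable_fun [set: R] (edecay e) by apply: cont_meas; exact: continuous_edecay.
split; first by have [] := hartley_mult (itg_edecay e0) Ia.
pose F x w := a w * (edecay e x * (cas (2 * pi * v * x) * cas (2 * pi * w * x))).
have mF : meas2 F.
  apply: (@meas2M (fun x w => a w)); first by apply: (@meas2_snd a); exact: itg_meas.
  apply: (@meas2M (fun x w => edecay e x)); first exact: (@meas2_fst (edecay e)).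
  apply: (@meas2M (fun x w => cas (2 * pi * v * x))); last exact: meas2_cas_sym.
  by apply: (@meas2_fst (fun x => cas (2 * pi * v * x))); exact: meas_cas.
have FG x w : `|F x w| <= edecay e x * (4 * `|a w|).
  rewrite (_ : F x w = edecay e x * (cas (2 * pi * v * x) * cas (2 * pi * w * x) * a w)); last by rewrite /F; ring.
  rewrite !normrM (ger0_norm (expR_ge0 _)); apply: ler_wpM2l; first exact: expR_ge0.
  apply: ler_wpM2r => //; rewrite (_ : 4 = 2 * 2); last by ring.
  by apply: ler_pM => //; exact: cas_bound.
have [I1 I2 E] := Rint_fubini_prod mF (itg_edecay e0) (itgZ 4 (itg_norm Ia)) FG.
transitivity (\int[mu]_x \int[mu]_w F x w).
  apply: Int_ext => x; rewrite /hartley -IntZl; last exact: itg_cas.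
  rewrite -IntZr; last exact/itgZ/itg_cas.
  by apply: Int_ext => w; rewrite /F casC; ring.
rewrite E; apply: Int_ext => w; rewrite IntZl; last first.
  rewrite (_ : (fun x => _) = (fun x => cas (2 * pi * v * x) * cas (2 * pi * w * x) * edecay e x)).
    apply: (@itg_bounded_mul _ _ _ 4); last exact: itg_edecay.
      by apply: measurable_funM; exact: meas_cas.
    move=> x; rewrite normrM (_ : 4 = 2 * 2); last by ring.
    by rewrite ler_pM ?cas_bound.
  by apply/funext => x; rewrite mulrC.
by rewrite edecay_cas// mulrC.
Qed.

(** The kernel is a probability density in either variable: by Cauchy-Schwarz the square of a mean
    is at most the mean of the squares, and integrating over [v] gives the norm bound. Measurability
    comes from writing the mean as a transform. *)
Lemma conv_poisson_meas e a : 0 < e -> itg a -> L2 a ->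
  [/\ L2 (conv_poisson e a) & dot (conv_poisson e a) (conv_poisson e a) <= dot a a].
Proof.
move=> e0 Ia La.
have mconv : measurable_fun [set: R] (conv_poisson e a).
  have [I1 _] := edecay_hartley 0 e0 Ia.
  rewrite (_ : conv_poisson e a = hartley (fun x => edecay e x * hartley a x)).
    exact: hartley_meas.
  by apply/funext => v; have [_ ->] := edecay_hartley v e0 Ia.
have [ma Isq] := La.
pose F v w := poisson e (v - w) * a w ^+ 2.
have mF : meas2 F.
  apply: (@meas2M (fun v w => poisson e (v - w))); first exact: meas2_poisson.
  by apply: (@meas2_snd (fun w => a w ^+ 2)); exact: meas_sq.
have IFv v : itg (F v).
  apply: (@itg_bounded_mul _ _ _ (2 / e)) => //.
    apply: cont_meas => y; apply: (@continuous_comp _ _ _ (fun y => v - y) (poisson e)).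
      by apply: cvgB; [exact: cvg_cst|exact: cvg_id].
    exact: continuous_poisson.
  by move=> w; rewrite ger0_norm ?poisson_ge0// poisson_le.
have IFw w : itg (F ^~ w).
  have [I1 _] := poisson_int w e0.
  have := itgZ (a w ^+ 2) I1; congr itg; apply/funext => v; exact: mulrC.
have EFw w : \int[mu]_v F v w = a w ^+ 2.
  have [I1 E1] := poisson_int w e0.
  by rewrite IntZr// E1 mul1r.
have FG w : \int[mu]_v `|F v w| <= a w ^+ 2.
  rewrite -EFw le_eqVlt; apply/orP; left; apply/eqP; apply: eq_Rintegral => v _.
  by rewrite ger0_norm// mulr_ge0 ?poisson_ge0 ?sqr_ge0.
have [I1 I2 E] := Rint_fubini mF IFv IFw Isq FG.
have key v : conv_poisson e a v ^+ 2 <= \int[mu]_w F v w.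
  pose s w := Num.sqrt (poisson e (v - w)).
  have ss w : s w ^+ 2 = poisson e (v - w) by rewrite sqr_sqrtr// poisson_ge0.
  have ms : measurable_fun [set: R] s.
    apply: cont_meas => y; apply: continuous_comp; last exact: sqrt_continuous.
    apply: (@continuous_comp _ _ _ (fun y => v - y) (poisson e)).
      by apply: cvgB; [exact: cvg_cst|exact: cvg_id].
    exact: continuous_poisson.
  have [J1 J2] := poisson_int v e0.
  have Ls : L2 s.
    split => //; move: J1; congr itg; apply/funext => w.
    by rewrite ss poissonC.
  have Lsa : L2 (fun w => s w * a w).
    split; first exact: measurable_funM.
    move: (IFv v); congr itg; apply/funext => w.
    by rewrite exprMn ss.
  have := cauchy_schwarz Ls Lsa.
  have -> : dot s (fun w => s w * a w) = conv_poisson e a v.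
    by apply: Int_ext => w; rewrite mulrA -expr2 ss.
  have n1 : nrm s = 1.
    rewrite /nrm -(sqrtr1 R); congr Num.sqrt; rewrite -J2.
    by apply: Int_ext => w; rewrite -expr2 ss poissonC.
  rewrite n1 mul1r => H.
  have -> : \int[mu]_w F v w = nrm (fun w => s w * a w) ^+ 2.
    rewrite sqr_nrm; apply: Int_ext => w.
    by rewrite -expr2 exprMn ss.
  by rewrite -[leLHS]ger0_norm ?sqr_ge0// normrX lerXn2r ?nnegrE ?nrm_ge0.
have Isq2 : itg (fun v => conv_poisson e a v ^+ 2).
  apply: itg_dom I1; first exact: meas_sq.
  by move=> v; rewrite ger0_norm ?sqr_ge0.
split; first by [].
have -> : dot (conv_poisson e a) (conv_poisson e a) = \int[mu]_v (conv_poisson e a v ^+ 2).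
  by apply: Int_ext => v; rewrite expr2.
apply: le_trans (le_Int Isq2 I1 key) _.
rewrite E le_eqVlt; apply/orP; left; apply/eqP.
by apply: Int_ext => w; rewrite EFw expr2.
Qed.

(** Plancherel's identity at positive [e], before the limit: self-adjointness followed by
    regularised inversion. *)
Lemma edecay_hartley_dot e a : 0 < e -> itg a -> L2 a ->
  \int[mu]_x (edecay e x * hartley a x ^+ 2) = dot a (conv_poisson e a).
Proof.
move=> e0 Ia La; have [I1 _] := edecay_hartley 0 e0 Ia.
have [_ E] := hartley_mult I1 Ia.
rewrite dotC /dot.
rewrite [RHS](_ : _ = \int[mu]_x (hartley (fun x => edecay e x * hartley a x) x * a x)).
  rewrite -E; apply: Int_ext => x; ring.
apply: Int_ext => x.
by have [_ ->] := edecay_hartley x e0 Ia.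
Qed.

Definition eps (n : nat) : R := n.+1%:R^-1.

Lemma eps_gt0 n : 0 < eps n. Proof. by rewrite invr_gt0. Qed.

Lemma eps_le1 n : eps n <= 1.
Proof. by rewrite invf_le1// ler1n. Qed.

Lemma eps_cvg : eps @ \oo --> 0. Proof. exact: cvg_harmonic. Qed.

(** Approximate identity at a point of continuity. Within distance [d] the oscillation of [g] is
    small; beyond it the kernel is at most [e / c] times the kernel with parameter 1, whose integral
    against |g - g x| is the fixed number [K]. *)
Lemma conv_poisson_cvg g (x : R) : L2 g -> {for x, continuous g} ->
  conv_poisson ^~ g ^~ x \o eps @ \oo --> g x.
Proof.
move=> Lg cg; apply/cvgrPdist_lt => /= eta eta0.
have e20 : 0 < eta / 2 by rewrite divr_gt0.
move/cvgrPdist_lt: cg => /(_ _ e20) /nbhs_ballP[d /= d0 Hd].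
(* With p and q the squares of 2 pi d and 2 pi (x - y), this is p / (1 + p); then p (1 + q) <= (1 +
   p) (e^2 + q) as soon as p <= q, which is the comparison of kernels far from [x]. *)
pose c := (2 * pi * d) ^+ 2 / (1 + (2 * pi * d) ^+ 2).
have p0 := pi_gt0 R.
have pd : 0 < (2 * pi * d) ^+ 2 by rewrite exprn_gt0// !mulr_gt0.
have c0 : 0 < c by rewrite divr_gt0// addr_gt0.
have IP e : 0 < e -> itg (fun y => poisson e (x - y)) /\ \int[mu]_y poisson e (x - y) = 1.
  move=> e0; have [I1 E1] := poisson_int x e0.
  have H : (fun y => poisson e (x - y)) = (fun y => poisson e (y - x)).
    by apply/funext => y; rewrite poissonC.
  by rewrite H.
have IPg e : 0 < e -> itg (fun y => poisson e (x - y) * (g y - g x)).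
  move=> e0; have [I1 E1] := IP e e0.
  under eq_fun do rewrite mulrBr.
  apply: itgB; first exact: itg_poisson_mul.
  by under eq_fun do rewrite mulrC; exact: itgZ.
pose K := \int[mu]_y `|poisson 1 (x - y) * (g y - g x)|.
have K0 : 0 <= K by exact: Rintegral_ge0.
have main e : 0 < e -> e <= 1 -> `|conv_poisson e g x - g x| <= eta / 2 + e / c * K.
  move=> e0 e1; have [I1 E1] := IP e e0.
  have -> : conv_poisson e g x - g x = \int[mu]_y (poisson e (x - y) * (g y - g x)).
    rewrite -[in LHS](mul1r (g x)) -E1 -IntZr// -IntB//; last first.
    - by under eq_fun do rewrite mulrC; exact: itgZ.
    - exact: itg_poisson_mul.
    by apply: Int_ext => y; rewrite mulrBr.
  apply: le_trans (norm_Int (IPg e e0)) _.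
  have -> : eta / 2 = eta / 2 * \int[mu]_y poisson e (x - y) by rewrite E1 mulr1.
  rewrite /K -(IntZl _ I1) -(IntZl _ (itg_norm (IPg 1 ltr01))).
  rewrite -IntD//; [|exact: itgZ|exact/itgZ/itg_norm/IPg].
  have pt (y : R) : `|poisson e (x - y) * (g y - g x)| <=
      eta / 2 * poisson e (x - y) + e / c * `|poisson 1 (x - y) * (g y - g x)|.
    have nP e' : 0 < e' -> `|poisson e' (x - y) * (g y - g x)| = poisson e' (x - y) * `|g y - g x|.
      by move=> ?; rewrite normrM ger0_norm// poisson_ge0.
    rewrite !nP//.
  have [xy|xy] := ltP `|x - y| d.
    rewrite (@le_trans _ _ (eta / 2 * poisson e (x - y)))//.
      rewrite mulrC ler_wpM2r ?poisson_ge0//; apply: ltW; rewrite distrC.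
      by apply: Hd; rewrite -ball_normE.
    rewrite lerDl; apply: mulr_ge0; first by rewrite divr_ge0 ?(ltW e0) ?(ltW c0).
      by apply: mulr_ge0 => //; exact: poisson_ge0.
  rewrite (@le_trans _ _ (e / c * (poisson 1 (x - y) * `|g y - g x|)))//; last first.
    by rewrite lerDr; apply: mulr_ge0; [exact: ltW|exact: poisson_ge0].
  rewrite mulrA ler_wpM2r// /poisson.
  set t := x - y.
  have td : (2 * pi * d) ^+ 2 <= (2 * pi * t) ^+ 2.
    rewrite -[leRHS]ger0_norm ?sqr_ge0// normrX lerXn2r ?nnegrE ?mulr_ge0 ?(ltW p0) ?(ltW d0)//.
    by rewrite normrM ger0_norm ?mulr_ge0 ?(ltW p0)// ler_wpM2l ?mulr_ge0 ?(ltW p0).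
  rewrite /c; move: td pd; set q := (2 * pi * t) ^+ 2; set p := (2 * pi * d) ^+ 2 => td pd.
  have q0 : 0 < q by exact: lt_le_trans td.
  have -> : e / (p / (1 + p)) * (2 * 1 / (1 ^+ 2 + q)) = 2 * e * ((1 + p) / p / (1 + q)).
    by field; rewrite !gt_eqF// addr_gt0.
  rewrite ler_wpM2l ?mulr_ge0 ?(ltW e0)// ler_pdivlMr ?addr_gt0// mulrC.
  rewrite ler_pdivrMr; last by rewrite addr_gt0// exprn_gt0.
  rewrite mulrAC ler_pdivlMr//.
  have := sqr_ge0 e; nra.
  apply: le_Int.
  - exact/itg_norm/IPg.
  - by apply: itgD; [exact: itgZ|exact/itgZ/itg_norm/IPg].
  - exact: pt.
have [N _ HN] : \forall n \near \oo, eps n < eta / 2 / (K + 1) * c.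
  have /cvgr0_norm_lt : eps @ \oo --> 0 by exact: eps_cvg.
  have E0 : 0 < eta / 2 / (K + 1) * c by rewrite mulr_gt0// divr_gt0//; lra.
  move=> /(_ _ E0); apply: filterS => n; by rewrite gtr0_norm ?eps_gt0.
exists N => // n Nn /=; rewrite distrC (le_lt_trans (main _ (eps_gt0 n) (eps_le1 n)))//.
rewrite [ltRHS]splitr ltrD2l.
have := HN n Nn; rewrite -ltr_pdivrMr// ltr_pdivlMr; last by lra.
apply: le_lt_trans; rewrite ler_wpM2l ?divr_ge0 ?(ltW c0) ?(ltW (eps_gt0 n))//; lra.
Qed.

End Hartley.

(** * Band-limited functions *)

Section BandSpace.
Context {R : realType}.
Notation mu := (@lebesgue_measure R).
Implicit Types (f g h a b : R -> R) (c e W : R).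

(** Open, so that a continuous function cut off to the band is still continuous at every point of
    it. *)
Definition band W : set (measurableTypeR R) := `]- W, W[%classic.
Definition in_band W a := L2 a /\ forall w, ~ band W w -> a w = 0.

Lemma measurable_band W : measurable (band W).
Proof. exact: measurable_itv. Qed.

Lemma band_lty W : (mu (band W) < +oo)%E.
Proof.
rewrite /band lebesgue_measure_itv/=; case: ifP => // _.
by rewrite -EFinB ltry.
Qed.

Lemma itg_indic (D : set (measurableTypeR R)) : measurable D -> (mu D < +oo)%E -> itg (\1_D : R -> R).
Proof.
move=> mD Dy; apply/integrableP; split.
  by apply/measurable_EFinP; exact: measurable_indic.
under eq_integral do rewrite /= ger0_norm//.
by rewrite integral_indic// setIT.
Qed.

Lemma itg_restrict (D : set (measurableTypeR R)) f : measurable D -> mu.-integrable D (EFin \o f) ->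
  itg (fun x => \1_D x * f x) /\ \int[mu]_x (\1_D x * f x) = \int[mu]_(x in D) f x.
Proof.
move=> mD If; have E : (fun x => \1_D x * f x) = f \_ D.
  by apply/funext => x; rewrite patchE indicE; case: ifP; rewrite ?mul1r ?mul0r.
split; last by rewrite [RHS]Rintegral_mkcond -E.
by rewrite /itg E -restrict_EFin; apply/integrable_restrict => //=; rewrite setTI.
Qed.

Lemma itg_restrict_inv (D : set (measurableTypeR R)) f : measurable D -> itg f -> mu.-integrable D (EFin \o f).
Proof. by move=> mD; apply: integrableS. Qed.

Lemma indic_sqr (D : set (measurableTypeR R)) (x : R) : \1_D x * \1_D x = \1_D x :> R.
Proof. by rewrite indicE; case: (_ \in _); rewrite ?mulr1 ?mulr0. Qed.

Lemma indic_in (D : set (measurableTypeR R)) (x : R) : D x -> \1_D x = 1 :> R.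
Proof. by move=> Dx; rewrite indicE mem_set. Qed.

Lemma indic_out (D : set (measurableTypeR R)) (x : R) : ~ D x -> \1_D x = 0 :> R.
Proof. by move=> Dx; rewrite indicE memNset. Qed.

Lemma L2_indic1 (D : set (measurableTypeR R)) : measurable D -> (mu D < +oo)%E -> L2 (\1_D : R -> R).
Proof.
move=> mD Dy; split; first exact: measurable_indic.
have := itg_indic mD Dy; congr itg; apply/funext => x.
by rewrite expr2 indic_sqr.
Qed.

Lemma L2_band_bounded W f (M : R) : measurable_fun [set: R] f ->
  (forall x, `|f x| <= M) -> L2 (fun x => \1_(band W) x * f x).
Proof.
move=> mf fM; have M0 : 0 <= M by exact: le_trans (fM 0).
apply: (@L2_dom _ _ (fun x => M * \1_(band W) x)).
- by apply: measurable_funM => //; apply: measurable_indic; exact: measurable_band.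
- move=> x; rewrite !normrM mulrC ler_wpM2r// (le_trans (fM x))//.
  by rewrite ger0_norm.
- by apply/L2Z/L2_indic1; [exact: measurable_band|exact: band_lty].
Qed.

Lemma in_band_indic W a : in_band W a -> a = (fun x => \1_(band W) x * a x).
Proof.
move=> [_ a0]; apply/funext => x; have [Bx|Bx] := pselect (band W x).
  by rewrite indic_in// mul1r.
by rewrite a0// mulr0.
Qed.

Lemma in_band_itg W a : in_band W a -> itg a.
Proof.
move=> Va; rewrite (in_band_indic Va); apply: L2_itgM; last by case: Va.
by apply: L2_indic1; [exact: measurable_band|exact: band_lty].
Qed.

Lemma in_band_L2 W a : in_band W a -> L2 a. Proof. by case. Qed.

Lemma in_bandD W a b : in_band W a -> in_band W b -> in_band W (fun x => a x + b x).
Proof.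
move=> [La a0] [Lb b0]; split; first exact: L2D.
by move=> w Bw; rewrite a0// b0// addr0.
Qed.

Lemma in_bandZ W c a : in_band W a -> in_band W (fun x => c * a x).
Proof.
move=> [La a0]; split; first exact: L2Z.
by move=> w Bw; rewrite a0// mulr0.
Qed.

Lemma in_bandB W a b : in_band W a -> in_band W b -> in_band W (fun x => a x - b x).
Proof.
move=> Va Vb; have := in_bandD Va (in_bandZ (-1) Vb).
by congr in_band; apply/funext => x; rewrite mulN1r.
Qed.

Definition clamp (M y : R) : R := Num.max (- M) (Num.min M y).

Lemma clamp_bound M y : 0 <= M -> `|clamp M y| <= M.
Proof.
move=> M0; rewrite ler_norml /clamp le_max lexx /= ge_max ge_min lexx /= andbT.
lra.
Qed.

Lemma clamp_id M y : `|y| <= M -> clamp M y = y.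
Proof.
by rewrite ler_norml /clamp => /andP[h1 h2]; rewrite (min_idPr h2) (max_idPr h1).
Qed.

Lemma clamp_dist M x y : `|x| <= M -> `|x - clamp M y| <= `|x - y|.
Proof.
rewrite ler_norml /clamp => /andP[h1 h2].
have [h3|h3] := leP M y; have [h4|h4] := leP (- M) _.
- by rewrite ler0_norm ?ler0_norm; lra.
- by lra.
- by [].
- by rewrite ger0_norm ?ger0_norm; lra.
Qed.

Lemma clamp_le M y : 0 <= M -> `|y - clamp M y| <= `|y|.
Proof.
move=> M0; rewrite /clamp.
have [h3|h3] := leP M y; have [h4|h4] := leP (- M) _.
- by rewrite !ger0_norm; lra.
- by lra.
- by rewrite subrr normr0.
- by rewrite !ler0_norm; lra.
Qed.

Lemma continuous_clamp M f : continuous f -> continuous (fun x => clamp M (f x)).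
Proof.
move=> cf x; apply: (@continuous_max _ _ (fun=> - M) (fun x => Num.min M (f x))).
  exact: cst_continuous.
by apply: (@continuous_min _ _ (fun=> M)); [exact: cst_continuous|exact: cf].
Qed.

Lemma meas_clamp M f : measurable_fun [set: R] f -> measurable_fun [set: R] (fun x => clamp M (f x)).
Proof. by move=> mf; apply: measurable_maxr => //; exact: measurable_minr. Qed.

(** Truncation at height [n] costs little by dominated convergence. The truncation is then
    approximated in L1 by a continuous function; clamping the latter to the same height does not
    increase the distance, and between functions bounded by [n] a small L1 distance is a small L2
    distance. *)
Lemma band_density W a e : in_band W a -> 0 < e ->
  exists (M : R) (c : R -> R), [/\ continuous c, forall x, `|c x| <= M &
    nrm (fun x => a x - \1_(band W) x * c x) <= e].
Proof.
move=> Va e0; have [La a0] := Va; have [ma Isq] := La.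
pose t n x := clamp n%:R (a x).
have mt n : measurable_fun [set: R] (t n) by exact: meas_clamp.
have Lt n : L2 (t n).
  apply: (L2_dom (mt n) _ La) => x; rewrite /t /clamp.
  have n0 : 0 <= n%:R :> R by [].
  have [h3|h3] := leP n%:R (a x); have [h4|h4] := leP (- n%:R) _.
  - by rewrite !ger0_norm; lra.
  - by rewrite !ger0_norm; lra.
  - by [].
  - by rewrite !ler0_norm; lra.
have [n Hn] : exists n, nrm (fun x => a x - t n x) <= e / 2.
  have H1 x : (fun n => (a x - t n x) ^+ 2) @ \oo --> (0 : R).
    apply: cvg_near_cst; exists (Num.bound `|a x|) => // m /= Hm.
    rewrite /t clamp_id ?subrr ?expr0n//.
    by rewrite ltW// (lt_le_trans (archi_boundP _))// ler_nat.
  have H2 m x : `|(a x - t m x) ^+ 2| <= a x ^+ 2.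
    rewrite ger0_norm ?sqr_ge0// -[leLHS]ger0_norm ?sqr_ge0//.
    rewrite -[leRHS]ger0_norm ?sqr_ge0// !normrX lerXn2r ?nnegrE//.
    exact: clamp_le.
  have [_] := @Rint_dct _ (fun n x => (a x - t n x) ^+ 2) (fun=> 0) (fun x => a x ^+ 2)
    (fun n => meas_sq (measurable_funB ma (mt n))) Isq H1 H2.
  have -> : \int[mu]_x (0 : R) = 0 by rewrite /Rintegral integral0.
  have e4 : 0 < (e / 2) ^+ 2 by rewrite exprn_gt0// divr_gt0.
  move=> /cvgr0_norm_lt /(_ _ e4)[N _ HN]; exists N.
  rewrite -(ler_pXn2r (ltn0Sn 1)) ?nnegrE ?nrm_ge0 ?divr_ge0 ?(ltW e0)// sqr_nrm.
  have := HN N (leqnn N); rewrite /= ger0_norm; last by apply: Rintegral_ge0 => x _; exact: sqr_ge0.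
  move=> /ltW; apply: le_trans; rewrite le_eqVlt; apply/orP; left; apply/eqP.
  by apply: Int_ext => x; rewrite expr2.
have ItB : mu.-integrable (band W) (EFin \o t n).
  apply: itg_restrict_inv; first exact: measurable_band.
  apply: (itg_dom (mt n) _ (itg_norm (in_band_itg Va))) => x.
  rewrite -[leLHS]subr0 -[X in _ - X](normr0 R).
  have := clamp_dist (a x) (_ : `|0 : R| <= n%:R); rewrite normr0 !sub0r !normrN => /(_ (ler0n _ _)).
  by rewrite subr0.
have [g_ [cg Ig]] := approximation_continuous_integrable (measurable_band W) (band_lty W) ItB.
(* The L1 tolerance: the squared difference of two functions bounded by [n] is at most [2 * n.+1]
   times the difference. *)
have d0 : (0 < ((e / 2) ^+ 2 / (2 * n.+1%:R))%:E)%E.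
  by rewrite lte_fin divr_gt0 ?exprn_gt0 ?mulr_gt0 ?divr_gt0.
move=> /fine_cvgP[_ /cvgr0_norm_lt]; rewrite lte_fin in d0.
move=> /(_ _ d0)[N _ /(_ N (leqnn N))] /= HN.
have n0 : 0 <= n%:R :> R by [].
exists n%:R, (fun x => clamp n%:R (g_ N x)); split.
- exact: continuous_clamp.
- by move=> x; exact: clamp_bound.
have mc : measurable_fun [set: R] (fun x => clamp n%:R (g_ N x)).
  by apply: cont_meas; exact: continuous_clamp.
have Lb : L2 (fun x => \1_(band W) x * clamp n%:R (g_ N x)).
  by apply: (@L2_band_bounded _ _ n%:R) => // x; exact: clamp_bound.
apply: le_trans (nrm_tri La (Lt n) Lb) _; rewrite [leRHS]splitr lerD//.
have t0 x : ~ band W x -> t n x = 0.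
  by move=> Bx; rewrite /t a0// clamp_id// normr0.
have [I1 E1] := itg_restrict (measurable_band W)
  (integrable_norm (integrableB (measurable_band W) ItB (Ig N))).
rewrite -(ler_pXn2r (ltn0Sn 1)) ?nnegrE ?nrm_ge0 ?divr_ge0 ?(ltW e0)// sqr_nrm.
apply: (@le_trans _ _ (2 * n.+1%:R * \int[mu]_(x in band W) `|t n x - g_ N x|)).
  rewrite -E1 -IntZl//; apply: le_Int.
  - by apply: L2_itgM; apply: L2B.
  - exact: itgZ.
  move=> x /=; have [Bx|Bx] := pselect (band W x); last first.
    by rewrite t0// indic_out// !mul0r subrr !mulr0.
  rewrite indic_in// !mul1r -expr2 -[leLHS]ger0_norm ?sqr_ge0// normrX expr2.
  apply: ler_pM => //; last by apply: clamp_dist; exact: clamp_bound.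
  rewrite (le_trans (ler_normB _ _))// (le_trans (lerD (clamp_bound _ _) (clamp_bound _ _)))//.
  by rewrite -addn1 natrD; lra.
rewrite mulrC -ler_pdivlMr ?mulr_gt0//.
apply: ltW; apply: le_lt_trans HN.
by rewrite -[leLHS]ger0_norm// Rintegral_ge0.
Qed.

End BandSpace.

(** * Plancherel's identity on the band *)

Section Plancherel.
Context {R : realType}.
Notation mu := (@lebesgue_measure R).
Implicit Types (f g h a b : R -> R) (c e W : R).

Lemma conv_poisson_bound e b (M v : R) : 0 < e -> L2 b -> (forall x, `|b x| <= M) ->
  `|conv_poisson e b v| <= M.
Proof.
move=> e0 Lb bM; have I1 := itg_poisson_mul v e0 Lb.
have [I2 E2] := poisson_int v e0.
apply: le_trans (norm_Int I1) _.
rewrite -[leRHS]mulr1 -E2 -IntZl//; apply: le_Int; [exact: itg_norm|exact: itgZ|].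
move=> y; rewrite normrM (ger0_norm (poisson_ge0 _ e0)) mulrC poissonC.
by apply: ler_wpM2r => //; exact: poisson_ge0.
Qed.

(** Dominated convergence. The outer factor [b] vanishes off the band, so the Poisson means have to
    converge only at points of the open band, where [b] is continuous. *)
Lemma conv_dot_cont W (M : R) (c_ : R -> R) : continuous c_ -> (forall x, `|c_ x| <= M) ->
  let b := fun x => \1_(band W) x * c_ x in
  (fun n => dot b (conv_poisson (eps n) b)) @ \oo --> dot b b.
Proof.
move=> cc cM b.
have mc : measurable_fun [set: R] c_ by exact: cont_meas.
have Lb : L2 b by exact: (L2_band_bounded W mc cM).
have M0 : 0 <= M by exact: le_trans (cM 0).
have bM x : `|b x| <= M.
  rewrite /b indicE; case: (_ \in _); rewrite ?mul1r ?mul0r ?normr0//; exact: cM.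
have Vb : in_band W b.
  by split => // w Bw; rewrite /b indic_out// mul0r.
have Ib := in_band_itg Vb.
have mconv n : measurable_fun [set: R] (conv_poisson (eps n) b).
  by have [[]] := conv_poisson_meas (eps_gt0 n) Ib Lb.
have H1 x : (fun n => b x * conv_poisson (eps n) b x) @ \oo --> b x * b x.
  have [Bx|Bx] := pselect (band W x); last first.
    by rewrite (Vb.2 x Bx) mul0r; under eq_fun do rewrite mul0r; exact: cvg_cst.
  apply: cvgMr; apply: conv_poisson_cvg => //.
  have : {for x, continuous c_} by exact: cc.
  have bE y : band W y -> b y = c_ y by move=> By; rewrite /b indic_in// mul1r.
  rewrite /continuous_at => H; suff : b y @[y --> x] --> c_ x by rewrite -(bE x Bx).
  apply: cvg_trans H; apply: near_eq_cvg.
  have : \forall y \near x, band W y.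
    by apply: open_nbhs_nbhs; split => //; exact: interval_open.
  by apply: filterS => y By; rewrite bE.
have H2 n x : `|b x * conv_poisson (eps n) b x| <= M * M * \1_(band W) x.
  have [Bx|Bx] := pselect (band W x); last first.
    by rewrite (Vb.2 x Bx) mul0r normr0 indic_out// mulr0.
  rewrite normrM indic_in// mulr1; apply: ler_pM => //.
  by apply: conv_poisson_bound => //; exact: eps_gt0.
have IM : itg (fun x => M * M * \1_(band W) x).
  by apply: itgZ; apply: itg_indic; [exact: measurable_band|exact: band_lty].
have [_ H] := Rint_dct (fun n => measurable_funM (itg_meas Ib) (mconv n)) IM H1 H2.
exact: H.
Qed.

(** Half the decay, so that the square is the energy of the transform with weight [edecay (eps n)].
    Being a norm, it satisfies the triangle inequality used in the density argument. *)
Definition wnrm n a := nrm (fun x => edecay (eps n / 2) x * hartley a x).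

Lemma edecay_sqr e (x : R) : edecay (e / 2) x * edecay (e / 2) x = edecay e x.
Proof. by rewrite /edecay -expRD; congr expR; field. Qed.

Lemma eps2_gt0 n : 0 < eps n / 2 :> R.
Proof. by rewrite divr_gt0// eps_gt0. Qed.

Lemma wnrm_L2 n a : itg a -> L2 (fun x => edecay (eps n / 2) x * hartley a x).
Proof.
move=> Ia; have [I1 _] := edecay_hartley 0 (eps2_gt0 n) Ia.
split; first exact: itg_meas.
have := itg_bounded_mul (itg_meas I1) _ I1.
move=> /(_ (2 * \int[mu]_w `|a w|)) H; under eq_fun do rewrite expr2; apply: H => x.
rewrite normrM (ger0_norm (expR_ge0 _)).
apply: le_trans (hartley_bound x Ia); rewrite ler_piMl//.
by apply: edecay_le1; apply: ltW; exact: eps2_gt0.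
Qed.

Lemma wnrm_sqr n a : itg a -> L2 a -> wnrm n a ^+ 2 = dot a (conv_poisson (eps n) a).
Proof.
move=> Ia La; rewrite sqr_nrm -edecay_hartley_dot ?eps_gt0//; apply: Int_ext => x.
by rewrite -(edecay_sqr (eps n)); ring.
Qed.

Lemma wnrm_le n a : itg a -> L2 a -> wnrm n a <= nrm a.
Proof.
move=> Ia La; rewrite -(ler_pXn2r (ltn0Sn 1)) ?nnegrE ?nrm_ge0// wnrm_sqr//.
have [Lc Hc] := conv_poisson_meas (eps_gt0 n) Ia La.
rewrite (le_trans (ler_norm _))// (le_trans (cauchy_schwarz La Lc))//.
rewrite expr2 ler_wpM2l ?nrm_ge0// ler_sqrt ?dot_ge0//.
Qed.

Lemma hartleyD a b (x : R) : itg a -> itg b ->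
  hartley (fun w => a w + b w) x = hartley a x + hartley b x.
Proof.
move=> Ia Ib; rewrite -IntD; [|exact: itg_cas..].
by apply: Int_ext => w; rewrite mulrDl.
Qed.

Lemma hartleyZ c a (x : R) : itg a -> hartley (fun w => c * a w) x = c * hartley a x.
Proof.
move=> Ia; rewrite -IntZl; last exact: itg_cas.
by apply: Int_ext => w; rewrite mulrA.
Qed.

Lemma hartleyB a b (x : R) : itg a -> itg b ->
  hartley (fun w => a w - b w) x = hartley a x - hartley b x.
Proof.
move=> Ia Ib; rewrite -IntB; [|exact: itg_cas..].
by apply: Int_ext => w; rewrite mulrBl.
Qed.

Lemma wnrm_tri n a b : itg a -> itg b ->
  wnrm n a <= wnrm n (fun x => a x - b x) + wnrm n b.
Proof.
move=> Ia Ib; have := nrmD (wnrm_L2 n (itgB Ia Ib)) (wnrm_L2 n Ib).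
apply: le_trans; rewrite le_eqVlt; apply/orP; left; apply/eqP.
by congr nrm; apply/funext => x; rewrite hartleyB//; ring.
Qed.

Lemma wnrm_distC n a b : itg a -> itg b ->
  wnrm n (fun x => a x - b x) = wnrm n (fun x => b x - a x).
Proof.
move=> Ia Ib; rewrite /wnrm -nrmN; congr nrm; apply/funext => x.
by rewrite (hartleyB x Ia Ib) (hartleyB x Ib Ia) -mulrN opprB.
Qed.

Lemma nrm_tri0 a b : L2 a -> L2 b -> nrm a <= nrm (fun x => a x - b x) + nrm b.
Proof.
move=> La Lb; have := nrmD (L2B La Lb) Lb.
by apply: le_trans; rewrite le_eqVlt; apply/orP; left; apply/eqP;
  congr nrm; apply/funext => x; ring.
Qed.

(** Density of the cut-off continuous functions, for which [conv_dot_cont] gives the limit, together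
    with the bound of [wnrm n] by [nrm] uniformly in [n]. *)
Lemma wnrm_cvg W a : in_band W a -> wnrm ^~ a @ \oo --> nrm a.
Proof.
move=> Va; have Ia := in_band_itg Va; have La := in_band_L2 Va.
apply/cvgrPdist_le => /= e e0.
have e3 : 0 < e / 3 by rewrite divr_gt0.
have [M [c_ [cc cM Hab]]] := band_density Va e3.
pose b x := \1_(band W) x * c_ x.
have Lb : L2 b by apply: (@L2_band_bounded _ _ _ M) => //; exact: cont_meas.
have Vb : in_band W b by split => // w Bw; rewrite /b indic_out// mul0r.
have Ib := in_band_itg Vb.
have Hb : wnrm ^~ b @ \oo --> nrm b.
  have := conv_dot_cont (W := W) cc cM; rewrite /= -/b.
  have -> : (fun n => dot b (conv_poisson (eps n) b)) = (fun n => wnrm n b ^+ 2).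
    by apply/funext => n; rewrite wnrm_sqr.
  move=> H; have := @cvg_comp _ _ _ _ _ _ _ _ H (@sqrt_continuous R (dot b b)).
  rewrite /nrm; apply: cvg_trans; apply: near_eq_cvg; apply: nearW => n /=.
  by rewrite sqrtr_sqr ger0_norm// nrm_ge0.
move/cvgrPdist_le : Hb => /(_ _ e3); apply: filterS => n Hn.
have Iab := itgB Ia Ib; have Lab := L2B La Lb.
have h1 := le_trans (wnrm_le n Iab Lab) Hab.
have h2 := wnrm_tri n Ia Ib.
have h3 : wnrm n b <= wnrm n (fun x => a x - b x) + wnrm n a.
  by rewrite (wnrm_distC n Ia Ib); exact: wnrm_tri.
have h4 := nrm_tri0 La Lb.
have h5 : nrm b <= nrm (fun x => a x - b x) + nrm a.
  by rewrite nrm_distC; exact: nrm_tri0.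
move: Hn h1 h2 h3 h4 h5 Hab.
move: (wnrm n (fun x => a x - b x)) (nrm (fun x => a x - b x)) => p q.
move: (wnrm n a) (wnrm n b) (nrm a) (nrm b) => p1 p2 p3 p4; clear.
by rewrite !ler_norml => /andP[? ?] ? ? ? ? ? ?; apply/andP; split; lra.
Qed.

Lemma conv_dot_cvg W a : in_band W a ->
  (fun n => dot a (conv_poisson (eps n) a)) @ \oo --> dot a a.
Proof.
move=> Va; have Ia := in_band_itg Va; have La := in_band_L2 Va.
have H := wnrm_cvg Va; rewrite -sqr_nrm expr2.
rewrite (_ : (fun n => _) = (fun n => wnrm n a * wnrm n a)); first exact: cvgM.
by apply/funext => n; rewrite -wnrm_sqr// expr2.
Qed.

(** Since the Poisson mean P a has norm at most that of a, the squared distance is at most 2 (<a, a>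
    - <a, P a>), which tends to 0. *)
Lemma conv_poisson_cvgL2 W a : in_band W a ->
  (fun n => nrm (fun x => conv_poisson (eps n) a x - a x)) @ \oo --> (0 : R).
Proof.
move=> Va; have Ia := in_band_itg Va; have La := in_band_L2 Va.
have H := conv_dot_cvg Va.
have Lc n := (conv_poisson_meas (eps_gt0 n) Ia La).1.
have Hc n := (conv_poisson_meas (eps_gt0 n) Ia La).2.
pose u n := 2 * (dot a a - dot a (conv_poisson (eps n) a)).
have u0 : u @ \oo --> (0 : R).
  have -> : 0 = 2 * (dot a a - dot a a) :> R by ring.
  by apply: cvgMr; apply: cvgB => //; exact: cvg_cst.
have le1 n : nrm (fun x => conv_poisson (eps n) a x - a x) <= Num.sqrt (u n).
  apply: ler_wsqrtr; have Lca := L2B (Lc n) La.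
  rewrite dotBl// !dotBr// /u; have := Hc n.
  rewrite [dot (conv_poisson (eps n) a) a]dotC; lra.
apply: (@squeeze_cvgr _ _ _ _ (fun=> 0) (Num.sqrt \o u)).
- by apply: nearW => n; rewrite nrm_ge0 le1.
- exact: cvg_cst.
- rewrite -(sqrtr0 R); apply: (@cvg_comp _ _ _ _ _ _ _ _ u0).
  exact: sqrt_continuous.
Qed.

(** The weighted energies of the transform equal <a, P a>, which tends to <a, a>. Fatou's lemma
    gives one inequality; the other holds because the weights are at most 1. *)
Lemma plancherel W a : in_band W a ->
  L2 (hartley a) /\ dot (hartley a) (hartley a) = dot a a.
Proof.
move=> Va; have Ia := in_band_itg Va; have La := in_band_L2 Va.
have Ed n : \int[mu]_x (edecay (eps n) x * hartley a x ^+ 2) = dot a (conv_poisson (eps n) a).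
  by apply: edecay_hartley_dot => //; exact: eps_gt0.
have In n : itg (fun x => edecay (eps n) x * hartley a x ^+ 2).
  have [_] := wnrm_L2 n Ia; congr itg; apply/funext => x.
  by rewrite exprMn expr2 edecay_sqr.
have mh := hartley_meas Ia.
have ce x : edecay (eps n) x @[n --> \oo] --> (1 : R).
  rewrite -(@expR0 R); apply: (@cvg_comp _ _ _ (fun n => - (eps n * `|x|)) expR); last exact: continuous_expR.
  suff : - (eps n * `|x|) @[n --> \oo] --> - (0 * `|x|) by rewrite mul0r oppr0.
  by apply: cvgN; apply: cvgMl; exact: eps_cvg.
have dn n : dot a (conv_poisson (eps n) a) <= dot a a.
  by rewrite -wnrm_sqr// -sqr_nrm lerXn2r ?nnegrE ?nrm_ge0// wnrm_le.
have [I2 le1] : itg (fun x => hartley a x ^+ 2) /\ \int[mu]_x (hartley a x ^+ 2) <= dot a a.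
  apply: (itg_fatou In).
  - by move=> n x; rewrite mulr_ge0 ?sqr_ge0// expR_ge0.
  - by move=> x; rewrite -[X in _ --> X]mul1r; apply: cvgMl; exact: ce.
  - by apply: nearW => n; rewrite Ed.
have Lh : L2 (hartley a) by [].
split => //; apply/eqP; rewrite eq_le; apply/andP; split.
  by apply: le_trans le1; rewrite le_eqVlt; apply/orP; left; apply/eqP;
    apply: Int_ext => x; rewrite expr2.
have /cvg_lim <- // := conv_dot_cvg Va.
apply: limr_le; first by apply: cvgP; exact: conv_dot_cvg Va.
apply: nearW => n; rewrite -Ed; apply: (le_Int (In n) (L2_itgM Lh Lh)) => x.
 rewrite -expr2 ler_piMl ?sqr_ge0//.
by apply: edecay_le1; apply: ltW; exact: eps_gt0.
Qed.

Lemma plancherel_nrm W a : in_band W a -> nrm (hartley a) = nrm a.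
Proof. by move=> /plancherel[_ E]; rewrite /nrm E. Qed.

Lemma plancherel_dot W a b : in_band W a -> in_band W b ->
  dot (hartley a) (hartley b) = dot a b.
Proof.
move=> Va Vb; have [La Ea] := plancherel Va; have [Lb Eb] := plancherel Vb.
have [_ Eab] := plancherel (in_bandD Va Vb).
have Hab : hartley (fun x => a x + b x) = (fun x => hartley a x + hartley b x).
  by apply/funext => x; rewrite hartleyD//; [exact: in_band_itg Va|exact: in_band_itg Vb].
have := in_band_L2 Va; have := in_band_L2 Vb => L1 L3.
move: Eab; rewrite Hab (dot_sqrD La Lb) (dot_sqrD L3 L1) Ea Eb.
move: (dot (hartley a) _) (dot a b) (dot a a) (dot b b) => p q r s; clear; lra.
Qed.

End Plancherel.

(** * Derivatives, completeness and projection for band-limited functions *)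

Section BandLimited.
Context {R : realType}.
Notation mu := (@lebesgue_measure R).
Implicit Types (f g h a b : R -> R) (c e W : R).

Lemma L2_reflect a : L2 a -> L2 (fun x => a (- x)).
Proof.
move=> [ma Ia]; have [I1 _] := integral_reflect Ia; split => //.
apply: (measurableT_comp ma); apply: cont_meas; exact: opp_continuous.
Qed.

Lemma nrm_reflect a : L2 a -> nrm (fun x => a (- x)) = nrm a.
Proof.
move=> La; rewrite /nrm /dot; congr Num.sqrt.
by have [_ <-] := integral_reflect (L2_itgM La La).
Qed.

Lemma bandN W (w : R) : band W (- w) <-> band W w.
Proof. by rewrite /band /= !in_itv/= ltrNl opprK andbC ltrNl. Qed.

Lemma band_abs W (w : R) : band W w -> `|w| <= W.
Proof. by rewrite /band /= in_itv/= ler_norml => /andP[/ltW -> /ltW ->]. Qed.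

(** The symbol of d/dx. As cas'(t) = cas(-t), differentiation reflects the frequency in addition to
    multiplying by 2 pi w up to sign. *)
Definition Dband a (w : R) : R := - (2 * pi * w) * a (- w).

Lemma Dband_in W a : in_band W a -> in_band W (Dband a).
Proof.
move=> [La a0].
have m1 : measurable_fun [set: R] (fun w : R => - (2 * pi * w)).
  by apply: cont_meas => w; apply: cvgN; exact: continuous_mull.
split; last by move=> w Bw; rewrite /Dband a0 ?mulr0// => /bandN.
apply: (@L2_dom _ _ (fun w => 2 * pi * W * a (- w))); last exact/L2Z/L2_reflect.
- by apply: measurable_funM => //; case: (L2_reflect La).
- move=> w; have [Bw|Bw] := pselect (band W w); last first.
    by rewrite /Dband a0 ?mulr0// => /bandN.
  rewrite !normrM normrN !normrM ler_wpM2r// ler_wpM2l ?mulr_ge0//.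
  by rewrite (le_trans (band_abs Bw))// ler_norm.
Qed.

Lemma nrm_Dband W a : 0 <= W -> in_band W a -> nrm (Dband a) <= 2 * pi * W * nrm a.
Proof.
move=> W0 Va; have [La a0] := Va; have p0 := pi_ge0 R.
rewrite -(nrm_reflect La) -[2 * pi * W]ger0_norm ?mulr_ge0//.
rewrite -nrmZ; last exact: L2_reflect.
apply: le_nrm; [by case: (Dband_in Va) => [[]]|exact/L2Z/L2_reflect|].
move=> w; have [Bw|Bw] := pselect (band W w); last first.
  by rewrite /Dband a0 ?mulr0// => /bandN.
rewrite !normrM normrN !normrM ler_wpM2r// ler_wpM2l ?mulr_ge0//.
by rewrite (ger0_norm W0) (band_abs Bw).
Qed.

Lemma is_derive_cas (x : R) : is_derive x 1 cas (cas (- x)).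
Proof.
rewrite /cas cosN sinN.
by apply: is_deriveD; [exact: is_derive_sin|exact: is_derive_cos] ||
   (have d1 := is_derive_cos x; have d2 := is_derive_sin x; apply: is_derive_eq; rewrite addrC).
Qed.

(** On the bounded band the differentiated integrand is dominated by a multiple of [|a|], so
    differentiation passes under the integral; the substitution [w] to [- w] restores the kernel. *)
Lemma is_derive_hartley W a (x : R) : 0 <= W -> in_band W a ->
  is_derive x 1 (hartley a) (hartley (Dband a) x).
Proof.
move=> W0 Va; have Ia := in_band_itg Va; have p0 := pi_ge0 R.
pose f (y w : R) := a w * cas (2 * pi * y * w).
have dc (y w : R) : is_derive y 1 (f ^~ w) (a w * (2 * pi * w * cas (- (2 * pi * w * y)))).
  have -> : f ^~ w = (fun y => a w * cas (2 * pi * w * y)).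
    by apply/funext => z; rewrite /f casC.
  have d1 := is_derive_scale (is_derive_cas (2 * pi * w * y)).
  by apply: is_derive_eq.
have pE (y w : R) : partial1of2 f y w = a w * (2 * pi * w * cas (- (2 * pi * w * y))).
  by rewrite partial1of2E; have [_ ->] := dc y w.
have H := @cvg_differentiation_under_integral R _ (measurableTypeR R) mu f setT measurableT
  x (x - 1) (x + 1) _ _ _ (fun w => 2 * pi * W * 2 * `|a w|) _ _ _.
have E : \int[mu]_(y in setT) partial1of2 f x y = hartley (Dband a) x.
  have ID := in_band_itg (Dband_in Va).
  rewrite /hartley; have [_ <-] := integral_reflect (itg_cas x ID).
  apply: Int_ext => w; rewrite pE /Dband opprK mulrN opprK.
  rewrite (_ : 2 * pi * x * - w = - (2 * pi * w * x)); last by rewrite mulrN; congr (- _); ring.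
  by rewrite mulrA [a w * _]mulrC.
have H' : h^-1 *: (hartley a (h + x) - hartley a x) @[h --> 0^'] --> hartley (Dband a) x.
  rewrite -E; apply: H.
  - by rewrite /= in_itv/=; apply/andP; split; lra.
  - by move=> y _; exact: itg_cas.
  - by move=> y w _ _; case: (dc y w).
  - by move=> w; rewrite !mulr_ge0.
  - exact/itgZ/itg_norm.
  - move=> y w _ _; rewrite pE; have [Bw|Bw] := pselect (band W w); last first.
      by rewrite (Va.2 w Bw) mul0r normr0 mulr0.
    rewrite normrM mulrC ler_wpM2r// !normrM (ger0_norm (_ : 0 <= 2)) ?(ger0_norm p0)//.
    apply: ler_pM => //; [by rewrite !mulr_ge0| |exact: cas_bound].
    by apply: ler_wpM2l; [rewrite mulr_ge0|exact: band_abs].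
split.
  apply/cvg_ex; exists (hartley (Dband a) x).
  by under eq_fun do rewrite /= /GRing.scale /= mulr1.
apply: cvg_lim => //.
by under eq_fun do rewrite /= /GRing.scale /= mulr1.
Qed.

Lemma iter_Dband_in W a n : in_band W a -> in_band W (iter n Dband a).
Proof. by move=> Va; elim: n => //= n IH; exact: Dband_in. Qed.

Lemma derive1n_hartley W a n : 0 <= W -> in_band W a ->
  derive1n n (hartley a) = hartley (iter n Dband a).
Proof.
move=> W0 Va; elim: n => // n IH.
rewrite derive1nS IH; apply/funext => x; rewrite derive1E.
by have [_ ->] := is_derive_hartley x W0 (iter_Dband_in n Va).
Qed.

Definition Kband W : R := 2 * nrm (\1_(band W) : R -> R).

(** Cauchy-Schwarz on the band. It makes point evaluation bounded: L2 convergence of band-limited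
    functions implies pointwise convergence. *)
Lemma hartley_sup W a (x : R) : in_band W a -> `|hartley a x| <= Kband W * nrm a.
Proof.
move=> Va; apply: le_trans (hartley_bound x (in_band_itg Va)) _.
rewrite -mulrA ler_wpM2l//.
have La := in_band_L2 Va.
have Ln : L2 (fun w => `|a w|).
  apply: (L2_dom _ _ La); last by move=> w; rewrite normr_id.
  by apply: measurableT_comp => //; case: La.
have L1 := L2_indic1 (measurable_band W) (band_lty W).
have -> : \int[mu]_w `|a w| = dot (\1_(band W) : R -> R) (fun w => `|a w|).
  apply: Int_ext => w; have [Bw|Bw] := pselect (band W w); first by rewrite indic_in// mul1r.
  by rewrite (Va.2 w Bw) normr0 mulr0.
apply: le_trans (ler_norm _) _; apply: le_trans (cauchy_schwarz L1 Ln) _.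
rewrite ler_wpM2l ?nrm_ge0//; apply: le_nrm => //; first by case: Ln.
by move=> w; rewrite normr_id.
Qed.

(** The real band-limited functions as functions, not classes: a transform is defined at every
    point, so equalities below are pointwise. *)
Definition BL W : set (R -> R) := [set f | exists2 a, in_band W a & f = hartley a].

Lemma BL_L2 W f : BL W f -> L2 f.
Proof. by move=> [a Va ->]; have [] := plancherel Va. Qed.

Lemma BLD W f g : BL W f -> BL W g -> BL W (fun x => f x + g x).
Proof.
move=> [a Va ->] [b Vb ->]; exists (fun x => a x + b x); first exact: in_bandD.
by apply/funext => x; rewrite hartleyD//; [exact: in_band_itg Va|exact: in_band_itg Vb].
Qed.

Lemma BLZ W c f : BL W f -> BL W (fun x => c * f x).
Proof.
move=> [a Va ->]; exists (fun x => c * a x); first exact: in_bandZ.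
by apply/funext => x; rewrite hartleyZ//; exact: in_band_itg Va.
Qed.

Lemma BLB W f g : BL W f -> BL W g -> BL W (fun x => f x - g x).
Proof.
move=> Bf Bg; have := BLD Bf (BLZ (-1) Bg).
by congr BL; apply/funext => x; rewrite mulN1r.
Qed.

Lemma BL0 W : BL W (fun=> 0).
Proof.
exists (fun=> 0); first by split => //; exact: L2_0.
apply/funext => x; rewrite /hartley; under eq_Rintegral do rewrite mul0r.
by rewrite /Rintegral integral0.
Qed.

Lemma BL_sum W (I : Type) (s : seq I) (F : I -> R -> R) :
  (forall i, BL W (F i)) -> BL W (fun x => \sum_(i <- s) F i x).
Proof.
move=> FI; elim: s => [|i s IH].
  by under eq_fun do rewrite big_nil; exact: BL0.
by under eq_fun do rewrite big_cons; apply: BLD.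
Qed.

Lemma BL_derive1n W f n : 0 <= W -> BL W f -> BL W (derive1n n f).
Proof.
move=> W0 [a Va ->]; rewrite (derive1n_hartley n W0 Va).
by exists (iter n Dband a) => //; exact: iter_Dband_in.
Qed.

Lemma BL_is_derive W f n (x : R) : 0 <= W -> BL W f ->
  is_derive x 1 (derive1n n f) (derive1n n.+1 f x).
Proof.
move=> W0 [a Va ->]; rewrite !(derive1n_hartley _ W0 Va).
exact: is_derive_hartley (iter_Dband_in n Va).
Qed.

Lemma BL_continuous W f : 0 <= W -> BL W f -> continuous f.
Proof. by move=> W0 Bf x; exact: is_derive_cont (BL_is_derive 0 x W0 Bf). Qed.

Lemma iter_DbandD n a b :
  iter n Dband (fun x => a x + b x) = (fun x => iter n Dband a x + iter n Dband b x).
Proof.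
elim: n => //= n ->; apply/funext => x; rewrite /Dband mulrDr //.
Qed.

Lemma iter_DbandZ n c a : iter n Dband (fun x => c * a x) = (fun x => c * iter n Dband a x).
Proof.
elim: n => //= n ->; apply/funext => x; rewrite /Dband mulrCA //.
Qed.

Lemma BL_derive1nD W f g n (x : R) : 0 <= W -> BL W f -> BL W g ->
  derive1n n (fun x => f x + g x) x = derive1n n f x + derive1n n g x.
Proof.
move=> W0 [a Va ->] [b Vb ->].
have -> : (fun x => hartley a x + hartley b x) = hartley (fun x => a x + b x).
  by apply/funext => y; rewrite hartleyD//; [exact: in_band_itg Va|exact: in_band_itg Vb].
rewrite (derive1n_hartley _ W0 (in_bandD Va Vb)) (derive1n_hartley _ W0 Va).
rewrite (derive1n_hartley _ W0 Vb) iter_DbandD hartleyD//.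
  exact: in_band_itg (iter_Dband_in n Va).
exact: in_band_itg (iter_Dband_in n Vb).
Qed.

Lemma BL_derive1nZ W c f n (x : R) : 0 <= W -> BL W f ->
  derive1n n (fun x => c * f x) x = c * derive1n n f x.
Proof.
move=> W0 [a Va ->].
have -> : (fun x => c * hartley a x) = hartley (fun x => c * a x).
  by apply/funext => y; rewrite hartleyZ//; exact: in_band_itg Va.
rewrite (derive1n_hartley _ W0 (in_bandZ c Va)) (derive1n_hartley _ W0 Va).
by rewrite iter_DbandZ hartleyZ//; exact: in_band_itg (iter_Dband_in n Va).
Qed.

Lemma BL_derive1nB W f g n (x : R) : 0 <= W -> BL W f -> BL W g ->
  derive1n n (fun x => f x - g x) x = derive1n n f x - derive1n n g x.
Proof.
move=> W0 Bf Bg.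
have -> : (fun x => f x - g x) = (fun x => f x + -1 * g x).
  by apply/funext => y; rewrite mulN1r.
by rewrite (BL_derive1nD _ _ W0)//; [rewrite (BL_derive1nZ _ _ _ W0)// mulN1r|exact: BLZ].
Qed.

(** By Plancherel a derivative costs at most the supremum of its symbol on the band, [2 pi W]. *)
Lemma bernstein W f n : 0 <= W -> BL W f -> nrm (derive1n n f) <= (2 * pi * W) ^+ n * nrm f.
Proof.
move=> W0 [a Va ->]; rewrite (derive1n_hartley _ W0 Va) (plancherel_nrm Va).
rewrite (plancherel_nrm (iter_Dband_in n Va)).
elim: n => [|n IH]; first by rewrite expr0 mul1r.
apply: le_trans (nrm_Dband W0 (iter_Dband_in n Va)) _.
rewrite exprS -[leRHS]mulrA; apply: ler_wpM2l => //.
by rewrite !mulr_ge0// pi_ge0.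
Qed.

Lemma BL_sup W f (x : R) : BL W f -> `|f x| <= Kband W * nrm f.
Proof. by move=> [a Va ->]; rewrite (plancherel_nrm Va); exact: hartley_sup. Qed.

Lemma Kband_ge0 W : 0 <= Kband W.
Proof. by rewrite mulr_ge0// nrm_ge0. Qed.

Lemma BL_complete W (f : nat -> R -> R) : (forall n, BL W (f n)) ->
  (forall e, 0 < e -> exists N, forall m n, (N <= m)%N -> (N <= n)%N ->
     nrm (fun x => f m x - f n x) <= e) ->
  exists2 g, BL W g & (fun n => nrm (fun x => f n x - g x)) @ \oo --> (0 : R).
Proof.
move=> Bf Cf; have /choice[a Ha] : forall n, exists a, in_band W a /\ f n = hartley a.
  by move=> n; have [a Va E] := Bf n; exists a.
have hB m (b : R -> R) : in_band W b -> (fun x => f m x - hartley b x) = hartley (fun x => a m x - b x).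
  move=> Vb; have [Va ->] := Ha m; apply/funext => x.
  by rewrite hartleyB//; [exact: in_band_itg Va|exact: in_band_itg Vb].
have La n : L2 (a n) by apply: in_band_L2 (Ha n).1.
have [|v [Lv Hv]] := L2_complete La.
  move=> e e0; have [N HN] := Cf e e0; exists N => m n Nm Nn.
  have := HN m n Nm Nn; rewrite {1}(Ha n).2 hB; last exact: (Ha n).1.
  by rewrite (plancherel_nrm (in_bandB (Ha m).1 (Ha n).1)).
(* The L2 limit need not vanish everywhere off the band. Cutting it off restores this and does not
   increase the distances, since every [a n] vanishes there. *)
pose b x := \1_(band W) x * v x.
have Vb : in_band W b.
  split; first by apply: L2_indic => //; exact: measurable_band.
  by move=> w Bw; rewrite /b indic_out// mul0r.
exists (hartley b); first by exists b.
apply/cvgrPdist_le => /= e e0; have [N HN] := Hv e e0.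
exists N => // n /= Nn; rewrite sub0r normrN ger0_norm ?nrm_ge0//.
rewrite hB// (plancherel_nrm (in_bandB (Ha n).1 Vb)).
apply: le_trans (HN n Nn); apply: le_nrm.
- by case: (L2B (La n) (in_band_L2 Vb)).
- exact: L2B.
move=> x; have [Bx|Bx] := pselect (band W x); first by rewrite /b indic_in// mul1r.
by rewrite ((Ha n).1.2 x Bx) /b indic_out// mul0r subrr normr0.
Qed.

(** Transform, cut to the band, transform back: the orthogonal projection onto [BL W], meaningful
    for integrable [h]. *)
Definition proj W h := hartley (fun w => \1_(band W) w * hartley h w).

Lemma proj_in W h : itg h -> in_band W (fun w => \1_(band W) w * hartley h w).
Proof.
move=> Ih; split; last by move=> w Bw; rewrite indic_out// mul0r.
apply: (@L2_band_bounded _ _ _ (2 * \int[mu]_w `|h w|)); first exact: hartley_meas.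
by move=> x; exact: hartley_bound.
Qed.

Lemma proj_BL W h : itg h -> BL W (proj W h).
Proof. by move=> Ih; exists (fun w => \1_(band W) w * hartley h w) => //; exact: proj_in. Qed.

(** Plancherel on the band followed by self-adjointness; this is the orthogonality of [h - proj W h]
    to the band-limited functions. *)
Lemma proj_dot W h g : itg h -> BL W g -> dot (proj W h) g = dot h g.
Proof.
move=> Ih [b Vb ->]; rewrite (plancherel_dot (proj_in W Ih) Vb).
have [_ E] := hartley_mult Ih (in_band_itg Vb); rewrite /dot E.
apply: Int_ext => w; have [Bw|Bw] := pselect (band W w); first by rewrite indic_in// mul1r.
by rewrite (Vb.2 w Bw) !mulr0.
Qed.

Lemma proj_nrm W h : itg h -> L2 h -> nrm (proj W h) <= nrm h.
Proof.
move=> Ih Lh; have BP := proj_BL W Ih; have LP := BL_L2 BP.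
have := cauchy_schwarz Lh LP; rewrite -(proj_dot Ih BP) -sqr_nrm ger0_norm ?sqr_ge0//.
have [->|n0] := eqVneq (nrm (proj W h)) 0; first by rewrite nrm_ge0.
have n1 : 0 < nrm (proj W h) by rewrite lt_neqAle eq_sym n0 nrm_ge0.
by rewrite expr2 ler_pM2r.
Qed.

Lemma projD W h1 h2 (x : R) : itg h1 -> itg h2 ->
  proj W (fun x => h1 x + h2 x) x = proj W h1 x + proj W h2 x.
Proof.
move=> I1 I2; rewrite /proj -hartleyD; [|exact: in_band_itg (proj_in W _)..].
by congr hartley; apply/funext => w; rewrite hartleyD// mulrDr.
Qed.

Lemma projZ W c h (x : R) : itg h -> proj W (fun x => c * h x) x = c * proj W h x.
Proof.
move=> Ih; rewrite /proj -hartleyZ; last exact: in_band_itg (proj_in W _).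
by congr hartley; apply/funext => w; rewrite hartleyZ// mulrCA.
Qed.

Lemma proj_sum W (I : Type) (s : seq I) (F : I -> R -> R) (x : R) :
  (forall i, itg (F i)) ->
  proj W (fun x => \sum_(i <- s) F i x) x = \sum_(i <- s) proj W (F i) x.
Proof.
move=> FI; elim: s => [|i s IH].
  rewrite big_nil; under eq_fun do rewrite big_nil.
  have := projZ W 0 x (itg0 (R := R)).
  by rewrite !mul0r.
rewrite big_cons; under eq_fun do rewrite big_cons.
by rewrite projD// ?IH//; exact: itg_sum.
Qed.

(** The symbol couples only [w] and [- w], and the band is symmetric, so cutting commutes with
    differentiation. [h'] is a derivative of [h] on the transform side only, because this is applied
    to piecewise polynomials. *)
Lemma proj_derive W h h' n : 0 <= W -> itg h -> itg h' ->
  (forall w, hartley h' w = iter n Dband (hartley h) w) ->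
  derive1n n (proj W h) = proj W h'.
Proof.
move=> W0 Ih Ih' E; rewrite /proj (derive1n_hartley _ W0 (proj_in W Ih)).
congr hartley; apply/funext => w; rewrite E.
elim: n w {E} => //= n IH w; rewrite /Dband IH mulrCA; congr (_ * _).
have [Bw|Bw] := pselect (band W w).
  by rewrite !indic_in//; exact/bandN.
by rewrite !indic_out// => /bandN.
Qed.

End BandLimited.

(** * The Wirtinger-Cimmino inequality *)

Section DerivativeRules.
Context {R : realType}.
Implicit Types (f g : R -> R) (t : R).

Lemma dcst (c t : R) : is_derive t 1 (fun _ : R => c) 0.
Proof. exact: is_derive_cst. Qed.

Lemma dD f g t (df dg : R) : is_derive t 1 f df -> is_derive t 1 g dg ->
  is_derive t 1 (fun s => f s + g s) (df + dg).
Proof. exact: is_deriveD. Qed.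

Lemma dM f g t (df dg : R) : is_derive t 1 f df -> is_derive t 1 g dg ->
  is_derive t 1 (fun s => f s * g s) (df * g t + f t * dg).
Proof.
move=> d1 d2; have := is_deriveM d1 d2.
by move=> d3; apply: is_derive_eq; rewrite /GRing.scale /= addrC mulrC.
Qed.

Lemma dZ (c : R) f t (df : R) : is_derive t 1 f df -> is_derive t 1 (fun s => c * f s) (c * df).
Proof. by move=> d1; have := dM (dcst c t) d1; rewrite mul0r add0r. Qed.

Lemma dB f g t (df dg : R) : is_derive t 1 f df -> is_derive t 1 g dg ->
  is_derive t 1 (fun s => f s - g s) (df - dg).
Proof. exact: is_deriveB. Qed.

Lemma dsum (I : Type) (r : seq I) (F : I -> R -> R) (dF : I -> R) t :
  (forall i, is_derive t 1 (F i) (dF i)) ->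
  is_derive t 1 (fun s => \sum_(i <- r) F i s) (\sum_(i <- r) dF i).
Proof.
move=> H; elim: r => [|i r IH].
  by rewrite big_nil; under eq_fun do rewrite big_nil; exact: dcst.
by rewrite big_cons; under eq_fun do rewrite big_cons; exact: dD.
Qed.

Lemma deq f t (d d' : R) : is_derive t 1 f d -> d = d' -> is_derive t 1 f d'.
Proof. by move=> ? <-. Qed.

Lemma dXn n t : is_derive t 1 (fun s : R => s ^+ n.+1 / (n.+1)`!%:R) (t ^+ n / n`!%:R).
Proof.
have h : is_derive t 1 (fun s : R => s ^+ n.+1) (n.+1%:R * t ^+ n).
  elim: n => [|n IH].
    by under eq_fun do rewrite expr1; rewrite expr0 mulr1; exact: is_derive_id.
  have := dM (is_derive_id t 1) IH; under eq_fun do rewrite -exprS.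
  by move=> /deq; apply; rewrite mul1r exprS -[n.+2]addn1 natrD; ring.
have := dZ (n.+1)`!%:R^-1 h; under eq_fun do rewrite mulrC.
by move=> /deq; apply; rewrite factS natrM invfM mulrACA mulVf ?pnatr_eq0// mul1r mulrC.
Qed.

(** The derivative is left unnamed: the entries of X^-1 x have to be differentiable, but their
    derivatives are eliminated in [hamiltonian_square]. *)
Definition dble f t := exists d : R, is_derive t 1 f d.

Lemma dble_prod (I : Type) (r : seq I) (F : I -> R -> R) t :
  (forall i, dble (F i) t) -> dble (fun s => \prod_(i <- r) F i s) t.
Proof.
move=> H; elim: r => [|i r [d IH]].
  by exists 0; under eq_fun do rewrite big_nil; exact: dcst.
have [d' H'] := H i; eexists; under eq_fun do rewrite big_cons; exact: dM H' IH.
Qed.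

Lemma dble_sum (I : Type) (r : seq I) (F : I -> R -> R) t :
  (forall i, dble (F i) t) -> dble (fun s => \sum_(i <- r) F i s) t.
Proof.
move=> /choice[dF H]; exists (\sum_(i <- r) dF i); exact: dsum.
Qed.

Lemma dbleM f g t : dble f t -> dble g t -> dble (fun s => f s * g s) t.
Proof. by move=> [a Ha] [b Hb]; eexists; exact: dM Ha Hb. Qed.

Lemma dble_cst (c : R) t : dble (fun=> c) t.
Proof. by exists 0; exact: dcst. Qed.

Lemma dble_det n (A : R -> 'M[R]_n) t : (forall i j, dble (fun s => A s i j) t) ->
  dble (fun s => \det (A s)) t.
Proof.
move=> H; apply: dble_sum => s; apply: dbleM; first exact: dble_cst.
exact: dble_prod.
Qed.

Lemma dble_adj n (A : R -> 'M[R]_n) t : (forall i j, dble (fun s => A s i j) t) ->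
  forall i j, dble (fun s => (\adj (A s)) i j) t.
Proof.
move=> H i j.
rewrite (_ : (fun s => _) = (fun s => cofactor (A s) j i)); last first.
  by apply/funext => s; rewrite mxE.
apply: dbleM; first exact: dble_cst.
apply: dble_det => i' j'.
rewrite (_ : (fun s => _) = (fun s => A s (lift j i') (lift i j'))); first exact: H.
by apply/funext => s; rewrite !mxE.
Qed.

Definition mder m n (A : R -> 'M[R]_(m, n)) (A' : 'M[R]_(m, n)) t :=
  forall i j, is_derive t 1 (fun s => A s i j) (A' i j).

Lemma mderM m n p (A : R -> 'M[R]_(m, n)) (B : R -> 'M[R]_(n, p)) A' B' t :
  mder A A' t -> mder B B' t ->
  mder (fun s => A s *m B s) (A' *m B t + A t *m B') t.
Proof.
move=> dA dB i j.
under eq_fun do rewrite mxE; rewrite !mxE -big_split/=.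
by apply: dsum => l; apply: dM.
Qed.

Lemma mder_tr m n (A : R -> 'M[R]_(m, n)) A' t : mder A A' t -> mder (fun s => (A s)^T) A'^T t.
Proof. by move=> dA i j; under eq_fun do rewrite mxE; rewrite mxE. Qed.

Lemma mderB m n (A B : R -> 'M[R]_(m, n)) A' B' t : mder A A' t -> mder B B' t ->
  mder (fun s => A s - B s) (A' - B') t.
Proof.
by move=> dA dB_ i j; under eq_fun do rewrite !mxE; rewrite !mxE; exact: dB.
Qed.

End DerivativeRules.

(* Completion of the square for the quadratic form [v^2 - lam x_e^2] along a
   matrix solution [(X, P)] of the associated linear Hamiltonian system. *)
Lemma hamiltonian_square (F : comNzRingType) k (N X X' P P' : 'M[F]_k)
    (e x x' a a' : 'cV[F]_k) (v lam : F) :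
  X' = N *m X + e *m (e^T *m P) -> P' = - (N^T *m P) - lam *: (e *m (e^T *m X)) ->
  x' = N *m x + v *: e -> X^T *m P = P^T *m X ->
  x = X *m a -> x' = X' *m a + X *m a' ->
  x'^T *m (P *m a) + x^T *m (P' *m a) + x^T *m (P *m a')
  = (v ^+ 2 - lam * ((e^T *m x) 0 0) ^+ 2 - (v - (e^T *m (P *m a)) 0 0) ^+ 2)%:M.
Proof.
move=> HX HP Hx sym xE dxE; set p := P *m a.
set c := (e^T *m p) 0 0; set xe := (e^T *m x) 0 0.
have cE : e^T *m p = c%:M by exact: mx11_scalar.
have xeE : e^T *m x = xe%:M by exact: mx11_scalar.
have T1 : x'^T *m p = x^T *m (N^T *m p) + v *: c%:M.
  by rewrite Hx linearD/= trmx_mul linearZ/= mulmxDl -scalemxAl cE mulmxA.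
have T2 : x^T *m (P' *m a) = - (x^T *m (N^T *m p)) - lam *: (xe ^+ 2)%:M.
  rewrite HP mulmxBl mulNmx -scalemxAl mulmxBr mulmxN -!mulmxA -/p -xE.
  rewrite -scalemxAr xeE; congr (_ - _ *: _); rewrite mulmxA.
  by rewrite -[x^T *m e]trmxK trmx_mul trmxK xeE tr_scalar_mx -scalar_mxM expr2.
(* Comparing the two expressions for [x'] eliminates the unknown [a']: the terms with [N] cancel. *)
have T3 : X *m a' = (v - c) *: e.
  have -> : X *m a' = x' - X' *m a by rewrite dxE addrAC subrr add0r.
  rewrite Hx HX mulmxDl -!mulmxA -xE -/p cE mul_mx_scalar scalerBl.
  by rewrite opprD addrACA subrr add0r.
(* Symmetry of [X^T *m P] moves [X] next to [a'], where the previous identity applies. *)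
have T4 : x^T *m (P *m a') = (v - c) *: c%:M.
  rewrite xE trmx_mul -mulmxA [X^T *m _]mulmxA sym -mulmxA T3 mulmxA -trmx_mul.
  have pe : p^T *m e = c%:M by rewrite -[LHS]trmxK trmx_mul trmxK cE tr_scalar_mx.
  by rewrite -scalemxAr -/p pe.
rewrite T1 T2 T4; apply/matrixP => i j; rewrite !ord1 !mxE eqxx !mulr1n.
set q := \sum_(_ < _) _; ring.
Qed.

(** The derivative of X^T P is symmetric: the terms with [N] cancel and leave u^T u - lam w^T w,
    with u = e^T P and w = e^T X. *)
Lemma hamiltonian_sym (F : comNzRingType) k (N X X' P P' : 'M[F]_k) (e : 'cV[F]_k) (lam : F) :
  X' = N *m X + e *m (e^T *m P) -> P' = - (N^T *m P) - lam *: (e *m (e^T *m X)) ->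
  X'^T *m P + X^T *m P' = P'^T *m X + P^T *m X'.
Proof.
have [u uE] : exists u, u = e^T *m P by eexists.
have [w wE] : exists w, w = e^T *m X by eexists.
rewrite -uE -wE => HX HP.
have wT : w^T = X^T *m e by rewrite wE trmx_mul trmxK.
have D : X'^T *m P + X^T *m P' = u^T *m u - lam *: (w^T *m w).
  rewrite HX HP linearD/= [(N *m X)^T]trmx_mul [(e *m u)^T]trmx_mul mulmxDl -!mulmxA -uE.
  rewrite mulmxBr mulmxN -scalemxAr [X^T *m (e *m w)]mulmxA -wT.
  by rewrite addrACA subrr add0r.
rewrite D -[LHS]trmxK linearB/= linearZ/= !trmx_mul !trmxK -D linearD/= !trmx_mul !trmxK.
by rewrite addrC.
Qed.

(** * Jacobi fields and their Hamiltonian system *)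

Section JacobiFields.
Context {R : realType}.
Variables (lam : R) (k : nat).
Hypotheses (lam0 : 0 < lam) (k0 : (0 < k)%N).
Let om := Num.sqrt lam.

Let omsq : om * om = lam.
Proof. by rewrite -expr2 sqr_sqrtr// ltW. Qed.

(** Divided powers shifted by two, so that differentiation always lowers the index by one; the
    indices 0 and 1 stand for the derivatives of the constant [monom 2]. *)
Definition monom (r : nat) (t : R) : R :=
  if r is r'.+2 then t ^+ r' / r'`!%:R else 0.

(** [trig 2] is cos (om t), the indices 1 and 0 are its first two derivatives, and for r > 2
    [trig r] is its iterated antiderivative of order r - 2 vanishing at 0. The recursion says that
    lam times the function plus its second derivative is a divided power. *)
Fixpoint trig (r : nat) (t : R) : R :=
  match r with
  | 0 => - lam * cos (om * t)
  | 1 => - om * sin (om * t)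
  | r'.+2 => lam^-1 * (monom r' t - trig r' t)
  end.

Lemma monom_derive r (t : R) : is_derive t 1 (monom r.+1) (monom r t).
Proof.
case: r => [|[|r]] /=; [exact: dcst| |exact: dXn].
rewrite (_ : monom 2 = fun=> 1) ?[X in is_derive _ _ _ X]/=; first exact: dcst.
by apply/funext => s; rewrite /= expr0 fact0 divr1.
Qed.

Lemma trig_derive r (t : R) : is_derive t 1 (trig r.+1) (trig r t).
Proof.
have dsin := is_derive_scale (is_derive_sin (om * t)).
have dcos := is_derive_scale (is_derive_cos (om * t)).
have [n] := ubnP r; elim: n r => // n IH [|[|r]] rn.
- rewrite /=; apply: deq (dZ (- om) dsin) _; rewrite -omsq; ring.
- rewrite /=; apply: deq (dZ lam^-1 (dB (dcst 0 t) (dZ (- lam) dcos))) _.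
  by rewrite sub0r mulNr opprK mulrA mulVf ?gt_eqF// mul1r mulrN mulNr.
rewrite [trig r.+3]/= [trig r.+2]/=.
by apply: dZ; apply: dB; [exact: monom_derive|apply: IH; exact: ltnW].
Qed.

Lemma monom_cont r : continuous (monom r).
Proof.
case: r => [|r] t; first exact: cst_continuous.
exact: is_derive_cont (monom_derive r t).
Qed.

Lemma trig_cont r : continuous (trig r).
Proof.
case: r => [|r] t; last exact: is_derive_cont (trig_derive r t).
apply: cvgMr; exact: (continuous_scale (@continuous_cos R)).
Qed.

Lemma monom_at0 r : monom r 0 = (r == 2)%:R.
Proof.
case: r => [|[|[|r]]] //=; first by rewrite expr0 fact0 divr1.
by rewrite expr0n mul0r.
Qed.

Lemma trig_at0 r : (0 < r)%N -> trig r 0 = (r == 2)%:R.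
Proof.
have [n] := ubnP r; elim: n r => // n IH [|[|[|r]]] // rn _.
- by rewrite /= mulr0 sin0 mulr0.
- by rewrite /= mulr0 cos0 sub0r mulr1 opprK mulVf ?gt_eqF.
- rewrite [LHS](_ : _ = lam^-1 * (monom r.+1 0 - trig r.+1 0))// IH//; last exact: ltnW.
  by rewrite monom_at0 subrr mulr0.
Qed.

(** The [l]-th derivative of the [i]-th solution of u^(2k) + lam u^(2k-2) = 0, normalised so that
    among the derivatives of order below 2k only the one of order k + i is non-zero at 0, with value
    1. Solutions of degree k + i < 2k - 2 are monomials; the last two are trigonometric. Truncation
    of the subtraction does no harm, since [monom 0] is 0 and the trigonometric index is not
    truncated for l <= 2k. *)
Definition sol (i l : nat) (t : R) : R :=
  if (i.+2 < k)%N then monom (k + i + 2 - l) t else trig (k + i + 2 - l) t.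

Lemma sol_derive i l (t : R) : (l < 2 * k)%N -> is_derive t 1 (sol i l) (sol i l.+1 t).
Proof.
move=> lk; rewrite /sol; case: ltnP => ik.
  have [H|H] := ltnP l (k + i + 2).
    by rewrite -(subnSK H); exact: monom_derive.
  have -> : (k + i + 2 - l = 0)%N by apply/eqP.
  have -> : (k + i + 2 - l.+1 = 0)%N by apply/eqP; exact: leqW.
  exact: dcst.
have H : (l < k + i + 2)%N by lia.
by rewrite -(subnSK H); exact: trig_derive.
Qed.

Lemma sol_cont i l : continuous (sol i l).
Proof. move=> t; rewrite /sol; case: (_ < _)%N; [exact: monom_cont|exact: trig_cont]. Qed.

Lemma sol_ode i (t : R) : (i < k)%N -> sol i (2 * k) t + lam * sol i (2 * k - 2) t = 0.
Proof.
move=> ik; rewrite /sol; case: ltnP => ik2.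
  have -> : (k + i + 2 - 2 * k = 0)%N by lia.
  have : (k + i + 2 - (2 * k - 2) <= 1)%N by lia.
  by case: (_ - _)%N => [|[|//]] _ /=; rewrite mulr0 addr0.
have -> : (k + i + 2 - (2 * k - 2) = (k + i + 2 - 2 * k).+2)%N by lia.
have : (k + i + 2 - 2 * k <= 1)%N by lia.
by case: (_ - _)%N => [|[|//]] _ /=; rewrite mulrA mulfV ?gt_eqF// mul1r sub0r addrN.
Qed.

Lemma sol_at0 i l : (i < k)%N -> (l < 2 * k)%N -> sol i l 0 = (l == k + i)%:R.
Proof.
move=> ik lk; rewrite /sol; have -> : (l == k + i) = (k + i + 2 - l == 2)%N by lia.
case: ltnP => ik2; first exact: monom_at0.
by apply: trig_at0; lia.
Qed.

Definition combi (v : 'I_k -> R) l (t : R) := \sum_(i < k) v i * sol i l t.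

Lemma combi_derive v l (t : R) : (l < 2 * k)%N ->
  is_derive t 1 (combi v l) (combi v l.+1 t).
Proof. by move=> lk; apply: dsum => i; apply: dZ; exact: sol_derive. Qed.

Lemma combi_cont v l : continuous (combi v l).
Proof.
move=> t; rewrite /combi.
elim: (index_enum _) => [|i r IH].
  by rewrite /continuous_at; under eq_fun do rewrite big_nil; rewrite big_nil; exact: cvg_cst.
rewrite /continuous_at; under eq_fun do rewrite big_cons; rewrite big_cons.
by apply: cvgD; [apply: cvgMr; exact: sol_cont|exact: IH].
Qed.

(** All derivatives of order below 2k vanish on ]0, t[, hence at 0 by continuity, and the one of
    order k + i has the value [v i] there. *)
Lemma combi_eq0 v (t : R) : 0 < t -> (forall s, 0 <= s <= t -> combi v 0 s = 0) ->
  forall i, v i = 0.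
Proof.
move=> t0 H.
have H1 l : (l < 2 * k)%N -> forall s, 0 < s < t -> combi v l s = 0.
  elim: l => [|l IH] lk s /andP[s0 st]; first by rewrite H// (ltW s0) (ltW st).
  have lk' := ltnW lk.
  have [_ <-] := combi_derive v s lk'.
  rewrite -(@near_eq_derive _ _ _ (fun=> 0)); first by rewrite derive_cst.
  have : s \in `]0, t[ by rewrite in_itv/= s0.
  move=> /near_in_itvoo; apply: filterS => u; rewrite in_itv/= => Hu.
  by rewrite IH.
move=> i; have lk : (k + i < 2 * k)%N by rewrite mul2n -addnn ltn_add2l.
have : combi v (k + i) 0 = 0.
  have h1 : combi v (k + i) s @[s --> 0^'+] --> combi v (k + i) 0.
    by apply: cvg_at_right_filter; exact: combi_cont.
  have h2 : combi v (k + i) s @[s --> 0^'+] --> (0 : R).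
    apply: cvg_near_cst; near=> s; apply: H1 => //; apply/andP; split.
      by near: s; exact: nbhs_right_gt.
    by near: s; exact: nbhs_right_lt.
  exact: (cvg_unique _ h1 h2).
rewrite /combi (bigD1 i)//= sol_at0// eqxx mulr1 big1 ?addr0// => j ji.
rewrite sol_at0// eqn_add2l (_ : (i == j :> nat) = false) ?mulr0//.
by apply/negbTE; rewrite eq_sym.
Unshelve. all: end_near. Qed.

Definition Xmx (t : R) : 'M[R]_k := \matrix_(l, i) sol i l t.

(** A singular matrix yields a non-trivial combination of Jacobi fields whose derivatives of order
    below k vanish at [t] as well as at 0. Rescaling [0, t] to [0, 1] makes it an eigenfunction with
    eigenvalue [lam * t ^+ 2]. *)
Lemma Xmx_det (t : R) : 0 < t -> ~ bvp_eigenvalue k (lam * t ^+ 2) -> \det (Xmx t) != 0.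
Proof.
move=> t0 nb; apply/negP => /eqP d0; apply: nb.
have : \det (Xmx t)^T == 0 by rewrite det_tr d0.
move=> /det0P[v v0 vX].
pose y := combi (fun i => v ord0 i).
have yt l : (l < k)%N -> y l t = 0.
  move=> lk; have := congr1 (fun M : 'rV_k => M ord0 (Ordinal lk)) vX.
  by rewrite !mxE => <-; apply: eq_bigr => i _; rewrite !mxE.
exists (fun l s => t ^+ l * y l (t * s)); split.
- split=> [j jk|j s jk _].
    apply: continuous_subspaceT => s; apply: cvgMr.
    exact: (continuous_scale (@combi_cont _ j)).
  have d1 := is_derive_scale (combi_derive (fun i => v ord0 i) (t * s) jk).
  by apply: deq (dZ (t ^+ j) d1) _; rewrite exprSr mulrA.
- move=> s _; rewrite -/y.
  have -> : t ^+ (2 * k) = t ^+ (2 * k - 2) * t ^+ 2 by rewrite -exprD subnK// mul2n -addnn; lia.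
  have : y (2 * k)%N (t * s) + lam * y (2 * k - 2)%N (t * s) = 0.
    rewrite /y /combi mulr_sumr -big_split/= big1// => i _.
    by rewrite mulrCA -mulrDr sol_ode// mulr0.
  move: (y (2 * k)%N (t * s)) (y (2 * k - 2)%N (t * s)) => p q pq.
  rewrite (_ : _ + _ = t ^+ (2 * k - 2) * t ^+ 2 * (p + lam * q)); first by rewrite pq mulr0.
  ring.
- move=> l lk; have {}lk : (l < k)%N by lia.
  rewrite mulr0 mulr1 yt// mulr0; split=> //.
  rewrite /y /combi big1 ?mulr0// => i _; rewrite sol_at0 ?(leq_trans lk)//; last by lia.
  by rewrite (_ : (l == k + i)%N = false) ?mulr0//; apply/negbTE; rewrite neq_ltn ltn_addr.
- apply: contrapT => H.
  suff v00 : forall i, v ord0 i = 0.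
    by move/eqP: v0; apply; apply/rowP => i; rewrite v00 mxE.
  apply: (@combi_eq0 _ t) => // s /andP[s0 st]; apply: contrapT => /eqP ys.
  apply: H; exists (s / t).
    by rewrite in_itv/= divr_ge0 ?(ltW t0)// ler_pdivrMr// mul1r.
  have -> : t * (s / t) = s by rewrite mulrC divfK ?gt_eqF.
  by rewrite expr0 mul1r.
Qed.

(** Ostrogradsky momentum conjugate to the [l]-th derivative, for half of the Lagrangian (u^(k))^2 -
    lam (u^(k-1))^2. The top momentum is u^(k) alone, without a [lam] term, hence the separate
    case. *)
Definition mom (i l : nat) (t : R) : R :=
  if l.+1 == k then sol i k t
  else (-1) ^+ (k - l.+1) * (lam * sol i (2 * k - 3 - l) t + sol i (2 * k - 1 - l) t).

Definition mom' (i l : nat) (t : R) : R :=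
  if l.+1 == k then sol i k.+1 t
  else (-1) ^+ (k - l.+1) * (lam * sol i (2 * k - 2 - l) t + sol i (2 * k - l) t).

Lemma mom_derive i l (t : R) : (l < k)%N -> is_derive t 1 (mom i l) (mom' i l t).
Proof.
move=> lk; rewrite /mom /mom'; case: eqP => [_|lk'].
  by apply: sol_derive; lia.
apply: dZ; apply: dD; [apply: dZ|].
  by rewrite (_ : (2 * k - 2 - l = (2 * k - 3 - l).+1)%N); [apply: sol_derive; lia|lia].
by rewrite (_ : (2 * k - l = (2 * k - 1 - l).+1)%N); [apply: sol_derive; lia|lia].
Qed.

(** For l > 0 the momenta are built to satisfy this recursion; at l = 0, where no lower momentum
    exists, it is the differential equation itself. The two extreme indices coincide when k = 1. *)
Lemma mom'E i l (t : R) : (i < k)%N -> (l < k)%N ->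
  mom' i l t = - (if (0 < l)%N then mom i l.-1 t else 0) - lam * ((l.+1 == k)%:R * sol i k.-1 t).
Proof.
move=> ik lk; rewrite /mom'; case: eqP => [lk'|lk'].
  rewrite mul1r; case: ltnP => l0.
    rewrite /mom prednK// (_ : (l == k) = false); last by lia.
    have -> : (k - l = 1)%N by lia.
    have -> : (2 * k - 3 - l.-1 = k.-1)%N by lia.
    have -> : (2 * k - 1 - l.-1 = k.+1)%N by lia.
    by rewrite expr1; ring.
  have k1 : k = 1%N by lia.
  have := sol_ode t ik; rewrite k1 /= => /eqP; rewrite addr_eq0 => /eqP ->.
  by rewrite oppr0 add0r.
rewrite mul0r mulr0 subr0; case: ltnP => l0.
  rewrite /mom prednK// (_ : (l == k) = false); last by lia.
  have -> : (k - l = (k - l.+1).+1)%N by lia.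
  have -> : (2 * k - 3 - l.-1 = 2 * k - 2 - l)%N by lia.
  have -> : (2 * k - 1 - l.-1 = 2 * k - l)%N by lia.
  by rewrite exprS; ring.
have -> : l = 0%N by lia.
by rewrite !subn0 addrC sol_ode// mulr0 oppr0.
Qed.

Definition Pmx (t : R) : 'M[R]_k := \matrix_(l, i) mom i l t.
Definition Xmx' (t : R) : 'M[R]_k := \matrix_(l, i) sol i l.+1 t.
Definition Pmx' (t : R) : 'M[R]_k := \matrix_(l, i) mom' i l t.
(** With [ecol] the last basis vector, x' = N x + v e says that each entry is the derivative of the
    preceding one and that v is the derivative of the last. *)
Definition Nmx : 'M[R]_k := \matrix_(l, j) (j == l.+1 :> nat)%:R.
Definition ecol : 'cV[R]_k := \col_l (l.+1 == k)%:R.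

Lemma sum_sel (G : nat -> R) m :
  \sum_(j < k) (j == m :> nat)%:R * G j = if (m < k)%N then G m else 0.
Proof.
case: ltnP => mk.
  rewrite (bigD1 (Ordinal mk))//= eqxx mul1r big1 ?addr0// => j jm.
  by rewrite (_ : (j == m :> nat) = false) ?mul0r//; apply/negbTE.
apply: big1 => j _; rewrite (_ : (j == m :> nat) = false) ?mul0r//.
by apply/negbTE; rewrite neq_ltn (leq_trans _ mk).
Qed.

Lemma ecol_mul n (B : 'M[R]_(k, n)) (G : nat -> 'I_n -> R) :
  (forall l i, B l i = G l i) -> forall i, (ecol^T *m B) ord0 i = G k.-1 i.
Proof.
move=> BG i; rewrite mxE (eq_bigr (fun j : 'I_k => (j == k.-1 :> nat)%:R * G j i)).
  by rewrite (sum_sel (fun j => G j i)) prednK// leqnn.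
by move=> j _; rewrite !mxE BG; congr (_%:R * _); congr nat_of_bool; lia.
Qed.

Lemma Nmx_mul n (B : 'M[R]_(k, n)) (G : nat -> 'I_n -> R) :
  (forall l i, B l i = G l i) ->
  forall l i, (Nmx *m B) l i = if (l.+1 < k)%N then G l.+1 i else 0.
Proof.
move=> BG l i; rewrite mxE -(sum_sel (fun j => G j i)).
by apply: eq_bigr => j _; rewrite !mxE BG.
Qed.

Lemma NmxT_mul n (B : 'M[R]_(k, n)) (G : nat -> 'I_n -> R) :
  (forall l i, B l i = G l i) ->
  forall l i, (Nmx^T *m B) l i = if (0 < l)%N then G l.-1 i else 0.
Proof.
move=> BG l i; rewrite mxE.
case: ltnP => l0.
  have lk : (l.-1 < k)%N by rewrite (leq_ltn_trans (leq_pred _)).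
  rewrite -[RHS](_ : (if (l.-1 < k)%N then G l.-1 i else 0) = _); last by rewrite lk.
  rewrite -(sum_sel (fun j => G j i)); apply: eq_bigr => j _.
  by rewrite !mxE BG; congr (_%:R * _); congr nat_of_bool; lia.
rewrite big1// => j _; rewrite !mxE (_ : (l == j.+1 :> nat) = false) ?mul0r//; lia.
Qed.

Lemma Xmx'E t : Xmx' t = Nmx *m Xmx t + ecol *m (ecol^T *m Pmx t).
Proof.
apply/matrixP => l i.
rewrite mxE [RHS]mxE (Nmx_mul (G := fun l i => sol i l t)); last by move=> ? ?; rewrite mxE.
rewrite [(ecol *m _) l i]mxE big_ord1.
rewrite (ecol_mul (G := fun l i => mom i l t)); last by move=> ? ?; rewrite mxE.
rewrite mxE /mom prednK// eqxx; have := ltn_ord l.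
rewrite leq_eqVlt => /orP[/eqP ->|lk]; first by rewrite ltnn eqxx mul1r add0r.
by rewrite lk (ltn_eqF lk) mul0r addr0.
Qed.

Lemma Pmx'E t : Pmx' t = - (Nmx^T *m Pmx t) - lam *: (ecol *m (ecol^T *m Xmx t)).
Proof.
apply/matrixP => l i; rewrite mxE mom'E//.
rewrite [RHS]mxE [(- (Nmx^T *m _)) l i]mxE (NmxT_mul (G := fun l i => mom i l t)); last first.
  by move=> ? ?; rewrite mxE.
congr (_ + _); rewrite mxE mxE [(_ *m _) l i]mxE big_ord1; congr (- (_ * _)).
rewrite (ecol_mul (G := fun l i => sol i l t)); last by move=> ? ?; rewrite mxE.
by rewrite mxE.
Qed.

Lemma Xmx_mder t : mder Xmx (Xmx' t) t.
Proof.
move=> l i; under eq_fun do rewrite mxE; rewrite mxE; apply: sol_derive.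
by rewrite (leq_trans (ltn_ord l))// leq_pmull.
Qed.

Lemma Pmx_mder t : mder Pmx (Pmx' t) t.
Proof. by move=> l i; under eq_fun do rewrite mxE; rewrite mxE; exact: mom_derive. Qed.

(** The difference of the two sides is constant in [t] by [hamiltonian_sym], and zero at 0 because X
    vanishes there. *)
Lemma XP_sym t : (Xmx t)^T *m Pmx t = (Pmx t)^T *m Xmx t.
Proof.
pose Q s := (Xmx s)^T *m Pmx s - (Pmx s)^T *m Xmx s.
have dQ s : mder Q 0 s.
  have := mderB (mderM (mder_tr (Xmx_mder s)) (Pmx_mder s)) (mderM (mder_tr (Pmx_mder s)) (Xmx_mder s)).
  by rewrite (hamiltonian_sym (Xmx'E s) (Pmx'E s)) subrr.
have Q0 : Q 0 = 0.
  rewrite /Q (_ : Xmx 0 = 0) ?trmx0 ?mul0mx ?mulmx0 ?subrr//.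
  apply/matrixP => l i; rewrite !mxE sol_at0//; last first.
    by rewrite (leq_trans (ltn_ord l))// leq_pmull.
  by rewrite (_ : (_ == _) = false)//; apply/negbTE; rewrite neq_ltn ltn_addr.
apply/eqP; rewrite -subr_eq0 -/(Q t) -Q0; apply/eqP/matrixP => i j.
by apply: (@is_derive_0_is_cst R (fun s => Q s i j) t 0) => s; have := dQ s i j; rewrite mxE.
Qed.

End JacobiFields.

(** * The inequality in the absence of conjugate points *)

Section Wirtinger.
Context {R : realType}.
Notation mu := (@lebesgue_measure R).

Lemma itg_itv (f : R -> R) (a b : R) : continuous f ->
  mu.-integrable `[a, b] (EFin \o f).
Proof.
move=> cf; apply: continuous_compact_integrable; first exact: segment_compact.
by apply: continuous_subspaceT => x; exact: cf.
Qed.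

Lemma FTC_itv (F f : R -> R) (a b : R) : a <= b -> continuous f ->
  (forall t : R, is_derive t 1 F (f t)) -> \int[mu]_(t in `[a, b]) f t = F b - F a.
Proof.
rewrite le_eqVlt => /orP[/eqP <- _ _|ab cf dF].
  by rewrite set_itv1 Rintegral_set1 subrr.
have cF t : {for t, continuous F} by exact: is_derive_cont (dF t).
rewrite /Rintegral (continuous_FTC2 ab (F := F)) -?EFinB//.
- by apply: continuous_subspaceT => x; exact: cf.
- split.
  + by move=> t _; case: (dF t).
  + by apply: cvg_at_right_filter; exact: cF.
  + by apply: cvg_at_left_filter; exact: cF.
- by move=> t _; rewrite derive1E; case: (dF t).
Qed.

(** [S'] is known only pointwise, so it is not integrated: a primitive of the continuous [q] minus
    [S] is nondecreasing on [a, b]. *)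
Lemma FTC_le (S S' q : R -> R) (a b : R) : a <= b -> continuous q ->
  (forall t : R, a <= t <= b -> is_derive t 1 S (S' t) /\ S' t <= q t) ->
  S b - S a <= \int[mu]_(t in `[a, b]) q t.
Proof.
move=> ab cq H.
(* Starting at [a - 1] makes [a] an interior point, where [G] is differentiable on both sides. *)
pose G (t : R) := \int[mu]_(s in `[a - 1, t]) q s.
have dG t : a <= t -> is_derive t 1 G (q t).
  move=> at_; have [d1 d2] := @continuous_FTC1_closed R q (a - 1) t (t + 1)
    ltac:(lra) (itg_itv _ _ cq) ltac:(lra) (cq t).
  by split; [exact: d1|rewrite -derive1E; exact: d2].
have dD t : a <= t <= b -> is_derive t 1 (fun t => G t - S t) (q t - S' t).
  by move=> /andP[t1 t2]; apply: dB; [exact: dG|case: (H t)=> //; rewrite t1].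
have le1 : G a - S a <= G b - S b.
  apply: (@ger0_derive1_ndecr R (fun t => G t - S t) a b) => //.
  - move=> t; rewrite in_itv/= => /andP[/ltW t1 /ltW t2].
    by case: (dD t); rewrite ?t1.
  - move=> t; rewrite in_itv/= => /andP[/ltW t1 /ltW t2].
    have t12 : a <= t <= b by rewrite t1.
    by rewrite derive1E; case: (dD t t12) => _ ->; rewrite subr_ge0; case: (H t t12).
  - apply/continuous_in_subspaceT => t /[!inE]/=; rewrite in_itv/= => t12.
    exact: is_derive_cont (dD t t12).
have -> : \int[mu]_(t in `[a, b]) q t = G b - G a.
  rewrite /G Rintegral_itvB ?bnd_simp//.
  - rewrite Rintegral_itv_obnd_cbnd//.
    by apply: integrableS (itg_itv a b cq) => //; exact: subset_itv_oc_cc.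
  - exact: itg_itv.
  - lra.
lra.
Qed.

Lemma dshift (f : R -> R) (c t f' : R) : is_derive (t + c) 1 f f' ->
  is_derive t 1 (fun s => f (s + c)) f'.
Proof.
move=> d1; have d2 : is_derive (t : R) 1 (fun y : R => y + c) 1.
  by apply: deq (dD (is_derive_id t 1) (dcst c t)) _; rewrite addr0.
by have := @is_derive1_comp _ f (fun y : R => y + c) t _ _ d1 d2; rewrite mulr1.
Qed.

(** With y = X^-1 x and S = x^T P y, completing the square gives S' = u_k^2 - lam u_(k-1)^2 - v^2.
    The vector x collects the derivatives of order below k, so S vanishes at both ends and 0 is at
    most the integral of u_k^2 - lam u_(k-1)^2. The shift [c] lets the Jacobi fields start away from
    [a]. *)
Lemma jacobi_wirtinger (lam : R) (k : nat) (a b c : R) (u : nat -> R -> R) :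
  0 < lam -> (0 < k)%N -> a <= b ->
  (forall j (t : R), is_derive t 1 (u j) (u j.+1 t)) ->
  (forall l, (l < k)%N -> u l a = 0 /\ u l b = 0) ->
  (forall t, a <= t <= b -> \det (Xmx lam k (t + c)) != 0) ->
  lam * \int[mu]_(t in `[a, b]) (u k.-1 t ^+ 2) <= \int[mu]_(t in `[a, b]) (u k t ^+ 2).
Proof.
move=> lam0 k0 ab du ubd Xdet.
pose X t := Xmx lam k (t + c); pose P t := Pmx lam k (t + c).
pose x t : 'cV[R]_k := \col_l u l t.
(* Cramer's formula for X^-1 x, from which differentiability can be read off. *)
pose y t : 'cV[R]_k := (\det (X t))^-1 *: (\adj (X t) *m x t).
pose S t := ((x t)^T *m (P t *m y t)) ord0 ord0.
have cu j : continuous (u j) by move=> t; exact: is_derive_cont (du j t).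
have csq j : continuous (fun t => u j t ^+ 2).
  rewrite (_ : (fun t => _) = (fun t => u j t * u j t)); last first.
    by apply/funext => t; rewrite expr2.
  by move=> t; apply: cvgM; exact: cu.
pose q t := u k t ^+ 2 - lam * u k.-1 t ^+ 2.
have cq : continuous q.
  by move=> t; apply: cvgB; [exact: csq|apply: cvgMr; exact: csq].
pose v t := u k t - ((ecol k)^T *m (P t *m y t)) ord0 ord0.
have dX t : mder X (Xmx' lam k (t + c)) t.
  by move=> i j; apply: (dshift (f := fun s => Xmx lam k s i j)); exact: Xmx_mder.
have dP t : mder P (Pmx' lam k (t + c)) t.
  by move=> i j; apply: (dshift (f := fun s => Pmx lam k s i j)); exact: Pmx_mder.
have dx t : mder x (\col_l u l.+1 t) t.
  by move=> i j; under eq_fun do rewrite mxE; rewrite mxE; exact: du.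
have main t : a <= t <= b -> is_derive t 1 S (q t - v t ^+ 2) /\ q t - v t ^+ 2 <= q t.
  move=> tab; split; last by rewrite gerBl sqr_ge0.
  have [dd Hdd] : dble (fun s => \det (X s)) t.
    by apply: dble_det => i j; eexists; exact: dX.
  have d0 := Xdet t tab.
  (* x = X y holds only where the determinant is non-zero; a neighbourhood of [t] is enough to
     differentiate it. *)
  have nd : \forall s \near t, \det (X s) != 0.
    exact: (cvgr_neq0 _ (is_derive_cont Hdd) d0).
  have /choice[y' Hy'] : forall i, dble (fun s => y s i ord0) t.
    move=> i; rewrite (_ : (fun s => _) = (fun s => (\det (X s))^-1 * \sum_j (\adj (X s)) i j * x s j ord0)).
      apply: dbleM; first by eexists; apply: is_deriveV.
      apply: dble_sum => j; apply: dbleM; last by eexists; exact: dx.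
      by apply: dble_adj => i' j'; eexists; exact: dX.
    by apply/funext => s; rewrite !mxE.
  pose Y' : 'cV[R]_k := \col_i y' i.
  have dy : mder y Y' t by move=> i j; rewrite ord1 mxE; exact: Hy'.
  have xE s : \det (X s) != 0 -> x s = X s *m y s.
    move=> ds; rewrite /y -scalemxAr mulmxA mul_mx_adj mul_scalar_mx scalerA.
    by rewrite mulVf// scale1r.
  have dxE : \col_l u l.+1 t = Xmx' lam k (t + c) *m y t + X t *m Y'.
    apply/colP => l; rewrite mxE.
    have H1 := mderM (dX t) dy l ord0.
    have H2 : is_derive t 1 (u l) ((Xmx' lam k (t + c) *m y t + X t *m Y') l ord0).
      apply: near_eq_is_derive H1; apply: filterS nd => s ds.
      by rewrite -xE// mxE.
    by have [_ <-] := H2; have [_ <-] := du l t.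
  have x'E : \col_l u l.+1 t = Nmx k *m x t + u k t *: ecol k.
    apply/matrixP => l j; rewrite mxE [RHS]mxE.
    rewrite (Nmx_mul (G := fun l _ => u l t)); last by move=> ? ?; rewrite mxE.
    rewrite !mxE; have := ltn_ord l; rewrite leq_eqVlt => /orP[/eqP E|lk].
      by rewrite E ltnn eqxx add0r mulr1.
    by rewrite lk (ltn_eqF lk) mulr0 addr0.
  have := mderM (mder_tr (dx t)) (mderM (dP t) dy) ord0 ord0.
  have := hamiltonian_square (Xmx'E lam0 k0 (t + c)) (Pmx'E lam0 k0 (t + c)) x'E
    (XP_sym lam0 k0 (t + c)) (xE t d0) dxE.
  rewrite mulmxDr addrA => ->; rewrite mxE eqxx mulr1n.
  rewrite (ecol_mul lam0 k0 (G := fun l _ => u l t)); last by move=> ? ?; rewrite mxE.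
  by move=> /deq; apply.
have Sa t : (forall l, (l < k)%N -> u l t = 0) -> S t = 0.
  move=> ut; rewrite /S (_ : x t = 0) ?trmx0 ?mul0mx ?mxE//.
  by apply/colP => l; rewrite !mxE ut.
have := FTC_le ab cq main.
rewrite !Sa ?subrr; [|by move=> l /ubd[]|by move=> l /ubd[]].
rewrite /q RintegralB//; [|exact: itg_itv|].
  by rewrite RintegralZl// ?subr_ge0//; exact: itg_itv.
apply: (@itg_itv (fun t => lam * u k.-1 t ^+ 2)) => t.
by apply: cvgMr; exact: csq.
Qed.

(* Below the first eigenvalue the interval carries no conjugate point, so the
   Jacobi fields issued from a point slightly to its left stay independent. *)
Lemma wirtinger_cimmino_ineq (k : nat) (sigma delta : R) :
  (0 < k)%N -> 0 < sigma -> 0 < delta -> delta < wirtinger_cimmino R k / sigma ->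
  exists2 lam, sigma ^+ 2 < lam & forall (a b : R) (u : nat -> R -> R),
    a <= b -> b - a <= delta ->
    (forall j (t : R), is_derive t 1 (u j) (u j.+1 t)) ->
    (forall l, (l < k)%N -> u l a = 0 /\ u l b = 0) ->
    lam * \int[mu]_(t in `[a, b]) (u k.-1 t ^+ 2) <= \int[mu]_(t in `[a, b]) (u k t ^+ 2).
Proof.
move=> k0 s0 d0; rewrite /wirtinger_cimmino.
(* If no first eigenvalue existed, the constant would take its default value 0, contradicting 0 <
   delta < 0 / sigma. *)
case: xgetP => [lam1 _ [l0 _ lmin] Hd|_]; last by rewrite sqrtr0 mul0r; lra.
have Hd2 : (delta * sigma) ^+ 2 < lam1.
  rewrite -(sqr_sqrtr (ltW l0)) ltrXn2r// ?nnegrE ?mulr_ge0 ?(ltW d0) ?(ltW s0) ?sqrtr_ge0//.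
  by rewrite -ltr_pdivlMr.
have dd : 0 < delta ^+ 2 by rewrite exprn_gt0.
(* The midpoint of sigma^2 and lam1 / delta^2: above the first for the contraction, below the second
   to leave room beyond [delta]. *)
pose lam := (sigma ^+ 2 + lam1 / delta ^+ 2) / 2.
have sl : sigma ^+ 2 < lam1 / delta ^+ 2.
  by rewrite ltr_pdivlMr// -exprMn mulrC.
have ll : sigma ^+ 2 < lam by rewrite /lam; lra.
have lam0 : 0 < lam by exact: le_lt_trans (sqr_ge0 _) ll.
have lam_lt : lam < lam1 / delta ^+ 2 by rewrite /lam; lra.
(* lam r^2 = lam1, so no point of ]0, r[ is conjugate to 0. *)
pose r := Num.sqrt (lam1 / lam).
have rd : delta < r.
  rewrite -(ger0_norm (ltW d0)) -sqrtr_sqr ltr_sqrt; last by rewrite divr_gt0.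
  by rewrite ltr_pdivlMr// mulrC -ltr_pdivlMr.
have rr : r ^+ 2 = lam1 / lam by rewrite sqr_sqrtr// divr_ge0 ?ltW.
exists lam => // a b u ab bad du ubd.
(* Centres an interval of length [delta] in ]0, r[, at distance (r - delta) / 2 from both ends. *)
pose c := - a + (r - delta) / 2.
apply: (@jacobi_wirtinger lam k a b c u) => // t /andP[at_ tb].
have t0 : 0 < t + c by rewrite /c; lra.
have tr : t + c < r by rewrite /c; lra.
apply: Xmx_det => // ev.
have : lam1 <= lam * (t + c) ^+ 2 by apply: lmin => //; rewrite mulr_gt0// exprn_gt0.
apply/negP; rewrite -ltNge mulrC -ltr_pdivlMr// -rr.
by rewrite ltrXn2r// ?nnegrE ?(ltW t0)// (le_trans (ltW t0) (ltW tr)).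
Qed.

End Wirtinger.

(** * Hermite interpolation between the nodes *)

Section Hermite.
Context {R : realType}.
Notation mu := (@lebesgue_measure R).
Implicit Types (p q : {poly R}).

Lemma dvdp_deriv (c : R) m p : ('X - c%:P) ^+ m.+1 %| p -> ('X - c%:P) ^+ m %| p^`().
Proof.
move=> /dvdpP[q ->]; rewrite derivM deriv_exp derivXsubC mul1r dvdp_add //.
  by rewrite dvdp_mull // exprS dvdp_mulIr.
by rewrite dvdp_mull // -mulr_natl dvdp_mulIr.
Qed.

Lemma dvdp_derivn_root (c : R) m p j : (j < m)%N -> ('X - c%:P) ^+ m %| p -> p^`(j).[c] = 0.
Proof.
elim: j m p => [|j IH] [//|m] p jm pd.
  have /dvdpP[q ->] := pd.
  by rewrite derivn0 hornerM exprS hornerM hornerXsubC subrr mul0r mulr0.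
rewrite derivSn; apply: (IH m) => //; exact: dvdp_deriv.
Qed.

Lemma derivn_monomial0 l j : (((l`!)%:R^-1 : R) *: 'X^l)^`(j).[0] = (j == l)%:R.
Proof.
rewrite derivnZ derivnXn hornerZ hornerMn hornerXn.
have [<-|jl] := eqVneq j l.
  by rewrite subnn expr0 ffactnn mulVf // pnatr_eq0 -lt0n fact_gt0.
have [lj|lj] := ltnP l j; first by rewrite ffact_small // mulr0n mulr0.
by rewrite expr0n subn_eq0 leqNgt ltn_neqAle jl lj /= mul0rn mulr0.
Qed.

(** Bezout for X^k and (X - 1)^k gives a polynomial congruent to 1 modulo the first and to 0 modulo
    the second. Multiplied by X^l / l! it has the required jets, and reduction modulo the product
    lowers the degree without changing them. *)
Lemma hermite_basis_exists k l : exists B : {poly R}, (size B <= k + k)%N /\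
  forall j, (j < k)%N -> B^`(j).[0] = (j == l)%:R /\ B^`(j).[1] = 0.
Proof.
set P : {poly R} := ('X - 0%:P) ^+ k; set Q : {poly R} := ('X - 1%:P) ^+ k.
have cop : coprimep P Q.
  by apply: coprimep_expl; apply: coprimep_expr; rewrite coprimep_XsubC2 // subr0 oner_eq0.
have /Bezout_coprimepP[[u v] /= uv] := cop.
have : size (u * P + v * Q) == 1%N by rewrite (eqp_size uv) size_poly1.
move=> /size_poly1P[c c0 uvc].
pose m : {poly R} := ((l`!)%:R^-1 : R) *: 'X^l.
pose N := m * (c^-1%:P * v * Q).
have N0 : N - m = - (m * c^-1%:P * u) * P.
  rewrite /N; have -> : c^-1%:P * v * Q = 1 - c^-1%:P * u * P.
    apply/eqP; rewrite eq_sym subr_eq -!mulrA -mulrDr (addrC (v * Q)) uvc -polyCM mulVf //.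
  by ring.
pose M := P * Q.
have M0 : M != 0 by rewrite mulf_neq0 // expf_neq0 // polyXsubC_eq0.
have sM : size M = (k + k).+1.
  rewrite size_mul ?expf_neq0 ?polyXsubC_eq0 // !size_exp_XsubC; lia.
have E : N %% M = N - N %/ M * M by apply/eqP; rewrite eq_sym subr_eq addrC -divp_eq.
exists (N %% M); split.
  by have := ltn_modpN0 N M0; rewrite sM ltnS.
move=> j jk; split.
  have -> : N %% M = m + (N %% M - m) by rewrite addrC subrK.
  rewrite derivnD hornerD derivn_monomial0 (@dvdp_derivn_root 0 k) ?addr0 //.
  rewrite E addrAC N0 /M -/P (mulrC P) mulrA -mulrBl; exact: dvdp_mulIr.
rewrite (@dvdp_derivn_root 1 k) // E /N /M -/Q !mulrA -mulrBl; exact: dvdp_mulIr.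
Qed.

Definition hermite_basis k l : {poly R} := xget 0 [set B : {poly R} | (size B <= k + k)%N /\
  forall j, (j < k)%N -> B^`(j).[0] = (j == l)%:R /\ B^`(j).[1] = 0].

Lemma hermite_basisP k l : (size (hermite_basis k l) <= k + k)%N /\
  forall j, (j < k)%N -> (hermite_basis k l)^`(j).[0] = (j == l)%:R /\ (hermite_basis k l)^`(j).[1] = 0.
Proof.
rewrite /hermite_basis; case: xgetP => [B _ //|] /=.
by have [B HB] := hermite_basis_exists k l => /(_ B).
Qed.

(* Basis polynomial attached to the node [a] of the cell with end points [a]
   and [a + h]; [h] may be negative. *)
Definition hermite_node k (h a : R) l : {poly R} :=
  h ^+ l *: (hermite_basis k l \Po (h^-1 *: ('X - a%:P))).

Lemma derivn_hermite_node k h a l j : (hermite_node k h a l)^`(j) =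
  (h ^+ l * h^-1 ^+ j) *: ((hermite_basis k l)^`(j) \Po (h^-1 *: ('X - a%:P))).
Proof.
elim: j => [|j IH]; first by rewrite derivn0 expr0 mulr1.
rewrite derivnS IH derivZ deriv_comp -derivnS derivZ derivXsubC.
by rewrite -!scalerAr mulr1 scalerA exprSr mulrA.
Qed.

Lemma hermite_node_horner k h a l j t : (hermite_node k h a l)^`(j).[t] =
  h ^+ l * h^-1 ^+ j * (hermite_basis k l)^`(j).[h^-1 * (t - a)].
Proof. by rewrite derivn_hermite_node hornerZ horner_comp hornerZ hornerXsubC. Qed.

Lemma hermite_node_near k h a l j : h != 0 -> (j < k)%N -> (hermite_node k h a l)^`(j).[a] = (j == l)%:R.
Proof.
move=> h0 jk; rewrite hermite_node_horner subrr mulr0 ((hermite_basisP k l).2 j jk).1.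
have [->|] := eqVneq j l; last by rewrite mulr0.
by rewrite mulr1 -exprMn mulfV // expr1n.
Qed.

Lemma hermite_node_far k h a l j : h != 0 -> (j < k)%N -> (hermite_node k h a l)^`(j).[a + h] = 0.
Proof.
by move=> h0 jk; rewrite hermite_node_horner addrAC subrr add0r mulVf // ((hermite_basisP k l).2 j jk).2 mulr0.
Qed.

Lemma hermite_node_top k h a l : (hermite_node k h a l)^`(k + k) = 0.
Proof. by rewrite derivn_hermite_node (derivn_poly0 ((hermite_basisP k l).1)) comp_poly0 scaler0. Qed.

Definition pnorm p : R := \sum_(i < size p) `|p`_i|.

Lemma pnorm_ge0 p : 0 <= pnorm p.
Proof. by apply: sumr_ge0. Qed.

Lemma horner_unit_le p s : 0 <= s -> s <= 1 -> `|p.[s]| <= pnorm p.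
Proof.
move=> s0 s1; rewrite horner_coef; apply: le_trans (ler_norm_sum _ _ _) _.
apply: ler_sum => i _; rewrite normrM ler_piMr // ger0_norm ?exprn_ge0 //.
exact: exprn_ile1.
Qed.

Definition hermite_bound k (g d : R) : R := \sum_(l < k) \sum_(j < k)
  (1 + d) ^+ l * (1 + g^-1) ^+ j * pnorm (hermite_basis k l)^`(j).

(** The affine change of variable contributes the factor h^l h^-j, which is bounded over all cells
    because g <= |h| <= d; the separation of the nodes controls the negative powers. *)
Lemma hermite_node_le k g d h a l j t : 0 < g -> g <= `|h| -> `|h| <= d -> (l < k)%N -> (j < k)%N ->
  0 <= h^-1 * (t - a) -> h^-1 * (t - a) <= 1 -> `|(hermite_node k h a l)^`(j).[t]| <= hermite_bound k g d.
Proof.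
move=> g0 gh hd lk jk s0 s1; rewrite hermite_node_horner.
have g1 : 0 <= g^-1 by rewrite invr_ge0 ltW.
have d0 : 0 <= d by exact: le_trans hd.
have T0 (l' j' : 'I_k) : 0 <= (1 + d) ^+ l' * (1 + g^-1) ^+ j' * pnorm (hermite_basis k l')^`(j').
  by rewrite !mulr_ge0 ?exprn_ge0 ?addr_ge0 ?ler01 ?pnorm_ge0.
apply: (@le_trans _ _ ((1 + d) ^+ l * (1 + g^-1) ^+ j * pnorm (hermite_basis k l)^`(j))).
  rewrite 2!normrM; apply: ler_pM; rewrite ?mulr_ge0 ?normr_ge0 ?horner_unit_le //.
  rewrite !normrX; apply: ler_pM; rewrite ?exprn_ge0 ?normr_ge0 //.
    by apply: lerXn2r; rewrite ?nnegrE ?addr_ge0 ?normr_ge0 ?ler01 //; apply: le_trans hd _; rewrite lerDr.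
  apply: lerXn2r; rewrite ?nnegrE ?addr_ge0 ?normr_ge0 ?ler01 //.
  rewrite normfV; apply: (@le_trans _ _ g^-1); last by rewrite lerDr.
  by rewrite lef_pV2 ?posrE //; apply: lt_le_trans gh.
rewrite /hermite_bound (bigD1 (Ordinal lk)) //= (bigD1 (Ordinal jk)) //= -addrA lerDl.
apply: addr_ge0; apply: sumr_ge0 => i _; first exact: (T0 (Ordinal lk) i).
by apply: sumr_ge0 => j' _; exact: T0.
Qed.

Lemma is_derive_derivn p j (t : R) : is_derive t 1 (fun s => p^`(j).[s]) p^`(j.+1).[t].
Proof. by rewrite derivnS; exact: is_derive_poly. Qed.

Lemma continuous_poly p : continuous (fun s : R => p.[s]).
Proof. move=> t; exact: (is_derive_cont (is_derive_derivn p 0 t)). Qed.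

Lemma derivn_sum (I : Type) (s : seq I) (F : I -> {poly R}) n :
  (\sum_(i <- s) F i)^`(n) = \sum_(i <- s) (F i)^`(n).
Proof. by elim/big_rec2: _ => [|i p q _ <-]; rewrite ?derivn0 ?linear0 ?derivnD //. Qed.

(* Integrating by parts [k] times moves all derivatives onto [u], whose
   boundary values vanish. *)
Lemma hermite_orthogonal k (a b : R) (u : nat -> R -> R) p : a <= b ->
  (forall j (t : R), is_derive t 1 (u j) (u j.+1 t)) ->
  (forall l, (l < k)%N -> u l a = 0 /\ u l b = 0) -> p^`(k + k) = 0 ->
  \int[mu]_(t in `[a, b]) (u k t * p^`(k).[t]) = 0.
Proof.
move=> ab du u0 p0.
(* The boundary terms of the first [m] integrations by parts. The derivative of [F m] is the
   integrand minus the term still to be integrated, and at m = k that term contains p^(2k) = 0. *)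
pose F m t : R := \sum_(j < m) (-1) ^+ j * (u (k - j.+1)%N t * p^`(k + j).[t]).
have dF m : (m <= k)%N -> forall t : R,
    is_derive t 1 (F m) (u k t * p^`(k).[t] - (-1) ^+ m * (u (k - m)%N t * p^`(k + m).[t])).
  elim: m => [_ t|m IH mk t].
    rewrite expr0 subn0 addn0 mul1r subrr.
    have -> : F 0%N = cst 0 by apply/funext => s; rewrite /F big_ord0.
    exact: is_derive_cst.
  have -> : F m.+1 = (fun s => F m s + (-1) ^+ m * (u (k - m.+1)%N s * p^`(k + m).[s])).
    by apply/funext => s; rewrite /F big_ord_recr.
  have d1 := du (k - m.+1)%N t; have d2 := is_derive_derivn p (k + m) t.
  have d3 := IH (ltnW mk) t.
  have e : (k - m.+1).+1 = (k - m)%N by lia.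
  rewrite e in d1; rewrite addnS.
  apply: is_derive_eq.
  rewrite /GRing.scale /= exprS; move: (u _ _) (u _ _) (u _ _) (_.[_]) (_.[_]) (_.[_]) ((-1) ^+ m).
  by move=> *; ring.
have dk (t : R) : is_derive t 1 (F k) (u k t * p^`(k).[t]).
  by have := dF k (leqnn k) t; rewrite p0 horner0 mulr0 mulr0 subr0.
have cf : continuous (fun t => u k t * p^`(k).[t]).
  move=> t; apply: continuousM; first exact: (is_derive_cont (du k t)).
  exact: continuous_poly.
rewrite (FTC_itv ab cf dk) /F !big1 ?subrr // => j _;
  have [ua ub] : u (k - j.+1)%N a = 0 /\ u (k - j.+1)%N b = 0
    by apply: u0; have := ltn_ord j; lia.
  by rewrite ?ua ?ub mul0r mulr0.
by rewrite ?ua ?ub mul0r mulr0.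
Qed.

End Hermite.

(** * Node functions on the cells *)

Section Cells.
Context {R : realType}.
Notation mu := (@lebesgue_measure R).
Implicit Types (x : int -> R) (g d : R) (i j : int) (p : {poly R}).

Definition gaps x g d := 0 < g /\ forall i, g <= x (i + 1) - x i /\ x (i + 1) - x i <= d.
(** Half-open, so that distinct cells are disjoint and consecutive ones fit together without a
    gap. *)
Definition seg x i : set (measurableTypeR R) := `]x i, x (i + 1)]%classic.

Lemma gaps_lt x g d i : gaps x g d -> x i < x (i + 1).
Proof. by move=> [g0 /(_ i)[h _]]; rewrite -subr_gt0; apply: lt_le_trans h. Qed.

Lemma gaps_add x g d i (n : nat) : gaps x g d -> x i + n%:R * g <= x (i + n%:Z).
Proof.
move=> [g0 G]; elim: n => [|n IH]; first by rewrite mul0r !addr0.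
have [h _] := G (i + n%:Z); have -> : i + n.+1%:Z = i + n%:Z + 1 by lia.
rewrite -natr1 mulrDl mul1r; lra.
Qed.

Lemma gaps_le x g d i j : gaps x g d -> i <= j -> x i <= x j.
Proof.
move=> G ij; have -> : j = i + `|j - i|%N by lia.
by apply: le_trans (gaps_add _ _ G); rewrite lerDl mulr_ge0 // ltW; case: G.
Qed.

Lemma seg_disj x g d i j (t : R) : gaps x g d -> seg x i t -> seg x j t -> i = j.
Proof.
move=> G; rewrite /seg /= !in_itv /= => /andP[a1 a2] /andP[b1 b2].
case: (ltgtP i j) => // ij.
  have h : x (i + 1) <= x j by apply: gaps_le G _; lia.
  by move: (lt_le_trans b1 a2); rewrite ltNge h.
have h : x (j + 1) <= x i by apply: gaps_le G _; lia.
by move: (lt_le_trans a1 b2); rewrite ltNge h.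
Qed.

Lemma measurable_seg x i : measurable (seg x i).
Proof. exact: measurable_itv. Qed.

Lemma seg_mu x g d i : gaps x g d -> (mu (seg x i) < +oo)%E /\ \int[mu]_t (\1_(seg x i) t : R) = x (i + 1) - x i.
Proof.
move=> G; have xx := gaps_lt i G.
have m : mu (seg x i) = (x (i + 1) - x i)%:E.
  by rewrite /seg lebesgue_measure_itv /= lte_fin xx.
split; first by rewrite m ltry.
rewrite -[RHS]/(fine (x (i + 1) - x i)%:E) -m /Rintegral; congr fine.
by rewrite integral_indic ?setIT //; exact: measurable_seg.
Qed.

Lemma seg_int x g d i (f : R -> R) : gaps x g d -> continuous f ->
  itg (fun t => \1_(seg x i) t * f t) /\
  \int[mu]_t (\1_(seg x i) t * f t) = \int[mu]_(t in `[x i, x (i + 1)]) f t.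
Proof.
move=> G cf; have Ic := itg_itv (x i) (x (i + 1)) cf.
have Io : mu.-integrable (seg x i) (EFin \o f).
  apply: integrableS Ic; [exact: measurable_itv|exact: measurable_itv|].
  exact: subset_itv_oc_cc.
have [I1 E1] := itg_restrict (measurable_seg x i) Io; split => //.
by rewrite E1 /seg Rintegral_itv_obnd_cbnd.
Qed.

Lemma seg_L2 x g d i (f : R -> R) : gaps x g d -> continuous f -> L2 (fun t => \1_(seg x i) t * f t).
Proof.
move=> G cf; split; first by have [I _] := seg_int i G cf; exact: itg_meas I.
have cf2 : continuous (fun t => f t ^+ 2).
  by move=> t; apply: (@continuous_comp _ _ _ f (fun y => y ^+ 2)); [exact: cf|exact: exprn_continuous].
have [I _] := seg_int i G cf2; suff -> : (fun t => (\1_(seg x i) t * f t) ^+ 2) =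
  (fun t => \1_(seg x i) t * f t ^+ 2) by [].
by apply/funext => t; rewrite exprMn [in LHS]expr2 indic_sqr.
Qed.

Lemma disj_mul0 x g d (phi : int -> int) (s : seq int) (F : int -> R -> R) i (t : R) : gaps x g d ->
  injective phi -> (forall j t, ~ seg x (phi j) t -> F j t = 0) -> i \notin s ->
  F i t * \sum_(j <- s) F j t = 0.
Proof.
move=> G ip F0 is_; have [it|it] := pselect (seg x (phi i) t); last by rewrite F0 ?mul0r.
rewrite big_seq big1 ?mulr0 // => j js; apply: F0 => jt.
by move: is_; rewrite (ip _ _ (seg_disj G it jt)) js.
Qed.

Lemma disj_sqr x g d (phi : int -> int) (s : seq int) (F : int -> R -> R) (t : R) : gaps x g d ->
  injective phi -> (forall j t, ~ seg x (phi j) t -> F j t = 0) -> uniq s ->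
  (\sum_(j <- s) F j t) ^+ 2 = \sum_(j <- s) F j t ^+ 2.
Proof.
move=> G ip F0; elim: s => [_|i s IH /andP[is_ us]]; first by rewrite !big_nil expr0n.
by rewrite !big_cons sqrrD (disj_mul0 _ G ip F0 is_) mul0rn addr0 IH.
Qed.

Lemma disj_dot x g d (phi : int -> int) (s : seq int) (F : int -> R -> R) : gaps x g d ->
  injective phi -> (forall j t, ~ seg x (phi j) t -> F j t = 0) -> uniq s ->
  (forall j, L2 (F j)) ->
  dot (fun t => \sum_(j <- s) F j t) (fun t => \sum_(j <- s) F j t) =
  \sum_(j <- s) dot (F j) (F j).
Proof.
move=> G ip F0 us LF; rewrite /dot.
under eq_Rintegral => t _ do rewrite -expr2 (disj_sqr t G ip F0 us).
by rewrite Rint_sum // => j; exact: (LF j).2.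
Qed.

(** The blocks indexed by different [i] live on different cells, so their squared norms add up; each
    is at most k^2 M^2 d times the squared coefficients, a cell having length at most [d]. The
    injection [phi] allows the block [i] to sit on a neighbouring cell. *)
Lemma disj_synth x g d (phi : int -> int) (s : seq int) k (M : R) (c : int -> nat -> R)
    (r : int -> nat -> R -> R) : gaps x g d -> injective phi -> uniq s -> 0 <= M ->
  (forall i l, (l < k)%N -> measurable_fun [set: R] (r i l)) ->
  (forall i l t, (l < k)%N -> `|r i l t| <= M * \1_(seg x (phi i)) t) ->
  L2 (fun t => \sum_(i <- s) \sum_(l < k) c i l * r i l t) /\
  nrm (fun t => \sum_(i <- s) \sum_(l < k) c i l * r i l t) <=
    k%:R * M * Num.sqrt d * Num.sqrt (\sum_(i <- s) \sum_(l < k) c i l ^+ 2).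
Proof.
move=> G ip us M0 mr rM.
have d0 : 0 <= d by case: G => g0 /(_ 0)[h1 h2]; rewrite (le_trans (ltW g0)) // (le_trans h1).
pose S i : R := \sum_(l < k) c i l ^+ 2.
have S0 i : 0 <= S i by apply: sumr_ge0 => l _; exact: sqr_ge0.
pose F i (t : R) : R := \sum_(l < k) c i l * r i l t.
have FM i t : `|F i t| <= k%:R * M * Num.sqrt (S i) * \1_(seg x (phi i)) t.
  apply: le_trans (ler_norm_sum _ _ _) _.
  have -> : k%:R * M * Num.sqrt (S i) * \1_(seg x (phi i)) t =
      \sum_(l < k) (Num.sqrt (S i) * (M * \1_(seg x (phi i)) t)).
    by rewrite sumr_const card_ord -mulr_natl; ring.
  apply: ler_sum => l _; rewrite normrM; apply: ler_pM => //; last exact: rM.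
  rewrite -sqrtr_sqr; apply: ler_wsqrtr; rewrite /S (bigD1 l) //= lerDl.
  by apply: sumr_ge0 => l' _; exact: sqr_ge0.
have F0 i t : ~ seg x (phi i) t -> F i t = 0.
  by move=> it; have := FM i t; rewrite indic_out // mulr0 normr_le0 => /eqP.
have L1 i : L2 (\1_(seg x (phi i)) : R -> R).
  by apply: L2_indic1; [exact: measurable_seg|case: (seg_mu (phi i) G)].
have LF i : L2 (F i).
  apply: (@L2_dom _ _ (fun t => k%:R * M * Num.sqrt (S i) * \1_(seg x (phi i)) t)); last exact: L2Z.
    by apply: measurable_sum => l; apply: measurable_funM => //; apply: mr; exact: ltn_ord.
  move=> t; rewrite [leRHS]ger0_norm //.
  by rewrite mulr_ge0 // mulr_ge0 ?sqrtr_ge0 // mulr_ge0.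
split; first exact: L2_sum.
have E i : dot (F i) (F i) <= k%:R ^+ 2 * M ^+ 2 * d * S i.
  have [fi ei] := seg_mu (phi i) G.
  have Ii : itg (\1_(seg x (phi i)) : R -> R) by apply: itg_indic => //; exact: measurable_seg.
  apply: (@le_trans _ _ (\int[mu]_t (k%:R ^+ 2 * M ^+ 2 * S i * \1_(seg x (phi i)) t))).
    apply: le_Int; [exact: L2_itgM|exact: itgZ|] => t.
    have h := FM i t; rewrite -expr2 -[F i t ^+ 2]ger0_norm ?sqr_ge0 // normrX.
    apply: (@le_trans _ _ ((k%:R * M * Num.sqrt (S i) * \1_(seg x (phi i)) t) ^+ 2)).
      by apply: lerXn2r; rewrite ?nnegrE ?normr_ge0 // (le_trans _ h).
    by rewrite !exprMn sqr_sqrtr // [\1_ _ _ ^+ 2]expr2 indic_sqr.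
  rewrite IntZl // ei; have := (G.2 (phi i)).2.
  have := mulr_ge0 (mulr_ge0 (sqr_ge0 (k%:R : R)) (sqr_ge0 M)) (S0 i).
  have -> : k%:R ^+ 2 * M ^+ 2 * d * S i = k%:R ^+ 2 * M ^+ 2 * S i * d by ring.
  by move=> h1 h2; apply: ler_wpM2l.
rewrite /nrm (@disj_dot x g d phi s F G ip F0 us LF).
have kM : 0 <= k%:R * M by rewrite mulr_ge0.
apply: (@le_trans _ _ (Num.sqrt ((k%:R * M) ^+ 2 * d * \sum_(i <- s) S i))).
  apply: ler_wsqrtr; rewrite mulr_sumr; apply: ler_sum => i _.
  by have := E i; rewrite exprMn.
by rewrite sqrtrM ?mulr_ge0 ?sqr_ge0 // sqrtrM ?sqr_ge0 // sqrtr_sqr ger0_norm.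
Qed.

Definition right_piece k x (j : nat) i l (t : R) : R :=
  \1_(seg x i) t * (hermite_node k (x (i + 1) - x i) (x i) l)^`(j).[t].
Definition left_piece k x (j : nat) i l (t : R) : R :=
  \1_(seg x i) t * (hermite_node k (x i - x (i + 1)) (x (i + 1)) l)^`(j).[t].
(** The cellwise [j]-th derivative of the piecewise polynomial whose only non-zero jet entry of
    order below k at the nodes is the [l]-th one at [x i]. A left piece is indexed by its cell,
    which is the one preceding the node. *)
Definition node k x (j : nat) i l (t : R) : R := left_piece k x j (i - 1) l t + right_piece k x j i l t.

Lemma right_piece_bound k x g d (j : nat) i l (t : R) : gaps x g d -> (j < k)%N -> (l < k)%N ->
  `|right_piece k x j i l t| <= hermite_bound k g d * \1_(seg x i) t.
Proof.
move=> G jk lk; have [g0 /(_ i)[h1 h2]] := G.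
rewrite /right_piece; have [it|it] := pselect (seg x i t); last by rewrite indic_out // mul0r normr0 mulr0.
rewrite indic_in // mul1r mulr1; move: it; rewrite /seg /= in_itv /= => /andP[t1 t2].
have h0 : 0 < x (i + 1) - x i by exact: lt_le_trans h1.
apply: hermite_node_le; rewrite ?gtr0_norm //.
  by rewrite mulr_ge0 ?invr_ge0 ?(ltW h0) // subr_ge0 ltW.
by rewrite ler_pdivrMl // mulr1 lerD2r.
Qed.

Lemma left_piece_bound k x g d (j : nat) i l (t : R) : gaps x g d -> (j < k)%N -> (l < k)%N ->
  `|left_piece k x j i l t| <= hermite_bound k g d * \1_(seg x i) t.
Proof.
move=> G jk lk; have [g0 /(_ i)[h1 h2]] := G.
rewrite /left_piece; have [it|it] := pselect (seg x i t); last by rewrite indic_out // mul0r normr0 mulr0.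
rewrite indic_in // mul1r mulr1; move: it; rewrite /seg /= in_itv /= => /andP[t1 t2].
have h0 : 0 < x (i + 1) - x i by exact: lt_le_trans h1.
have E : (x i - x (i + 1))^-1 * (t - x (i + 1)) = (x (i + 1) - x i)^-1 * (x (i + 1) - t).
  by rewrite -[x i - _]opprB invrN mulNr -mulrN opprB.
have N : `|x i - x (i + 1)| = x (i + 1) - x i by rewrite distrC gtr0_norm.
apply: hermite_node_le; rewrite ?E ?N //.
- by rewrite mulr_ge0 ?invr_ge0 ?(ltW h0) // subr_ge0.
- by rewrite ler_pdivrMl // mulr1 lerD2l lerN2 ltW.
Qed.

Lemma hermite_bound_ge0 k g d : 0 < g -> 0 <= d -> 0 <= hermite_bound k g d.
Proof.
move=> g0 d0; apply: sumr_ge0 => l _; apply: sumr_ge0 => j _.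
by rewrite !mulr_ge0 ?exprn_ge0 ?addr_ge0 ?ler01 ?pnorm_ge0 ?invr_ge0 // ltW.
Qed.

Lemma gaps_d x g d : gaps x g d -> 0 < d.
Proof. by move=> [g0 /(_ 0)[h1 h2]]; rewrite (lt_le_trans g0) // (le_trans h1). Qed.

Lemma right_piece_itg k x g d (j : nat) i l : gaps x g d -> itg (right_piece k x j i l) /\ L2 (right_piece k x j i l).
Proof.
move=> G; split; last by apply: seg_L2 G _; exact: continuous_poly.
by case: (seg_int i G (@continuous_poly _ (hermite_node k (x (i + 1) - x i) (x i) l)^`(j))).
Qed.

Lemma left_piece_itg k x g d (j : nat) i l : gaps x g d -> itg (left_piece k x j i l) /\ L2 (left_piece k x j i l).
Proof.
move=> G; split; last by apply: seg_L2 G _; exact: continuous_poly.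
by case: (seg_int i G (@continuous_poly _ (hermite_node k (x i - x (i + 1)) (x (i + 1)) l)^`(j))).
Qed.

Lemma node_itg k x g d (j : nat) i l : gaps x g d -> itg (node k x j i l) /\ L2 (node k x j i l).
Proof.
move=> G; have [a1 a2] := right_piece_itg k j i l G; have [b1 b2] := left_piece_itg k j (i - 1) l G.
by split; [exact: itgD|exact: L2D].
Qed.

Definition synth_const k g d : R := 2 * (k%:R * hermite_bound k g d * Num.sqrt d).

(** Left pieces and right pieces each form a family with disjoint supports; the factor 2 in
    [synth_const] accounts for the two families. *)
Lemma node_synth k x g d (j : nat) (s : seq int) (c : int -> nat -> R) : gaps x g d -> (j < k)%N ->
  uniq s -> L2 (fun t => \sum_(i <- s) \sum_(l < k) c i l * node k x j i l t) /\
  nrm (fun t => \sum_(i <- s) \sum_(l < k) c i l * node k x j i l t) <=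
    synth_const k g d * Num.sqrt (\sum_(i <- s) \sum_(l < k) c i l ^+ 2).
Proof.
move=> G jk us; have M0 : 0 <= hermite_bound k g d.
  by apply: hermite_bound_ge0; [case: G|rewrite ltW // (gaps_d G)].
have inj1 : injective (fun i : int => i - 1) by move=> a b /addIr.
have [A1 A2] := @disj_synth x g d (fun i => i - 1) s k _ c (fun i l => left_piece k x j (i - 1) l)
  G inj1 us M0 (fun i l _ => (left_piece_itg k j (i - 1) l G).2.1)
  (fun i l t lk => left_piece_bound (i - 1) t G jk lk).
have [B1 B2] := @disj_synth x g d id s k _ c (fun i l => right_piece k x j i l)
  G (fun a b e => e) us M0 (fun i l _ => (right_piece_itg k j i l G).2.1)
  (fun i l t lk => right_piece_bound i t G jk lk).
have -> : (fun t => \sum_(i <- s) \sum_(l < k) c i l * node k x j i l t) =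
  (fun t => \sum_(i <- s) \sum_(l < k) c i l * left_piece k x j (i - 1) l t +
            \sum_(i <- s) \sum_(l < k) c i l * right_piece k x j i l t).
  apply/funext => t; rewrite -big_split /=; apply: eq_bigr => i _.
  by rewrite -big_split /=; apply: eq_bigr => l _; rewrite /node mulrDr.
split; first exact: L2D.
apply: le_trans (nrmD A1 B1) _; rewrite /synth_const.
move: A2 B2; move: (nrm _) (nrm _) (Num.sqrt _) (_ * Num.sqrt d) => a b e q h1 h2.
by rewrite (_ : 2 * q * e = q * e + q * e) ?lerD //; ring.
Qed.

(** Integration by parts against [cas] on one cell; the derivative of the kernel produces the symbol
    [Dband]. *)
Lemma seg_hartley x g d i p (w : R) : gaps x g d ->
  hartley (fun t => \1_(seg x i) t * p^`().[t]) w =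
  p.[x (i + 1)] * cas (2 * pi * w * x (i + 1)) - p.[x i] * cas (2 * pi * w * x i) +
  Dband (hartley (fun t => \1_(seg x i) t * p.[t])) w.
Proof.
move=> G; set c := 2 * pi * w.
have dF (t : R) : is_derive t 1 (fun s : R => p.[s] * cas (c * s))
    (p^`().[t] * cas (c * t) + p.[t] * (c * cas (- c * t))).
  have d1 : is_derive t 1 (fun s => p.[s]) p^`().[t] by exact: is_derive_poly.
  have d2 := is_derive_scale (is_derive_cas (c * t)).
  apply: is_derive_eq; rewrite /GRing.scale /= -mulNr.
  by move: (cas _) (cas _) (p.[t]) (_.[t]) => *; ring.
have c1 : continuous (fun t => p^`().[t] * cas (c * t)).
  by move=> t; apply: continuousM; [exact: continuous_poly|exact: (continuous_scale continuous_cas)].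
have c2 : continuous (fun t => p.[t] * cas (- c * t)).
  by move=> t; apply: continuousM; [exact: continuous_poly|exact: (continuous_scale continuous_cas)].
have c12 : continuous (fun t => p^`().[t] * cas (c * t) + p.[t] * (c * cas (- c * t))).
  move=> t; apply: (@cvgD _ R^o); first exact: c1.
  under eq_fun do rewrite mulrCA; rewrite mulrCA; apply: cvgMr; exact: c2.
have F := FTC_itv (ltW (gaps_lt i G)) c12 dF.
have [I12 E12] := seg_int i G c12; have [I1 E1] := seg_int i G c1; have [I2 E2] := seg_int i G c2.
rewrite /Dband /hartley -/c.
have -> : \int[mu]_t (\1_(seg x i) t * p^`().[t] * cas (c * t)) =
    \int[mu]_t (\1_(seg x i) t * (p^`().[t] * cas (c * t))).
  by apply: Int_ext => t; rewrite mulrA.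
have -> : \int[mu]_t (\1_(seg x i) t * p.[t] * cas (2 * pi * - w * t)) =
    \int[mu]_t (\1_(seg x i) t * (p.[t] * cas (- c * t))).
  by apply: Int_ext => t; rewrite mulrA /c mulrN.
rewrite -F -E12.
have -> : \int[mu]_t (\1_(seg x i) t * (p^`().[t] * cas (c * t) + p.[t] * (c * cas (- c * t)))) =
  \int[mu]_t (\1_(seg x i) t * (p^`().[t] * cas (c * t))) +
  c * \int[mu]_t (\1_(seg x i) t * (p.[t] * cas (- c * t))).
  rewrite -IntZl // -IntD //; last exact: itgZ.
  by apply: Int_ext => t; move: (\1_ _ _) (cas _) (cas _) => *; ring.
by rewrite -/c mulNr addrK.
Qed.

(** The boundary terms of the two cells meeting at [x i] cancel because the jets agree there, and
    those at the outer ends vanish. Thus the cellwise derivatives are weak derivatives. *)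
Lemma node_hartley k x g d (j : nat) i l (w : R) : gaps x g d -> (j < k)%N -> (l < k)%N ->
  hartley (node k x j i l) w = iter j Dband (hartley (node k x 0 i l)) w.
Proof.
move=> G; elim: j w => [//|j IH] w jk lk.
have jk' := ltnW jk.
rewrite iterS [RHS]/Dband -(IH (- w) jk' lk) -/(Dband (hartley (node k x j i l)) w).
have [r1 _] := right_piece_itg k j.+1 i l G; have [l1 _] := left_piece_itg k j.+1 (i - 1) l G.
have [r0 _] := right_piece_itg k j i l G; have [l0 _] := left_piece_itg k j (i - 1) l G.
rewrite /node hartleyD // /Dband hartleyD // mulrDr.
have := seg_hartley i (hermite_node k (x (i + 1) - x i) (x i) l)^`(j) w G.
rewrite -derivnS -/(right_piece k x j.+1 i l) -/(right_piece k x j i l) => ->.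
have := seg_hartley (i - 1) (hermite_node k (x (i - 1) - x (i - 1 + 1)) (x (i - 1 + 1)) l)^`(j) w G.
rewrite -derivnS -/(left_piece k x j.+1 (i - 1) l) -/(left_piece k x j (i - 1) l) => ->.
have h0 m : x (m + 1) - x m != 0 by rewrite gt_eqF // subr_gt0 (gaps_lt m G).
have h0' m : x m - x (m + 1) != 0 by rewrite -opprB oppr_eq0.
have R1 := hermite_node_near (x i) l (h0 i) jk'.
have R2 : (hermite_node k (x (i + 1) - x i) (x i) l)^`(j).[x (i + 1)] = 0.
  by have := hermite_node_far (x i) l (h0 i) jk'; rewrite [x i + _]addrC subrK.
have L1 := hermite_node_near (x (i - 1 + 1)) l (h0' (i - 1)) jk'.
have L2' : (hermite_node k (x (i - 1) - x (i - 1 + 1)) (x (i - 1 + 1)) l)^`(j).[x (i - 1)] = 0.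
  by have := hermite_node_far (x (i - 1 + 1)) l (h0' (i - 1)) jk'; rewrite [X in _.[X]]addrC [X in _.[X]]subrK.
rewrite R1 R2 L1 L2' subrK /Dband; move: (cas _) (cas _) (cas _) => u v z.
by move: (hartley _ _) (hartley _ _) => p q; ring.
Qed.

End Cells.

(** * Interpolation error and samples on the cells *)

Section CellInequalities.
Context {R : realType}.
Notation mu := (@lebesgue_measure R).
Implicit Types (x : int -> R) (g d lam : R) (i : int) (u : nat -> R -> R).

Definition hermite k x u i : {poly R} := \sum_(l < k)
  (u l (x i) *: hermite_node k (x (i + 1) - x i) (x i) l +
   u l (x (i + 1)) *: hermite_node k (x i - x (i + 1)) (x (i + 1)) l).

Lemma hermite_derivn k x u i j (t : R) : (hermite k x u i)^`(j).[t] = \sum_(l < k)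
  (u l (x i) * (hermite_node k (x (i + 1) - x i) (x i) l)^`(j).[t] +
   u l (x (i + 1)) * (hermite_node k (x i - x (i + 1)) (x (i + 1)) l)^`(j).[t]).
Proof.
rewrite /hermite derivn_sum horner_sum; apply: eq_bigr => l _.
by rewrite derivnD !derivnZ hornerD !hornerZ.
Qed.

Lemma hermite_interp k x g d u i j : gaps x g d -> (j < k)%N ->
  (hermite k x u i)^`(j).[x i] = u j (x i) /\ (hermite k x u i)^`(j).[x (i + 1)] = u j (x (i + 1)).
Proof.
move=> G jk; have h0 : x (i + 1) - x i != 0 by rewrite gt_eqF // subr_gt0 (gaps_lt i G).
have h0' : x i - x (i + 1) != 0 by rewrite -opprB oppr_eq0.
have R1 l := hermite_node_near (x i) l h0 jk.
have R2 l : (hermite_node k (x (i + 1) - x i) (x i) l)^`(j).[x (i + 1)] = 0.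
  by have := hermite_node_far (x i) l h0 jk; rewrite [X in _.[X]]addrC [X in _.[X]]subrK.
have L1 l := hermite_node_near (x (i + 1)) l h0' jk.
have L2' l : (hermite_node k (x i - x (i + 1)) (x (i + 1)) l)^`(j).[x i] = 0.
  by have := hermite_node_far (x (i + 1)) l h0' jk; rewrite [X in _.[X]]addrC [X in _.[X]]subrK.
rewrite !hermite_derivn; split; rewrite (bigD1 (Ordinal jk)) //= big1 ?addr0.
- by rewrite R1 L2' eqxx mulr1 mulr0 addr0.
- move=> l lj; rewrite R1 L2' mulr0 addr0; case: eqP => [jl|]; last by rewrite mulr0.
  by move: lj; rewrite -val_eqE /= -jl eqxx.
- by rewrite R2 L1 eqxx mulr1 mulr0 add0r.
- move=> l lj; rewrite R2 L1 mulr0 add0r; case: eqP => [jl|]; last by rewrite mulr0.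
  by move: lj; rewrite -val_eqE /= -jl eqxx.
Qed.

Lemma hermite_top k x u i : (hermite k x u i)^`(k + k) = 0.
Proof.
by rewrite /hermite derivn_sum big1 // => l _; rewrite derivnD [X in X + _]derivnZ [X in _ + X]derivnZ !hermite_node_top !scaler0 addr0.
Qed.

(** The conclusion of [wirtinger_cimmino_ineq], isolated as a condition on [lam] and on the maximal
    cell length. *)
Definition wirtinger k lam d := forall (a b : R) u, a <= b -> b - a <= d ->
  (forall j (t : R), is_derive t 1 (u j) (u j.+1 t)) ->
  (forall l, (l < k)%N -> u l a = 0 /\ u l b = 0) ->
  lam * \int[mu]_(t in `[a, b]) (u k.-1 t) ^+ 2 <= \int[mu]_(t in `[a, b]) (u k t) ^+ 2.

Lemma continuous_sqr (f : R -> R) : continuous f -> continuous (fun t => f t ^+ 2).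
Proof.
by move=> cf t; apply: (@continuous_comp _ _ _ f (fun y => y ^+ 2)); [exact: cf|exact: exprn_continuous].
Qed.

Lemma continuous_mul (f h : R -> R) : continuous f -> continuous h -> continuous (fun t => f t * h t).
Proof. by move=> cf ch t; apply: continuousM; [exact: cf|exact: ch]. Qed.

Lemma cell_ineq k x g d lam u i : (0 < k)%N -> gaps x g d -> wirtinger k lam d ->
  (forall j (t : R), is_derive t 1 (u j) (u j.+1 t)) ->
  lam * \int[mu]_t (\1_(seg x i) t * (u k.-1 t - (hermite k x u i)^`(k.-1).[t]) ^+ 2) <=
  \int[mu]_t (\1_(seg x i) t * u k t ^+ 2).
Proof.
move=> k0 G Wi du; set H := hermite k x u i.
pose v j (t : R) := u j t - H^`(j).[t].
have dv j (t : R) : is_derive t 1 (v j) (v j.+1 t).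
  have d1 := du j t; have d2 := is_derive_derivn H j t; exact: is_deriveB.
have cu j : continuous (u j) by move=> t; exact: (is_derive_cont (du j t)).
have cv j : continuous (v j) by move=> t; exact: (is_derive_cont (dv j t)).
have v0 l : (l < k)%N -> v l (x i) = 0 /\ v l (x (i + 1)) = 0.
  by move=> lk; have [h1 h2] := hermite_interp u i G lk; rewrite /v h1 h2 !subrr.
have xx := ltW (gaps_lt i G).
have [_ E1] := seg_int i G (continuous_sqr (cv k.-1)).
have [I2 E2] := seg_int i G (continuous_sqr (cv k)).
have [Iu Eu] := seg_int i G (continuous_sqr (cu k)).
have cvH := continuous_mul (cv k) (@continuous_poly _ H^`(k)).
have [Ic Ec] := seg_int i G cvH.
have O := hermite_orthogonal xx dv v0 (hermite_top k x u i).
have := Wi _ _ v xx (G.2 i).2 dv v0.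
rewrite -E1 => h; apply: (le_trans h); rewrite -E2.
(* Pythagoras: with u^(k) = v^(k) + H^(k) the square of H^(k) is dropped, and the cross term
   integrates to 0 by [hermite_orthogonal]. *)
apply: (@le_trans _ _ (\int[mu]_t (\1_(seg x i) t * u k t ^+ 2 - 2 * (\1_(seg x i) t * (v k t * H^`(k).[t]))))).
  apply: le_Int => //; first by apply: itgB => //; exact: itgZ.
  move=> t; rewrite {2}/v; have : 0 <= \1_(seg x i) t :> R by [].
  have -> : v k t = u k t - H^`(k).[t] by [].
  move: (\1_(seg x i) t) (u k t) (H^`(k).[t]) => a b c a0.
  rewrite -subr_ge0; have -> : a * b ^+ 2 - 2 * (a * ((b - c) * c)) - a * (b - c) ^+ 2 = a * c ^+ 2 by ring.
  by rewrite mulr_ge0 // sqr_ge0.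
rewrite IntB //; last exact: itgZ.
by rewrite IntZl // Ec O mulr0 subr0.
Qed.

(** Integrates the derivative of (t - x (i + 1)) u_l^2, which vanishes at the right end and
    contributes the cell length, at least [g], at the left end. The mixed term is split by 2 a b <=
    a^2 + b^2. *)
Lemma sobolev_cell x g d u i l : gaps x g d ->
  (forall j (t : R), is_derive t 1 (u j) (u j.+1 t)) ->
  g * u l (x i) ^+ 2 <=
  \int[mu]_t (\1_(seg x i) t * ((1 + d) * u l t ^+ 2 + d * u l.+1 t ^+ 2)).
Proof.
move=> G du; have [h1 h2] := G.2 i; have xx := ltW (gaps_lt i G); have d0 := gaps_d G.
have cu j : continuous (u j) by move=> t; exact: (is_derive_cont (du j t)).
have cq : continuous (fun t => (1 + d) * u l t ^+ 2 + d * u l.+1 t ^+ 2).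
  move=> t; apply: (@cvgD _ R^o); apply: cvgMr; exact: continuous_sqr.
have [_ ->] := seg_int i G cq.
pose S (t : R) := (t - x (i + 1)) * u l t ^+ 2.
have dS (t : R) : is_derive t 1 S (u l t ^+ 2 + (t - x (i + 1)) * (2 * u l t * u l.+1 t)).
  rewrite /S; have d1 := du l t.
  apply: is_derive_eq; rewrite /GRing.scale /=.
  move: (x _) (u _ _) (u _ _) => *; ring.
apply: (@le_trans _ _ (S (x (i + 1)) - S (x i))).
  rewrite /S subrr mul0r sub0r -mulNr opprB; apply: ler_wpM2r => //; exact: sqr_ge0.
apply: FTC_le xx cq _ => t /andP[t1 t2]; split; first exact: dS.
have : 0 <= x (i + 1) - t by rewrite subr_ge0.
have : x (i + 1) - t <= d by apply: le_trans h2; rewrite lerD2l lerN2.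
rewrite -[t - x _]opprB.
move: (x (i + 1) - t) (u l t) (u l.+1 t) => s a b sd s0.
have h3 : 0 <= s * (a + b) ^+ 2 by rewrite mulr_ge0 // sqr_ge0.
have h4 : 0 <= (d - s) * (a ^+ 2 + b ^+ 2) by apply: mulr_ge0; rewrite ?subr_ge0 ?addr_ge0 ?sqr_ge0.
have h5 : 0 <= a ^+ 2 := sqr_ge0 a.
nra.
Qed.

Lemma seg_sum_le x g d (s : seq int) (q : R -> R) : gaps x g d -> uniq s ->
  continuous q -> itg q -> (forall t, 0 <= q t) ->
  \sum_(i <- s) \int[mu]_t (\1_(seg x i) t * q t) <= \int[mu]_t q t.
Proof.
move=> G us cq Iq q0.
have I1 i : itg (fun t => \1_(seg x i) t * q t) by case: (seg_int i G cq).
rewrite -Rint_sum //; apply: le_Int => //; first exact: itg_sum.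
move=> t; rewrite -mulr_suml ler_piMl //.
have F0 i (t' : R) : ~ seg x i t' -> \1_(seg x i) t' = 0 :> R by exact: indic_out.
(* The sum z of disjoint indicators satisfies z^2 = z, so it is 0 or 1. *)
have := @disj_sqr _ x g d id s (fun i t => \1_(seg x i) t) t G (fun a b e => e) F0 us.
have -> : \sum_(j <- s) (\1_(seg x j) t : R) ^+ 2 = \sum_(j <- s) \1_(seg x j) t.
  by apply: eq_bigr => j _; rewrite expr2 indic_sqr.
move: (\sum_(j <- s) _) => z /eqP; rewrite expr2 -subr_eq0 -{3}[z]mulr1 -mulrBr mulf_eq0 subr_eq0.
by case/orP => /eqP ->.
Qed.

Definition polya_const k g d (sg : R) : R :=
  \sum_(l < k) g^-1 * ((1 + d) * (sg ^+ l) ^+ 2 + d * (sg ^+ l.+1) ^+ 2).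

(** The local estimates are summed over disjoint cells and the derivatives are bounded by Bernstein.
    It makes the jets of a band-limited function square summable. *)
Lemma plancherel_polya k x g d W (s : seq int) (f : R -> R) : gaps x g d -> 0 <= W -> uniq s ->
  BL W f ->
  \sum_(i <- s) \sum_(l < k) derive1n l f (x i) ^+ 2 <= polya_const k g d (2 * pi * W) * nrm f ^+ 2.
Proof.
move=> G W0 us Bf; rewrite exchange_big /= /polya_const mulr_suml; apply: ler_sum => l _.
have g0 := G.1; have d0 := gaps_d G.
rewrite -[X in _ <= X]mulrA ler_pdivlMl // mulr_sumr.
pose u j : R -> R := derive1n j f.
have du j (t : R) : is_derive t 1 (u j) (u j.+1 t) by exact: (BL_is_derive j t W0 Bf).
have Lu j : L2 (u j) by apply: BL_L2; apply: BL_derive1n Bf.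
have cu j : continuous (u j) by move=> t; exact: (is_derive_cont (du j t)).
pose q (t : R) := (1 + d) * u l t ^+ 2 + d * u l.+1 t ^+ 2.
have cq : continuous q.
  move=> t; apply: (@cvgD _ R^o); apply: cvgMr; exact: continuous_sqr.
have q0 t : 0 <= q t by rewrite addr_ge0 // mulr_ge0 ?sqr_ge0 // ?addr_ge0 // ltW.
have Iq : itg q by apply: itgD; apply: itgZ; exact: (Lu _).2.
apply: (@le_trans _ _ (\sum_(i <- s) \int[mu]_t (\1_(seg x i) t * q t))).
  by apply: ler_sum => i _; exact: sobolev_cell.
apply: le_trans (seg_sum_le G us cq Iq q0) _.
have -> : \int[mu]_t q t = (1 + d) * nrm (u l) ^+ 2 + d * nrm (u l.+1) ^+ 2.
  rewrite /q IntD ?IntZl; try exact: itgZ (Lu _).2; try exact: (Lu _).2.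
  rewrite !sqr_nrm /dot; congr (_ * _ + _ * _); apply: Int_ext => t; exact: expr2.
have B j : nrm (u j) ^+ 2 <= ((2 * pi * W) ^+ j) ^+ 2 * nrm f ^+ 2.
  rewrite -exprMn; apply: lerXn2r; rewrite ?nnegrE ?nrm_ge0 ?(le_trans (nrm_ge0 (u j))) //; exact: bernstein.
have := B l; have := B l.+1; move: (nrm (u l)) (nrm (u l.+1)) (_ ^+ l) (_ ^+ l.+1) (nrm f).
move=> a b c e n hb ha; rewrite [X in _ <= X]mulrDl -[X in _ <= X + _]mulrA -[X in _ <= _ + X]mulrA.
apply: lerD; apply: ler_wpM2l => //; first by rewrite addr_ge0 // ltW.
exact: ltW.
Qed.

End CellInequalities.

(** * Error of the truncated interpolant *)

Section Contraction.
Context {R : realType}.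
Notation mu := (@lebesgue_measure R).
Implicit Types (x : int -> R) (g d lam W : R) (i : int) (f : R -> R).

Definition int_shift (n : nat) (j : nat) : int := j%:Z - n%:Z.
(** The nodes from -n to n. The list [cells n] stops at n - 1, since these 2n + 1 nodes bound 2n
    cells. *)
Definition int_ball n : seq int := [seq int_shift n j | j <- iota 0 (n + n).+1].
Definition cells n : seq int := [seq int_shift n j | j <- iota 0 (n + n)].

Lemma uniq_int_ball n : uniq (int_ball n).
Proof. by rewrite map_inj_uniq ?iota_uniq // => a b; rewrite /int_shift; lia. Qed.

Lemma uniq_cells n : uniq (cells n).
Proof. by rewrite map_inj_uniq ?iota_uniq // => a b; rewrite /int_shift; lia. Qed.

Lemma mem_int_ball n i : (i \in int_ball n) = (`|i| <= n)%N.
Proof.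
apply/mapP/idP => [[j]|h]; first by rewrite mem_iota /int_shift => *; lia.
exists (absz (i + n%:Z)); last by rewrite /int_shift; lia.
by rewrite mem_iota; lia.
Qed.

Lemma int_ball_last (F : int -> R) n : \sum_(i <- int_ball n) F i = \sum_(i <- cells n) F i + F n%:Z.
Proof.
rewrite /int_ball -addn1 iotaD map_cat big_cat /= big_seq1; congr (_ + F _).
by rewrite /int_shift; lia.
Qed.

Lemma int_ball_first (F : int -> R) n : \sum_(i <- int_ball n) F i = F (- n%:Z) + \sum_(i <- cells n) F (i + 1).
Proof.
rewrite /int_ball /= big_cons; congr (F _ + _); first by rewrite /int_shift; lia.
rewrite (iotaDl 1) -map_comp /cells !big_map; apply: eq_bigr => j _; congr F.
by rewrite /= /int_shift add1n; lia.
Qed.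

Lemma cells_indic x g d n (t : R) : gaps x g d ->
  \sum_(i <- cells n) (\1_(seg x i) t : R) = \1_(`]x (- n%:Z), x n%:Z]%classic : set (measurableTypeR R)) t.
Proof.
move=> G; have H m : \sum_(i <- [seq int_shift n j | j <- iota 0 m]) (\1_(seg x i) t : R) =
    \1_(`]x (- n%:Z), x (- n%:Z + m%:Z)]%classic : set (measurableTypeR R)) t.
  elim: m => [|m IH].
    by rewrite big_nil addr0 indic_out //= in_itv /= => /andP[/lt_le_trans/[apply]]; rewrite ltxx.
  rewrite -addn1 iotaD map_cat big_cat /= big_seq1 IH.
  have -> : int_shift n (0 + m) = - n%:Z + m%:Z by rewrite /int_shift; lia.
  rewrite /seg; have -> : - n%:Z + m%:Z + 1 = - n%:Z + (m + 1)%:Z by lia.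
  have h1 : x (- n%:Z) <= x (- n%:Z + m%:Z) by apply: gaps_le G _; lia.
  have h2 : x (- n%:Z + m%:Z) <= x (- n%:Z + (m + 1)%:Z) by apply: gaps_le G _; lia.
  rewrite !indicE !mem_setE !in_itv /=.
  move: (x (- n%:Z)) (x (- n%:Z + m%:Z)) (x (- n%:Z + (m + 1)%:Z)) h1 h2 => a b c ab bc.
  case: (ltP a t) => at_; case: (leP t b) => tb; case: (leP t c) => tc; rewrite /= ?addr0 ?add0r //.
  - by move: (le_lt_trans bc tc); rewrite ltNge tb.
  - by move: (lt_le_trans tb at_); rewrite ltNge ab.
by rewrite H; have -> : - n%:Z + (n + n)%N%:Z = n%:Z by lia.
Qed.

Definition hermite_samples k x f n (t : R) : R :=
  \sum_(i <- int_ball n) \sum_(l < k) derive1n l f (x i) * node k x k.-1 i l t.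
Definition jet_norm k x f i : R := Num.sqrt (\sum_(l < k) derive1n l f (x i) ^+ 2).

(** The lower bound on the gaps makes the intervals exhaust the line; dominated convergence does the
    rest. *)
Lemma sum_indic_out x g d f : gaps x g d -> L2 f ->
  (fun n : nat => nrm (fun t => f t - \1_(`]x (- n%:Z), x n%:Z]%classic : set (measurableTypeR R)) t * f t)) @ \oo --> 0.
Proof.
move=> G Lf; pose D (n : nat) : set (measurableTypeR R) := `]x (- n%:Z), x n%:Z]%classic.
have mD m : measurable (D m) by exact: measurable_itv.
have [||||_ C] := @Rint_dct _ (fun n t => (f t - \1_(D n) t * f t) ^+ 2) (fun=> 0) (fun t => f t ^+ 2).
- by move=> n; apply: meas_sq; case: (L2B Lf (L2_indic (mD n) Lf)).
- exact: Lf.2.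
- move=> t; apply: cvg_near_cst; have g0 := G.1.
  near=> n; suff tn : D n t by rewrite indic_in // mul1r subrr expr0n.
  have : `|t - x 0| / g + 1 <= n%:R by near: n; exact: nbhs_infty_ger.
  move=> h; have ng : `|t - x 0| < n%:R * g.
    by rewrite -ltr_pdivrMr //; apply: lt_le_trans h; rewrite ltrDl.
  have h1 := gaps_add 0 n G; have h2 := gaps_add (- n%:Z) n G.
  rewrite addNr in h2; rewrite add0r in h1.
  rewrite /D /= in_itv /=; move: ng; rewrite ltr_norml => /andP[].
  move: (x _) (x _) (x _) (n%:R * g) h1 h2 => a b c m *; apply/andP; split; lra.
- move=> n t; rewrite normrX -[leRHS]real_normK ?num_real //; apply: lerXn2r; rewrite ?nnegrE //.
  have [tn|tn] := pselect (D n t); first by rewrite indic_in // mul1r subrr normr0.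
  by rewrite indic_out // mul0r subr0.
rewrite (_ : (fun n : nat => _) = (fun n => Num.sqrt (\int[mu]_t (f t - \1_(D n) t * f t) ^+ 2))).
  have E0 : \int[mu]_(t in [set: R]) (0 : R) = 0 by rewrite /Rintegral integral0.
  rewrite E0 in C; rewrite -[X in _ --> X]sqrtr0.
  exact: (cvg_comp _ _ C (@sqrt_continuous R 0)).
by apply/funext => n; rewrite /nrm /dot; congr Num.sqrt; apply: Int_ext => t; rewrite expr2.
Unshelve. all: by end_near.
Qed.

(** The error splits into [E1], the interpolation error on the inner cells, [E2], the function
    outside them, and [E3], [E4], the outer halves of the two extreme node functions. On the inner
    cells [cell_ineq] and Bernstein give the factor 2 pi W / sqrt lam; the other terms vanish as [n]
    grows. *)
Lemma hermite_samples_error k x g d lam W f n : (0 < k)%N -> gaps x g d -> 0 < lam -> 0 <= W ->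
  wirtinger k lam d -> BL W f ->
  L2 (hermite_samples k x f n) /\
  nrm (fun t => derive1n k.-1 f t - hermite_samples k x f n t) <=
  2 * pi * W / Num.sqrt lam * nrm (derive1n k.-1 f) +
  nrm (fun t => derive1n k.-1 f t - \1_(`]x (- n%:Z), x n%:Z]%classic : set (measurableTypeR R)) t * derive1n k.-1 f t) +
  synth_const k g d * (jet_norm k x f n%:Z + jet_norm k x f (- n%:Z)).
Proof.
move=> k0 G lam0 W0 Wi Bf; pose u j : R -> R := derive1n j f.
have du j (t : R) : is_derive t 1 (u j) (u j.+1 t) by exact: (BL_is_derive j t W0 Bf).
have Bu j : BL W (u j) by exact: BL_derive1n Bf.
have Lu j : L2 (u j) by exact: BL_L2 (Bu j).
have cu j : continuous (u j) by move=> t; exact: (is_derive_cont (du j t)).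
have k1 : (k.-1 < k)%N by rewrite prednK.
have [LS _] := node_synth (fun i l => u l (x i)) G k1 (uniq_int_ball n).
split; first exact: LS.
pose F i (t : R) := \1_(seg x i) t * (u k.-1 t - (hermite k x u i)^`(k.-1).[t]).
have cF i : continuous (fun t => u k.-1 t - (hermite k x u i)^`(k.-1).[t]).
  by move=> t; apply: (@cvgB _ R^o); [exact: cu|exact: continuous_poly].
have LF i : L2 (F i) by exact: seg_L2 G (cF i).
have F0 i t : ~ seg x i t -> F i t = 0 by move=> it; rewrite /F indic_out // mul0r.
pose E1 t := \sum_(i <- cells n) F i t.
pose E2 t := u k.-1 t - \1_(`]x (- n%:Z), x n%:Z]%classic : set (measurableTypeR R)) t * u k.-1 t.
pose E3 t := \sum_(i <- [:: n%:Z]) \sum_(l < k) u l (x i) * right_piece k x k.-1 i l t.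
pose E4 t := \sum_(i <- [:: - n%:Z]) \sum_(l < k) u l (x i) * left_piece k x k.-1 (i - 1) l t.
have E t : u k.-1 t - hermite_samples k x f n t = E1 t + E2 t - (E3 t + E4 t).
  rewrite /E3 /E4 !big_seq1.
  have -> : hermite_samples k x f n t = \sum_(i <- int_ball n) \sum_(l < k) u l (x i) * left_piece k x k.-1 (i - 1) l t +
      \sum_(i <- int_ball n) \sum_(l < k) u l (x i) * right_piece k x k.-1 i l t.
    rewrite -big_split; apply: eq_bigr => i _ /=; rewrite -big_split; apply: eq_bigr => l _ /=.
    by rewrite /node mulrDr.
  (* Regrouping by cells leaves over the left pieces of node -n and the right pieces of node n. *)
  rewrite int_ball_first int_ball_last.
  have -> : E1 t = \sum_(i <- cells n) \1_(seg x i) t * u k.-1 t -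
     \sum_(i <- cells n) \sum_(l < k) u l (x i) * right_piece k x k.-1 i l t -
     \sum_(i <- cells n) \sum_(l < k) u l (x (i + 1)) * left_piece k x k.-1 (i + 1 - 1) l t.
    rewrite -!sumrB; apply: eq_bigr => i _; rewrite /F mulrBr -addrA -opprD; congr (_ - _).
    rewrite hermite_derivn mulr_sumr -big_split /=; apply: eq_bigr => l _.
    by rewrite addrK /right_piece /left_piece mulrDr mulrCA [in X in _ + X = _]mulrCA.
  rewrite -mulr_suml (cells_indic n t G) /E2.
  move: (\sum_(i <- cells n) _) (\sum_(i <- cells n) _) (\sum_(l < k) _) (\sum_(l < k) _).
  by move: (\1_ _ _) (u _ _) => *; ring.
have M0 : 0 <= hermite_bound k g d by apply: hermite_bound_ge0; [case: G|rewrite ltW // (gaps_d G)].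
have [L3 N3] := @disj_synth _ x g d id [:: n%:Z] k _ (fun i l => u l (x i)) (fun i l => right_piece k x k.-1 i l)
  G (fun a b e => e) isT M0 (fun i l _ => (right_piece_itg k k.-1 i l G).2.1)
  (fun i l t lk => right_piece_bound i t G k1 lk).
have inj1 : injective (fun i : int => i - 1) by move=> a b /addIr.
have [L4 N4] := @disj_synth _ x g d (fun i => i - 1) [:: - n%:Z] k _ (fun i l => u l (x i))
  (fun i l => left_piece k x k.-1 (i - 1) l)
  G inj1 isT M0 (fun i l _ => (left_piece_itg k k.-1 (i - 1) l G).2.1)
  (fun i l t lk => left_piece_bound (i - 1) t G k1 lk).
have L1 : L2 E1 by exact: L2_sum.
have L2' : L2 E2 by apply: L2B => //; apply: L2_indic => //; exact: measurable_itv.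
have -> : (fun t => derive1n k.-1 f t - hermite_samples k x f n t) = (fun t => E1 t + E2 t - (E3 t + E4 t)).
  by apply/funext => t; exact: E.
have N1 : nrm E1 <= 2 * pi * W / Num.sqrt lam * nrm (u k.-1).
  have sl : 0 < Num.sqrt lam by rewrite sqrtr_gt0.
  have B1 : nrm (u k) <= 2 * pi * W * nrm (u k.-1).
    have := bernstein 1 W0 (Bu k.-1); rewrite expr1.
    by have -> : derive1n 1 (u k.-1) = u k by rewrite /u derive1n1 -[X in _ = derive1n X f](prednK k0) derive1nS.
  suff h : lam * nrm E1 ^+ 2 <= nrm (u k) ^+ 2.
    rewrite [X in _ <= X]mulrAC ler_pdivlMr // [X in X <= _]mulrC; apply: le_trans B1.
    rewrite -(@ler_pXn2r _ 2) ?nnegrE ?nrm_ge0 ?mulr_ge0 ?nrm_ge0 ?sqrtr_ge0 //.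
    by rewrite exprMn sqr_sqrtr // ltW.
  rewrite sqr_nrm (@disj_dot _ x g d id (cells n) F G (fun a b e => e) F0 (uniq_cells n) LF).
  rewrite sqr_nrm {2}/dot; under [leRHS]eq_Rintegral => t _ do rewrite -expr2.
  have := seg_sum_le G (uniq_cells n) (continuous_sqr (cu k)) (Lu k).2 (fun t => sqr_ge0 _).
  apply: le_trans; rewrite mulr_sumr; apply: ler_sum => i _.
  apply: le_trans (cell_ineq i k0 G Wi du).
  rewrite ler_pM2l // le_eqVlt; apply/orP; left; apply/eqP; apply: Int_ext => t.
  by rewrite /F mulrACA indic_sqr expr2.
apply: le_trans (nrmB (L2D L1 L2') (L2D L3 L4)) _.
apply: lerD.
  by apply: le_trans (nrmD L1 L2') _; rewrite lerD2r.
apply: le_trans (nrmD L3 L4) _.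
move: N3 N4; rewrite !big_seq1 -/(jet_norm k x f n%:Z) -/(jet_norm k x f (- n%:Z)) /synth_const.
have : 0 <= k%:R * hermite_bound k g d * Num.sqrt d by rewrite !mulr_ge0 ?sqrtr_ge0.
have : 0 <= jet_norm k x f n%:Z by exact: sqrtr_ge0.
have : 0 <= jet_norm k x f (- n%:Z) by exact: sqrtr_ge0.
move: (jet_norm _ _ _ _) (jet_norm _ _ _ _) (nrm _) (nrm _) (_ * Num.sqrt d) => a b c e q.
by move=> *; nra.
Qed.

End Contraction.

(** * The sampling operator and its inverse *)

Section Synthesis.
Context {R : realType}.
Implicit Types (a : int -> R) (c : int -> nat -> R) (s : seq int) (F : int -> nat -> R -> R).

Definition comb k F c s (t : R) : R := \sum_(i <- s) \sum_(l < k) c i l * F i l t.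
Definition energy k c s : R := \sum_(i <- s) \sum_(l < k) c i l ^+ 2.

Lemma energy_ge0 k c s : 0 <= energy k c s.
Proof. by apply: sumr_ge0 => i _; apply: sumr_ge0 => l _; exact: sqr_ge0. Qed.

Lemma sum_diff (T : eqType) (b : T -> R) (s1 s2 : seq T) : uniq s1 -> uniq s2 -> {subset s1 <= s2} ->
  \sum_(i <- s2) b i = \sum_(i <- s1) b i + \sum_(i <- [seq i <- s2 | i \notin s1]) b i.
Proof.
move=> u1 u2 s12; rewrite (bigID (mem s1)) /= -[X in X + _]big_filter -[X in _ + X]big_filter; congr (_ + _).
apply: perm_big; apply: uniq_perm => //; first exact: filter_uniq.
by move=> i; rewrite mem_filter andb_idr //; exact: s12.
Qed.

Lemma comb_diff k F c s1 s2 (t : R) : uniq s1 -> uniq s2 -> {subset s1 <= s2} ->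
  comb k F c s2 t - comb k F c s1 t = comb k F c [seq i <- s2 | i \notin s1] t.
Proof.
move=> u1 u2 s12; rewrite /comb.
by rewrite (@sum_diff _ (fun i => \sum_(l < k) c i l * F i l t) _ _ u1 u2 s12) addrC addKr.
Qed.

Lemma sub_int_ball s : exists N, {subset s <= int_ball N}.
Proof.
elim: s => [|i s [N IH]]; first by exists 0%N.
exists (maxn N (absz i)) => j; rewrite inE mem_int_ball => /orP[/eqP ->|/IH]; first by rewrite leq_maxr.
by rewrite mem_int_ball leq_max => ->.
Qed.

(** A finite set whose sum is within [e] of the supremum of all finite sums leaves at most [e] to
    any finite set disjoint from it. *)
Lemma sum_tail a (C : R) : (forall i, 0 <= a i) ->
  (forall s, uniq s -> \sum_(i <- s) a i <= C) -> forall e, 0 < e ->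
  exists N, forall s, uniq s -> (forall i, i \in s -> (N < `|i|)%N) -> \sum_(i <- s) a i <= e.
Proof.
move=> a0 aC e e0; pose S := [set y | exists2 s, uniq s & y = \sum_(i <- s) a i].
have hS : has_sup S.
  split; first by exists 0, [::] => //; rewrite big_nil.
  by exists C => y [s us ->]; exact: aC.
have [y [s0 u0 ->] hy] := @sup_adherent _ S e e0 hS.
have [N sN] := sub_int_ball s0; exists N => s us sbig.
have ucat : uniq (s0 ++ s).
  rewrite cat_uniq u0 us /= andbT; apply/hasPn => i /sbig iN; apply/negP => /sN.
  by rewrite mem_int_ball leqNgt iN.
have : \sum_(i <- s0 ++ s) a i <= sup S by apply: ub_le_sup; [exact: hS.2|exists (s0 ++ s)].
by rewrite big_cat /=; move: hy; move: (sup S) (\sum_(i <- s0) _) (\sum_(i <- s) _) => *; lra.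
Qed.

End Synthesis.

(** * The sampling operator, its Neumann series and the frame *)

Section FrameOperator.
Context {R : realType} (k : nat) (x : int -> R) (g d lam W : R).
Context (k0 : (0 < k)%N) (G : gaps x g d) (lam0 : 0 < lam) (W0 : 0 <= W)
  (Wi : wirtinger k lam d) (Wlam : (2 * pi * W) ^+ 2 < lam).
Implicit Types (f : R -> R) (c : int -> nat -> R) (s : seq int).

Definition node_proj i l : R -> R := proj W (node k x 0 i l).
Definition top_der f : R -> R := derive1n k.-1 f.
Definition jets f : int -> nat -> R := fun i l => derive1n l f (x i).
Definition ratio : R := 2 * pi * W / Num.sqrt lam.

Let k1 : (k.-1 < k)%N. Proof. by rewrite prednK. Qed.

Lemma ratio_ge0 : 0 <= ratio.
Proof. by rewrite divr_ge0 ?sqrtr_ge0 // !mulr_ge0 ?pi_ge0. Qed.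

Lemma ratio_lt1 : ratio < 1.
Proof.
rewrite /ratio ltr_pdivrMr ?sqrtr_gt0 // mul1r -[ltLHS]ger0_norm ?mulr_ge0 ?pi_ge0 //.
by rewrite -sqrtr_sqr ltr_sqrt.
Qed.

Lemma node_proj_BL i l : BL W (node_proj i l).
Proof. by apply: proj_BL; case: (node_itg k 0 i l G). Qed.

Lemma top_der_BL f : BL W f -> BL W (top_der f).
Proof. exact: BL_derive1n. Qed.

(** Projection and differentiation commute here because, by [node_hartley], the cellwise derivative
    is a weak one. *)
Lemma top_der_node_proj i l : (l < k)%N -> top_der (node_proj i l) = proj W (node k x k.-1 i l).
Proof.
move=> lk; apply: proj_derive => //; [by case: (node_itg k 0 i l G)|by case: (node_itg k k.-1 i l G)|].
by move=> w; exact: (node_hartley i w G k1 lk).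
Qed.

Lemma BL_derive1n_sum (I : Type) (r : seq I) (F : I -> R -> R) n (t : R) : (forall i, BL W (F i)) ->
  derive1n n (fun t => \sum_(i <- r) F i t) t = \sum_(i <- r) derive1n n (F i) t.
Proof.
move=> BF; elim: r => [|i r IH].
  rewrite big_nil (_ : (fun t => _) = (fun t => 0 * (fun=> 0) t)).
    by rewrite (BL_derive1nZ 0 n t W0 (@BL0 _ W)) mul0r.
  by apply/funext => y; rewrite big_nil mul0r.
rewrite big_cons -IH -(BL_derive1nD _ _ W0) //; last exact: BL_sum.
by congr (derive1n n _ t); apply/funext => y; rewrite big_cons.
Qed.

Lemma comb_BL F c s : (forall i l, BL W (F i l)) -> BL W (comb k F c s).
Proof. by move=> BF; apply: BL_sum => i; apply: BL_sum => l; exact: BLZ. Qed.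

Lemma top_der_comb F c s (t : R) : (forall i l, BL W (F i l)) ->
  top_der (comb k F c s) t = comb k (fun i l => top_der (F i l)) c s t.
Proof.
move=> BF; rewrite /top_der /comb BL_derive1n_sum; last by move=> i; apply: BL_sum => l; exact: BLZ.
apply: eq_bigr => i _; rewrite BL_derive1n_sum; last by move=> l; exact: BLZ.
by apply: eq_bigr => l _; rewrite (BL_derive1nZ _ _ _ W0).
Qed.

Lemma proj_comb j c s (t : R) :
  proj W (comb k (node k x j) c s) t = comb k (fun i l => proj W (node k x j i l)) c s t.
Proof.
have I i l : itg (node k x j i l) by case: (node_itg k j i l G).
rewrite /comb proj_sum; last by move=> i; apply: itg_sum => l; exact: itgZ.
apply: eq_bigr => i _; rewrite proj_sum; last by move=> l; exact: itgZ.
by apply: eq_bigr => l _; rewrite projZ.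
Qed.

Lemma node_comb_itg j c s : itg (comb k (node k x j) c s) /\ L2 (comb k (node k x j) c s).
Proof.
split; [apply: itg_sum => i; apply: itg_sum => l; apply: itgZ|
        apply: L2_sum => i; apply: L2_sum => l; apply: L2Z]; by case: (node_itg k j i l G).
Qed.

Lemma comb_node_proj c s : comb k node_proj c s = proj W (comb k (node k x 0) c s).
Proof. by apply/funext => t; rewrite proj_comb. Qed.

Lemma top_der_comb_node_proj c s : top_der (comb k node_proj c s) = proj W (comb k (node k x k.-1) c s).
Proof.
apply/funext => t; rewrite top_der_comb; last exact: node_proj_BL.
rewrite proj_comb; apply: eq_bigr => i _; apply: eq_bigr => l _; by rewrite top_der_node_proj.
Qed.

Lemma nrm_comb_node_proj c s : uniq s -> nrm (comb k node_proj c s) <= synth_const k g d * Num.sqrt (energy k c s).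
Proof.
move=> us; rewrite comb_node_proj; have [I L] := node_comb_itg 0 c s.
by apply: le_trans (proj_nrm W I L) _; case: (node_synth c G k0 us).
Qed.

Lemma nrm_top_der_comb c s : uniq s -> nrm (top_der (comb k node_proj c s)) <= synth_const k g d * Num.sqrt (energy k c s).
Proof.
move=> us; rewrite top_der_comb_node_proj; have [I L] := node_comb_itg k.-1 c s.
by apply: le_trans (proj_nrm W I L) _; case: (node_synth c G k1 us).
Qed.

Lemma synth_const_ge0 : 0 <= synth_const k g d.
Proof.
rewrite /synth_const !mulr_ge0 ?sqrtr_ge0 ?hermite_bound_ge0 //; first by case: G.
by rewrite ltW // (gaps_d G).
Qed.

(** [F] has the same scalar product with [S] and with its projection, so the squares of the two
    sides differ by |proj S|^2 - |S|^2 <= 0. *)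
Lemma proj_best F S : BL W F -> itg S -> L2 S ->
  nrm (fun t => F t - proj W S t) <= nrm (fun t => F t - S t).
Proof.
move=> BF IS LS; have LF := BL_L2 BF; have BP := proj_BL W IS; have LP := BL_L2 BP.
rewrite -(@ler_pXn2r _ 2) ?nnegrE ?nrm_ge0 // !sqr_nrm.
rewrite !dotBl ?dotBr; try exact: L2B; try by [].
have E1 := proj_dot IS BF; have E2 := proj_dot IS BP.
have : nrm (proj W S) ^+ 2 <= nrm S ^+ 2.
  by apply: lerXn2r; rewrite ?nnegrE ?nrm_ge0 // proj_nrm.
rewrite !sqr_nrm.
rewrite (dotC F (proj W S)) E1 (dotC S F) (dotC F S).
by move: (dot F F) (dot S F) (dot (proj W S) _) (dot S S) => *; lra.
Qed.

Definition sampling_n f n : R -> R := comb k node_proj (jets f) (int_ball n).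

Lemma sampling_n_BL f n : BL W (sampling_n f n).
Proof. exact: comb_BL node_proj_BL. Qed.

Lemma jets_bound f s : BL W f -> uniq s -> energy k (jets f) s <= polya_const k g d (2 * pi * W) * nrm f ^+ 2.
Proof. by move=> Bf us; exact: plancherel_polya. Qed.

Lemma jets_tail f : BL W f -> forall e, 0 < e ->
  exists N, forall s, uniq s -> (forall i, i \in s -> (N < `|i|)%N) -> Num.sqrt (energy k (jets f) s) <= e.
Proof.
move=> Bf e e0.
have [N NP] := @sum_tail _ (fun i => \sum_(l < k) jets f i l ^+ 2) _
  (fun i => sumr_ge0 _ (fun l _ => sqr_ge0 _)) (fun s us => jets_bound Bf us) _ (exprn_gt0 2 e0).
exists N => s us sb; rewrite -[leRHS]gtr0_norm // -sqrtr_sqr; apply: ler_wsqrtr; exact: NP.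
Qed.

Lemma jet_norm_cvg f : BL W f -> (fun n : nat => jet_norm k x f n%:Z) @ \oo --> 0 /\
  (fun n : nat => jet_norm k x f (- n%:Z)) @ \oo --> 0.
Proof.
move=> Bf; have H i : jet_norm k x f i = Num.sqrt (energy k (jets f) [:: i]) by rewrite /energy big_seq1.
have e0 i : 0 <= jet_norm k x f i by exact: sqrtr_ge0.
split; apply/cvgrPdist_le => /= e /(jets_tail Bf)[N NP]; near=> n;
  rewrite sub0r normrN ger0_norm // H; apply: NP => // i; rewrite inE => /eqP ->;
  rewrite ?abszN /=; near: n; exact: nbhs_infty_gt.
Unshelve. all: by end_near.
Qed.

(** Stated for arbitrary finite sets and for any family with a synthesis bound: for the projected
    node functions it defines the operator, for the frame it gives unconditional convergence. *)
Lemma comb_tail F (C : R) f : BL W f -> 0 <= C ->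
  (forall c s, uniq s -> nrm (comb k F c s) <= C * Num.sqrt (energy k c s)) ->
  forall e, 0 < e -> exists N, forall s1 s2, uniq s1 -> uniq s2 -> {subset int_ball N <= s1} ->
    {subset s1 <= s2} -> nrm (fun t => comb k F (jets f) s2 t - comb k F (jets f) s1 t) <= e.
Proof.
move=> Bf C0 FC e e0; have C1 : 0 < C + 1 by rewrite ltr_wpDl.
have [N NP] := jets_tail Bf (divr_gt0 e0 C1); exists N => s1 s2 u1 u2 N1 s12.
rewrite (_ : (fun t => _) = comb k F (jets f) [seq i <- s2 | i \notin s1]); last first.
  by apply/funext => t; exact: comb_diff.
have uf : uniq [seq i <- s2 | i \notin s1] by exact: filter_uniq.
apply: le_trans (FC _ _ uf) _; have := NP _ uf; set z := Num.sqrt _ => h.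
have hz : z <= e / (C + 1).
  apply: h => i; rewrite mem_filter => /andP[i1 _]; rewrite ltnNge -mem_int_ball.
  by apply: contra i1; exact: N1.
have z0 : 0 <= z by exact: sqrtr_ge0.
have : z * (C + 1) <= e by rewrite -ler_pdivlMr.
clear h; clearbody z; move: z z0 hz => y y0 _; rewrite mulrDr mulr1 [y * C]mulrC; move: (C * y) => *; lra.
Qed.

Definition sampling f (t : R) : R := limn (fun n => sampling_n f n t).

Lemma cvg_nrm_pt (u : nat -> R -> R) h (t : R) : (forall n, BL W (u n)) -> BL W h ->
  (fun n => nrm (fun t => u n t - h t)) @ \oo --> 0 -> (fun n => u n t) @ \oo --> h t.
Proof.
move=> Bu Bh C; apply/cvgrPdist_le => /= e e0.
have : (fun n => Kband W * nrm (fun t => u n t - h t)) @ \oo --> 0.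
  by rewrite -[X in _ --> X](mulr0 (Kband W)); apply: cvgMr.
move=> /cvgrPdist_le /(_ e e0); apply: filterS => n.
rewrite sub0r normrN ger0_norm ?mulr_ge0 ?nrm_ge0 ?Kband_ge0 //; apply: le_trans.
by rewrite distrC; apply: (BL_sup t); exact: BLB.
Qed.

(** The pointwise limit [sampling f] is identified with the L2 limit through boundedness of
    evaluation. The pointwise definition makes linearity a matter of limits of numbers. *)
Lemma sampling_spec f : BL W f -> BL W (sampling f) /\ (fun n => nrm (fun t => sampling_n f n t - sampling f t)) @ \oo --> 0.
Proof.
move=> Bf; have [||h Bh Ch] := @BL_complete _ W (sampling_n f); first exact: sampling_n_BL.
  move=> e e0; have [N NP] := comb_tail Bf synth_const_ge0 nrm_comb_node_proj e0.
  have sub m n : (m <= n)%N -> {subset int_ball m <= int_ball n}.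
    by move=> mn i; rewrite !mem_int_ball => /leq_trans; apply.
  exists N => m n Nm Nn; case: (leqP m n) => mn; [rewrite nrm_distC|];
    by apply: NP; [exact: uniq_int_ball|exact: uniq_int_ball|exact: sub|apply: sub; rewrite // ltnW].
suff -> : sampling f = h by [].
apply/funext => t; have := @cvg_nrm_pt _ _ t (sampling_n_BL f) Bh Ch.
by move=> /(cvg_lim (@Rhausdorff R)).
Qed.

Lemma sampling_BL f : BL W f -> BL W (sampling f). Proof. by case/sampling_spec. Qed.

Lemma sampling_cvg f t : BL W f -> (fun n => sampling_n f n t) @ \oo --> sampling f t.
Proof. by move=> Bf; have [B C] := sampling_spec Bf; exact: cvg_nrm_pt (sampling_n_BL f) B C. Qed.

Lemma sampling_D f h (t : R) : BL W f -> BL W h -> sampling (fun t => f t + h t) t = sampling f t + sampling h t.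
Proof.
move=> Bf Bh; have C := @sampling_cvg _ t (BLD Bf Bh).
apply: (cvg_unique (@Rhausdorff R) C).
rewrite (_ : (fun n => _) = (fun n => sampling_n f n t + sampling_n h n t)).
  by apply: (@cvgD _ R^o); exact: sampling_cvg.
apply/funext => n; rewrite /sampling_n /comb -big_split; apply: eq_bigr => i _ /=.
by rewrite -big_split; apply: eq_bigr => l _ /=; rewrite /jets (BL_derive1nD _ _ W0) // mulrDl.
Qed.

Lemma sampling_Z b f (t : R) : BL W f -> sampling (fun t => b * f t) t = b * sampling f t.
Proof.
move=> Bf; have C := @sampling_cvg _ t (BLZ b Bf).
apply: (cvg_unique (@Rhausdorff R) C).
rewrite (_ : (fun n => _) = (fun n => b * sampling_n f n t)); first by apply: cvgMr; exact: sampling_cvg.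
apply/funext => n; rewrite /sampling_n /comb mulr_sumr; apply: eq_bigr => i _ /=.
by rewrite mulr_sumr; apply: eq_bigr => l _ /=; rewrite /jets (BL_derive1nZ _ _ _ W0) // mulrA.
Qed.

Lemma bernstein_diff f h n : BL W f -> BL W h ->
  nrm (fun t => derive1n n f t - derive1n n h t) <= (2 * pi * W) ^+ n * nrm (fun t => f t - h t).
Proof.
move=> Bf Bh; have := bernstein n W0 (BLB Bf Bh); congr (nrm _ <= _).
by apply/funext => t; rewrite (BL_derive1nB _ _ W0).
Qed.

Lemma top_der_cvg (f : nat -> R -> R) h : (forall n, BL W (f n)) -> BL W h ->
  (fun n : nat => nrm (fun t => f n t - h t)) @ \oo --> 0 ->
  (fun n : nat => nrm (fun t => top_der (f n) t - top_der h t)) @ \oo --> 0.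
Proof.
move=> Bf Bh C; apply: (@squeeze_cvgr _ _ _ _ (fun=> 0) (fun n => (2 * pi * W) ^+ k.-1 * nrm (fun t => f n t - h t))).
- by near=> n; rewrite nrm_ge0 /=; exact: bernstein_diff.
- exact: cvg_cst.
- by rewrite -[X in _ --> X](mulr0 ((2 * pi * W) ^+ k.-1)); apply: cvgMr.
Unshelve. all: by end_near.
Qed.

(** Projecting the truncated interpolant does not increase its distance to the band-limited f^(k-1),
    so [hermite_samples_error] applies; then [n] tends to infinity. *)
Lemma sampling_contraction f : BL W f -> nrm (fun t => top_der f t - top_der (sampling f) t) <= ratio * nrm (top_der f).
Proof.
move=> Bf; have [BA CA] := sampling_spec Bf; have BDf := top_der_BL Bf.
have C1 := top_der_cvg (sampling_n_BL f) BA CA.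
have C2 := sum_indic_out G (BL_L2 BDf).
have [C3 C4] := jet_norm_cvg Bf.
have C34 : (fun n : nat => synth_const k g d * (jet_norm k x f n%:Z + jet_norm k x f (- n%:Z))) @ \oo --> 0.
  by rewrite -[X in _ --> X](mulr0 (synth_const k g d)) -[X in _ * X](addr0 0); apply: cvgMr; apply: (@cvgD _ R^o).
pose r n := nrm (fun t => top_der f t - \1_(`]x (- n%:Z), x n%:Z]%classic : set (measurableTypeR R)) t * top_der f t) +
  synth_const k g d * (jet_norm k x f n%:Z + jet_norm k x f (- n%:Z)) + nrm (fun t => top_der (sampling_n f n) t - top_der (sampling f) t).
have Cr : (fun n => ratio * nrm (top_der f) + r n) @ \oo --> ratio * nrm (top_der f).
  rewrite -[X in _ --> X]addr0; apply: (@cvgD _ R^o); first exact: cvg_cst.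
  rewrite -[X in _ --> X]addr0; apply: (@cvgD _ R^o); last exact: C1.
  by rewrite -[X in _ --> X]addr0; apply: (@cvgD _ R^o); [exact: C2|exact: C34].
apply: (@ler_cvg_to _ _ _ _ (fun=> nrm (fun t => top_der f t - top_der (sampling f) t)) _ _ _ _ Cr); first exact: cvg_cst.
near=> n.
have [LS NS] := hermite_samples_error n k0 G lam0 W0 Wi Bf.
have L0 := BL_L2 BDf; have L1 := BL_L2 (top_der_BL (sampling_n_BL f n)); have L2' := BL_L2 (top_der_BL BA).
apply: le_trans (nrm_tri (g := top_der (sampling_n f n)) L0 L1 L2') _.
rewrite /r !addrA; apply: lerD => //; rewrite -addrA; apply: le_trans _ (le_trans NS _).
  have [I L] := node_comb_itg k.-1 (jets f) (int_ball n).
  by rewrite /sampling_n top_der_comb_node_proj; exact: proj_best.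
by rewrite /ratio addrA.
Unshelve. all: by end_near.
Qed.

Definition residual f (t : R) : R := f t - sampling f t.

Lemma residual_BL f : BL W f -> BL W (residual f).
Proof. by move=> Bf; apply: BLB => //; exact: sampling_BL. Qed.

Lemma iter_residual_BL f n : BL W f -> BL W (iter n residual f).
Proof. by move=> Bf; elim: n => //= n IH; exact: residual_BL. Qed.

Lemma top_derB f h (t : R) : BL W f -> BL W h -> top_der (fun t => f t - h t) t = top_der f t - top_der h t.
Proof. by move=> Bf Bh; rewrite /top_der (BL_derive1nB _ _ W0). Qed.

Lemma residual_contraction f n : BL W f -> nrm (top_der (iter n residual f)) <= ratio ^+ n * nrm (top_der f).
Proof.
move=> Bf; elim: n => [|n IH]; first by rewrite mul1r.
have Bn := iter_residual_BL n Bf; rewrite iterS.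
have -> : top_der (residual (iter n residual f)) = (fun t => top_der (iter n residual f) t - top_der (sampling (iter n residual f)) t).
  by apply/funext => t; rewrite top_derB //; exact: sampling_BL.
apply: le_trans (sampling_contraction Bn) _; rewrite exprS -mulrA; apply: ler_wpM2l => //.
exact: ratio_ge0.
Qed.

Lemma iter_residual_D f h n : BL W f -> BL W h ->
  iter n residual (fun t => f t + h t) = (fun t => iter n residual f t + iter n residual h t).
Proof.
move=> Bf Bh; elim: n => //= n ->; apply/funext => t; rewrite /residual sampling_D; try exact: iter_residual_BL.
by move: (sampling _ _) (sampling _ _) (iter _ _ _ _) (iter _ _ _ _) => *; ring.
Qed.

Lemma iter_residual_Z b f n : BL W f -> iter n residual (fun t => b * f t) = (fun t => b * iter n residual f t).
Proof.
move=> Bf; elim: n => //= n ->; apply/funext => t; rewrite /residual sampling_Z; last exact: iter_residual_BL.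
by rewrite mulrBr.
Qed.

(** Differentiation comes before summation: [residual_contraction] controls the top derivatives of
    the iterated residuals, not the residuals themselves. *)
Definition neumann_n f n (t : R) : R := \sum_(m < n) top_der (iter m residual f) t.
Definition neumann f (t : R) : R := limn (fun n => neumann_n f n t).

Lemma neumann_n_BL f n : BL W f -> BL W (neumann_n f n).
Proof. by move=> Bf; apply: BL_sum => m; apply: top_der_BL; exact: iter_residual_BL. Qed.

Lemma geometric_le n : \sum_(m < n) ratio ^+ m <= (1 - ratio)^-1.
Proof.
have q1 : 0 < 1 - ratio by rewrite subr_gt0 ratio_lt1.
suff <- : (1 - ratio ^+ n) / (1 - ratio) = \sum_(m < n) ratio ^+ m.
  by rewrite ler_piMl ?invr_ge0 ?(ltW q1) // lerBlDr lerDl exprn_ge0 // ratio_ge0.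
apply/eqP; rewrite eq_sym -(inj_eq (mulIf (lt0r_neq0 q1))) divfK ?lt0r_neq0 //.
elim: n => [|n /eqP IH]; first by rewrite big_ord0 mul0r expr0 subrr.
by rewrite big_ord_recr /= mulrDl IH exprS; apply/eqP; ring.
Qed.

Lemma neumann_n_diff f n p : BL W f -> nrm (fun t => neumann_n f (n + p) t - neumann_n f n t) <= ratio ^+ n * ((1 - ratio)^-1 * nrm (top_der f)).
Proof.
move=> Bf.
rewrite (_ : (fun t => _) = (fun t => \sum_(m < p) top_der (iter (n + m) residual f) t)); last first.
  by apply/funext => t; rewrite /neumann_n [X in X - _]big_split_ord /= [X in X - _]addrC addrK.
apply: le_trans (nrm_sum _ _) _; first by move=> m; apply: BL_L2; apply: top_der_BL; exact: iter_residual_BL.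
apply: (@le_trans _ _ (\sum_(m < p) ratio ^+ n * (ratio ^+ m * nrm (top_der f)))).
  by apply: ler_sum => m _; rewrite mulrA -exprD; exact: residual_contraction.
rewrite -mulr_sumr; apply: ler_wpM2l; first by rewrite exprn_ge0 // ratio_ge0.
by rewrite -mulr_suml; apply: ler_wpM2r; [exact: nrm_ge0|exact: geometric_le].
Qed.

Lemma neumann_spec f : BL W f -> BL W (neumann f) /\ (fun n => nrm (fun t => neumann_n f n t - neumann f t)) @ \oo --> 0.
Proof.
move=> Bf; have [||h Bh Ch] := @BL_complete _ W (neumann_n f); first by move=> n; exact: neumann_n_BL.
  move=> e e0; have C : (fun n => ratio ^+ n * ((1 - ratio)^-1 * nrm (top_der f))) @ \oo --> 0.
    rewrite -[X in _ --> X](mul0r ((1 - ratio)^-1 * nrm (top_der f))); apply: cvgMl.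
    by apply: cvg_expr; rewrite ger0_norm ?ratio_ge0 // ratio_lt1.
  move/cvgrPdist_le : (C) => /(_ e e0)[N _ NP].
  have H m n : (N <= m)%N -> (m <= n)%N -> nrm (fun t => neumann_n f n t - neumann_n f m t) <= e.
    move=> Nm mn; have := NP m Nm; rewrite sub0r normrN; apply: le_trans.
    by rewrite -(subnKC mn); apply: le_trans (neumann_n_diff m _ Bf) _; exact: ler_norm.
  exists N => m n Nm Nn; case: (leqP m n) => mn; [rewrite nrm_distC|]; apply: H => //.
  exact: ltnW.
suff -> : neumann f = h by [].
apply/funext => t; have := @cvg_nrm_pt _ _ t (fun n => neumann_n_BL n Bf) Bh Ch.
by move=> /(cvg_lim (@Rhausdorff R)).
Qed.

Lemma neumann_BL f : BL W f -> BL W (neumann f). Proof. by case/neumann_spec. Qed.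

Lemma neumann_cvg f t : BL W f -> (fun n => neumann_n f n t) @ \oo --> neumann f t.
Proof. by move=> Bf; have [B C] := neumann_spec Bf; exact: cvg_nrm_pt (fun n => neumann_n_BL n Bf) B C. Qed.

(** Only the seminorm of [f] enters on the right; with [nrm_top_der_comb] this bounds synthesis by
    the frame. *)
Lemma nrm_neumann f : BL W f -> nrm (neumann f) <= (1 - ratio)^-1 * nrm (top_der f).
Proof.
move=> Bf; have [BU C] := neumann_spec Bf; set K := _ * nrm (top_der f).
have C2 : (fun n => K + nrm (fun t => neumann_n f n t - neumann f t)) @ \oo --> K.
  by rewrite -[X in _ --> X]addr0; apply: (@cvgD _ R^o); [exact: cvg_cst|exact: C].
apply: (@ler_cvg_to _ _ _ _ (fun=> nrm (neumann f)) _ _ _ _ C2); first exact: cvg_cst.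
near=> n; have L1 := BL_L2 (neumann_n_BL n Bf); have L2' := BL_L2 BU.
rewrite [X in nrm X <= _](_ : neumann f = (fun t => neumann_n f n t - (neumann_n f n t - neumann f t))); last first.
  by apply/funext => t; rewrite subKr.
apply: le_trans (nrmB L1 (L2B L1 L2')) _; rewrite lerD //.
have := neumann_n_diff 0 n Bf; rewrite add0n mul1r; congr (nrm _ <= _).
by apply/funext => t; rewrite {2}/neumann_n big_ord0 subr0.
Unshelve. all: by end_near.
Qed.

Lemma neumann_D f h (t : R) : BL W f -> BL W h -> neumann (fun t => f t + h t) t = neumann f t + neumann h t.
Proof.
move=> Bf Bh; have C := @neumann_cvg _ t (BLD Bf Bh).
apply: (cvg_unique (@Rhausdorff R) C).
rewrite (_ : (fun n => _) = (fun n => neumann_n f n t + neumann_n h n t)).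
  by apply: (@cvgD _ R^o); exact: neumann_cvg.
apply/funext => n; rewrite /neumann_n -big_split; apply: eq_bigr => m _ /=.
by rewrite iter_residual_D // /top_der (BL_derive1nD _ _ W0) //; exact: iter_residual_BL.
Qed.

Lemma neumann_Z b f (t : R) : BL W f -> neumann (fun t => b * f t) t = b * neumann f t.
Proof.
move=> Bf; have C := @neumann_cvg _ t (BLZ b Bf).
apply: (cvg_unique (@Rhausdorff R) C).
rewrite (_ : (fun n => _) = (fun n => b * neumann_n f n t)); first by apply: cvgMr; exact: neumann_cvg.
apply/funext => n; rewrite /neumann_n mulr_sumr; apply: eq_bigr => m _ /=.
by rewrite iter_residual_Z // /top_der (BL_derive1nZ _ _ _ W0) //; exact: iter_residual_BL.
Qed.

Lemma neumann_B f h (t : R) : BL W f -> BL W h -> neumann (fun t => f t - h t) t = neumann f t - neumann h t.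
Proof.
move=> Bf Bh; rewrite -mulN1r -(neumann_Z _ _ Bh) -neumann_D //; last exact: BLZ.
by congr (neumann _ t); apply/funext => y; rewrite mulN1r.
Qed.

Lemma neumann_sum (I : Type) (r : seq I) (F : I -> R -> R) (t : R) : (forall i, BL W (F i)) ->
  neumann (fun t => \sum_(i <- r) F i t) t = \sum_(i <- r) neumann (F i) t.
Proof.
move=> BF; elim: r => [|i r IH].
  rewrite big_nil (_ : (fun t => _) = (fun t => 0 * (fun=> 0) t)).
    by rewrite neumann_Z ?mul0r //; exact: BL0.
  by apply/funext => y; rewrite big_nil mul0r.
rewrite big_cons -IH -neumann_D //; last exact: BL_sum.
by congr (neumann _ t); apply/funext => y; rewrite big_cons.
Qed.

(* The Neumann series for [1 - sampling] telescopes. *)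
Lemma neumann_sampling f (t : R) : BL W f -> neumann (sampling f) t = top_der f t.
Proof.
move=> Bf; have BE := residual_BL Bf.
have -> : sampling f = (fun t => f t - residual f t) by apply/funext => y; rewrite /residual subKr.
rewrite neumann_B //.
suff -> : neumann (residual f) t = neumann f t - top_der f t by rewrite subKr.
apply: (cvg_unique (@Rhausdorff R) (@neumann_cvg _ t BE)).
rewrite (_ : (fun n => _) = (fun n => neumann_n f n.+1 t - top_der f t)).
  apply: (@cvgB _ R^o); last exact: cvg_cst.
  by have := @neumann_cvg _ t Bf; rewrite -(@cvg_shiftS _ (fun n => neumann_n f n t)).
apply/funext => n; rewrite /neumann_n big_ord_recl /= addrC addKr.
by apply: eq_bigr => m _; rewrite -iterSr.
Qed.

Definition frame i l : R -> R := neumann (node_proj i l).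

Lemma frame_BL i l : BL W (frame i l).
Proof. exact: neumann_BL (node_proj_BL i l). Qed.

Lemma comb_frame c s : comb k frame c s = neumann (comb k node_proj c s).
Proof.
apply/funext => t; rewrite /comb neumann_sum; last by move=> i; apply: BL_sum => l; apply: BLZ; exact: node_proj_BL.
apply: eq_bigr => i _; rewrite neumann_sum; last by move=> l; apply: BLZ; exact: node_proj_BL.
by apply: eq_bigr => l _; rewrite neumann_Z //; exact: node_proj_BL.
Qed.

Definition frame_const : R := (1 - ratio)^-1 * synth_const k g d.

Lemma frame_const_ge0 : 0 <= frame_const.
Proof. by rewrite mulr_ge0 ?synth_const_ge0 // invr_ge0 subr_ge0 ltW // ratio_lt1. Qed.

Lemma frame_synth c s : uniq s -> nrm (comb k frame c s) <= frame_const * Num.sqrt (energy k c s).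
Proof.
move=> us; rewrite comb_frame; apply: le_trans (nrm_neumann (comb_BL c s node_proj_BL)) _.
rewrite /frame_const -mulrA; apply: ler_wpM2l; last exact: nrm_top_der_comb.
by rewrite invr_ge0 subr_ge0 ltW // ratio_lt1.
Qed.

(** On a ball of nodes the frame sum is the operator [neumann] applied to the truncated sampling of
    [f]. Its distance to [neumann (sampling f)], which is f^(k-1), is bounded by the seminorm of the
    truncation error. A general finite set is compared with a larger ball by the tail estimate. *)
Lemma frame_reconstruction f : BL W f -> forall e, 0 < e ->
  exists N, forall s, uniq s -> {subset int_ball N <= s} ->
  nrm (fun t => top_der f t - comb k frame (jets f) s t) <= e.
Proof.
move=> Bf e e0; have e2 : 0 < e / 2 by rewrite divr_gt0.
have [N NP] := comb_tail Bf frame_const_ge0 frame_synth e2; exists N => s us Ns.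
have [BA CA] := sampling_spec Bf; have CD := top_der_cvg (sampling_n_BL f) BA CA.
have q1 : 0 < (1 - ratio)^-1 by rewrite invr_gt0 subr_gt0 ratio_lt1.
have [M sM] := sub_int_ball s.
have C3 : (fun n => (1 - ratio)^-1 * nrm (fun t => top_der (sampling_n f n) t - top_der (sampling f) t)) @ \oo --> 0.
  by rewrite -[X in _ --> X](mulr0 (1 - ratio)^-1); apply: cvgMr; exact: CD.
move/cvgrPdist_le : (C3) => /(_ _ e2)[N2 _ N2P].
(* Large enough for the ball to contain [s] and for the truncated operator to be close to its
   limit. *)
pose n := maxn M N2; have := N2P n (leq_maxr M N2); rewrite sub0r normrN.
rewrite ger0_norm ?mulr_ge0 ?nrm_ge0 ?(ltW q1) // => h2.
have sn : {subset s <= int_ball n}.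
  by move=> i /sM; rewrite !mem_int_ball => /leq_trans; apply; exact: leq_maxl.
have h1 := NP s (int_ball n) us (uniq_int_ball n) Ns sn.
have BDf := top_der_BL Bf; have Bn := comb_BL (jets f) (int_ball n) frame_BL; have Bs := comb_BL (jets f) s frame_BL.
apply: le_trans (nrm_tri (g := comb k frame (jets f) (int_ball n)) (BL_L2 BDf) (BL_L2 Bn) (BL_L2 Bs)) _.
rewrite [leRHS](splitr e); apply: lerD => //; apply: le_trans h2.
rewrite comb_frame nrm_distC -/(sampling_n f n).
rewrite (_ : (fun t => _) = neumann (fun t => sampling_n f n t - sampling f t)); last first.
  by apply/funext => t; rewrite neumann_B ?neumann_sampling //; exact: sampling_n_BL.
apply: le_trans (nrm_neumann (BLB (sampling_n_BL f n) BA)) _; apply: ler_wpM2l; first exact: ltW.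
rewrite le_eqVlt; apply/orP; left; apply/eqP; congr nrm; apply/funext => t.
by rewrite top_derB //; exact: sampling_n_BL.
Qed.

(** Duality: with the coefficients c = <f, g> the energy E is <f, sum of c g>, hence at most |f| C
    sqrt E by the synthesis bound, and sqrt E can be cancelled. *)
Lemma frame_bessel f s : BL W f -> uniq s -> energy k (fun i l => dot f (frame i l)) s <= frame_const ^+ 2 * nrm f ^+ 2.
Proof.
move=> Bf us; set c := fun i l => _; have L0 := BL_L2 Bf.
have Lf i l := BL_L2 (frame_BL i l).
have Ec : energy k c s = dot f (comb k frame c s).
  rewrite dotC /comb dot_suml //; last by move=> i; apply: L2_sum => l; exact: L2Z.
  apply: eq_bigr => i _; rewrite dot_suml //; last by move=> l; exact: L2Z.
  by apply: eq_bigr => l _; rewrite dotZl // dotC expr2.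
have Lc := BL_L2 (comb_BL c s frame_BL).
have h1 := cauchy_schwarz L0 Lc; have h2 := frame_synth c us.
have s0 := energy_ge0 k c s; have r0 : 0 <= Num.sqrt (energy k c s) by exact: sqrtr_ge0.
have h3 : Num.sqrt (energy k c s) ^+ 2 <= nrm f * (frame_const * Num.sqrt (energy k c s)).
  rewrite sqr_sqrtr // {1}Ec; apply: le_trans (ler_norm _) _; apply: le_trans h1 _.
  by apply: ler_wpM2l => //; exact: nrm_ge0.
rewrite -[leLHS]sqr_sqrtr //.
have := nrm_ge0 f; have := frame_const_ge0; move: r0 h3; move: (Num.sqrt _) (nrm f) frame_const => r n C r0 h3 C0 n0.
have [->|rn] := eqVneq r 0; first by rewrite expr0n mulr_ge0 ?sqr_ge0.
have rp : 0 < r by rewrite lt0r rn.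
have h4 : r <= C * n by rewrite -(ler_pM2r rp); move: h3; rewrite expr2; congr (_ <= _); ring.
by rewrite -exprMn; apply: lerXn2r; rewrite ?nnegrE ?mulr_ge0.
Qed.

End FrameOperator.

(** * Complex-valued functions *)

Section ComplexNorm.
Context {R : realType}.
Notation mu := (@lebesgue_measure R).
Notation normc := ComplexField.Normc.normc.
Implicit Types (h u : R -> complex R) (f g a v p r : R -> R).

Lemma normc_sqr (z : complex R) : normc z ^+ 2 = complex.Re z ^+ 2 + complex.Im z ^+ 2.
Proof. by case: z => a b /=; rewrite sqr_sqrtr // addr_ge0 // sqr_ge0. Qed.

Lemma normc_le (z : complex R) : normc z <= `|complex.Re z| + `|complex.Im z|.
Proof.
have n0 : 0 <= normc z by case: z => a b; exact: sqrtr_ge0.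
rewrite -(@ler_pXn2r _ 2) ?nnegrE ?addr_ge0 // normc_sqr.
rewrite -[complex.Re z ^+ 2]real_normK ?num_real // -[complex.Im z ^+ 2]real_normK ?num_real //.
have := normr_ge0 (complex.Re z); have := normr_ge0 (complex.Im z).
by move: `|_| `|_| => b a a0 b0; rewrite sqrrD lerD2r lerDl mulrn_wge0 // mulr_ge0.
Qed.

Lemma L2norm_def h : L2norm h = sqrte (\int[mu]_x (re h x ^+ 2 + im h x ^+ 2)%:E)%E.
Proof.
rewrite /L2norm unlock -poweR12_sqrt; last first.
  by apply: integral_ge0 => x _; rewrite lee_fin addr_ge0 // sqr_ge0.
congr (_ `^ _)%E; apply: eq_integral => x _ /=; congr EFin.
have n0 : 0 <= normc (h x) by case: (h x) => a b; exact: sqrtr_ge0.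
by rewrite ger0_norm // powR_mulrn // normc_sqr.
Qed.

Lemma L2norm_L2 h : L2 (re h) -> L2 (im h) ->
  L2norm h = (Num.sqrt (nrm (re h) ^+ 2 + nrm (im h) ^+ 2))%:E.
Proof.
move=> L1 L2'; rewrite L2norm_def !sqr_nrm /dot.
have I : itg (fun x => re h x ^+ 2 + im h x ^+ 2) by apply: itgD; [exact: L1.2|exact: L2'.2].
have -> : \int[mu]_x (re h x * re h x) + \int[mu]_x (im h x * im h x) =
    \int[mu]_x (re h x ^+ 2 + im h x ^+ 2).
  by rewrite IntD; [congr (_ + _); apply: Int_ext => x; exact: expr2|exact: L1.2|exact: L2'.2].
by rewrite /Rintegral -[X in sqrte X]fineK //; exact: integrable_fin_num.
Qed.

Lemma L2norm_fin h : measurable_fun [set: R] (re h) -> measurable_fun [set: R] (im h) ->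
  L2norm h \is a fin_num -> L2 (re h) /\ L2 (im h).
Proof.
move=> m1 m2; rewrite L2norm_def => fin.
have m12 : measurable_fun [set: R] (fun x => re h x ^+ 2 + im h x ^+ 2).
  by apply: measurable_funD; exact: meas_sq.
have I : itg (fun x => re h x ^+ 2 + im h x ^+ 2).
  apply/integrableP; split; first exact/measurable_EFinP.
  under eq_integral => x _ do rewrite /= ger0_norm ?addr_ge0 ?sqr_ge0 //.
  move: fin; case: (\int[mu]_x _)%E => //= z; by rewrite ltry.
split; split => //; apply: itg_dom I; try exact: meas_sq.
  by move=> x; rewrite ger0_norm ?sqr_ge0 // lerDl sqr_ge0.
by move=> x; rewrite ger0_norm ?sqr_ge0 // lerDr sqr_ge0.
Qed.

Lemma L2norm_cvg0 (T : Type) (F : set_system T) (FF : Filter F) (h : T -> R -> complex R) :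
  (forall n, L2 (re (h n)) /\ L2 (im (h n))) ->
  (fun n => nrm (re (h n))) @ F --> 0 -> (fun n => nrm (im (h n))) @ F --> 0 ->
  (fun n => L2norm (h n)) @ F --> 0%E.
Proof.
move=> L C1 C2.
rewrite (_ : (fun n => _) = EFin \o (fun n => Num.sqrt (nrm (re (h n)) ^+ 2 + nrm (im (h n)) ^+ 2))); last first.
  by apply/funext => n; have [L1 L2'] := L n; rewrite L2norm_L2.
apply: cvg_EFin; first by near=> n.
have C : (fun n => nrm (re (h n)) + nrm (im (h n))) @ F --> 0.
  by rewrite -[X in _ --> X]addr0; apply: (@cvgD _ R^o).
apply: (@squeeze_cvgr _ _ _ _ (fun=> 0) (fun n => nrm (re (h n)) + nrm (im (h n)))) => //; last exact: cvg_cst.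
near=> n; rewrite sqrtr_ge0 /=.
have := nrm_ge0 (re (h n)); have := nrm_ge0 (im (h n)); move: (nrm _) (nrm _) => b c b0 c0.
rewrite -[leRHS]ger0_norm ?addr_ge0 // -sqrtr_sqr; apply: ler_wsqrtr.
by rewrite sqrrD lerD2r lerDl mulrn_wge0 // mulr_ge0.
Unshelve. all: by end_near.
Qed.

(** An extended norm tending to 0 is eventually finite, and from then on real and imaginary parts
    are square integrable. *)
Lemma L2norm_cvg0_inv (h : nat -> R -> complex R) :
  (forall n, measurable_fun [set: R] (re (h n)) /\ measurable_fun [set: R] (im (h n))) ->
  (fun n => L2norm (h n)) @ \oo --> 0%E ->
  forall e, 0 < e -> \forall n \near \oo, [/\ L2 (re (h n)), L2 (im (h n)),
     nrm (re (h n)) <= e & nrm (im (h n)) <= e].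
Proof.
move=> m /fine_cvgP[fin /cvgrPdist_le C] e e0; near=> n.
have [m1 m2] := m n.
have [L1 L2'] : L2 (re (h n)) /\ L2 (im (h n)) by apply: L2norm_fin => //; near: n.
have : `|0 - fine (L2norm (h n))| <= e by near: n; exact: C.
rewrite sub0r normrN L2norm_L2 //= ger0_norm ?sqrtr_ge0 //.
have := nrm_ge0 (re (h n)); have := nrm_ge0 (im (h n)); move: (nrm _) (nrm _) => b c b0 c0 H.
split => //; apply: le_trans H; rewrite -[leLHS]ger0_norm // -sqrtr_sqr; apply: ler_wsqrtr.
  by rewrite lerDl sqr_ge0.
by rewrite lerDr sqr_ge0.
Unshelve. all: by end_near.
Qed.

Lemma Lfun2_L2 f : f \in Lfun mu 2%:E <-> L2 f.
Proof.
split=> [H|[mf If]].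
  split; last exact: Lfun2_integrable_sqr.
  by move: H; rewrite inE => /andP[/[!inE]].
rewrite inE; apply/andP; split; rewrite inE //= /finite_norm unlock; apply: poweR_lty.
move/integrableP : If => [_]; apply: le_lt_trans.
rewrite le_eqVlt; apply/orP; left; apply/eqP; apply: eq_integral => x _ /=; congr EFin.
by rewrite powR_mulrn // real_normK ?num_real // ger0_norm // sqr_ge0.
Qed.

Lemma hartley_cos_sin f (w : R) : itg f ->
  [/\ itg (fun x => f x * cos (2 * pi * w * x)), itg (fun x => f x * sin (2 * pi * w * x)),
      \int[mu]_x (f x * cos (2 * pi * w * x)) = (hartley f w + hartley f (- w)) / 2 &
      \int[mu]_x (f x * sin (2 * pi * w * x)) = (hartley f w - hartley f (- w)) / 2].
Proof.
move=> If; have I1 := itg_cas w If; have I2 := itg_cas (- w) If.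
have E1 x : f x * cos (2 * pi * w * x) = 2^-1 * (f x * cas (2 * pi * w * x) + f x * cas (2 * pi * - w * x)).
  by rewrite /cas mulrN mulNr cosN sinN; move: (cos _) (sin _) => c s; field.
have E2 x : f x * sin (2 * pi * w * x) = 2^-1 * (f x * cas (2 * pi * w * x) - f x * cas (2 * pi * - w * x)).
  by rewrite /cas mulrN mulNr cosN sinN; move: (cos _) (sin _) => c s; field.
split.
- by under eq_fun do rewrite E1; apply: itgZ; exact: itgD.
- by under eq_fun do rewrite E2; apply: itgZ; exact: itgB.
- by under Int_ext do rewrite E1; rewrite IntZl ?IntD //; [rewrite mulrC|exact: itgD].
- by under Int_ext do rewrite E2; rewrite IntZl ?IntB //; [rewrite mulrC|exact: itgB].
Qed.

Lemma fourierE u (w : R) : itg (re u) -> itg (im u) ->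
  re (fourier u) w = (hartley (re u) w + hartley (re u) (- w)) / 2 +
                     (hartley (im u) w - hartley (im u) (- w)) / 2 /\
  im (fourier u) w = (hartley (im u) w + hartley (im u) (- w)) / 2 -
                     (hartley (re u) w - hartley (re u) (- w)) / 2.
Proof.
move=> I1 I2; have [c1 s1 C1 S1] := hartley_cos_sin w I1; have [c2 s2 C2 S2] := hartley_cos_sin w I2.
rewrite -C1 -S1 -C2 -S2 -IntD // -IntB //; split; apply: Int_ext => x;
  rewrite /re /im /expi; case: (u x) => a b /=; rewrite cosN sinN; ring.
Qed.

(** Recovers the Hartley transform of the real part of u from the real and imaginary parts [p] and
    [r] of its Fourier transform. The imaginary part of u is the real part of - i u, whence the
    arguments (r, - p) in the second use. *)
Definition fourier_mix p r (w : R) : R := (p w + p (- w) + r (- w) - r w) / 2.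

Lemma hartley_mix u (w : R) : itg (re u) -> itg (im u) ->
  hartley (re u) w = fourier_mix (re (fourier u)) (im (fourier u)) w /\
  hartley (im u) w = fourier_mix (im (fourier u)) (fun w => - re (fourier u) w) w.
Proof.
move=> I1 I2; have [A1 B1] := fourierE w I1 I2; have [A2 B2] := fourierE (- w) I1 I2.
rewrite /fourier_mix A1 A2 B1 B2 opprK; move: (hartley _ _) (hartley _ _) (hartley _ _) (hartley _ _) => a b c d.
by split; field.
Qed.

Lemma fourier_mix_L2 p r : L2 p -> L2 r -> L2 (fourier_mix p r) /\ nrm (fourier_mix p r) <= nrm p + nrm r.
Proof.
move=> Lp Lr; have Lp' := L2_reflect Lp; have Lr' := L2_reflect Lr.
have E : fourier_mix p r = (fun w => 2^-1 * ((p w + p (- w)) + (r (- w) - r w))).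
  by apply/funext => w; rewrite /fourier_mix mulrC addrA.
have L1 := L2D Lp Lp'; have L2' := L2B Lr' Lr.
rewrite E; split; first exact/L2Z/L2D.
rewrite nrmZ ?ger0_norm ?invr_ge0 //; last exact: L2D.
rewrite ler_pdivrMl //; apply: le_trans (nrmD L1 L2') _.
have := nrmD Lp Lp'; have := nrmB Lr' Lr; rewrite !nrm_reflect //.
move: (nrm _) (nrm _) (nrm p) (nrm r) => *; lra.
Qed.

End ComplexNorm.

(** * From the complex Fourier transform to the real transform *)

Section Bridge.
Context {R : realType}.
Notation mu := (@lebesgue_measure R).
Implicit Types (h u : R -> complex R) (f g a v p r : R -> R) (W e : R).

Lemma L2_itg_bounded f (M : R) : measurable_fun [set: R] f -> (forall x, `|f x| <= M) -> itg f -> L2 f.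
Proof.
move=> mf fM If; split => //.
have := itg_bounded_mul mf fM If; by under eq_fun do rewrite -expr2.
Qed.

Lemma edecay_ge0 e (x : R) : 0 <= edecay e x. Proof. exact: expR_ge0. Qed.

Lemma L2_edecay_cas e (x : R) : 0 < e ->
  itg (fun w => edecay e w * cas (2 * pi * x * w)) /\ L2 (fun w => edecay e w * cas (2 * pi * x * w)).
Proof.
move=> e0; have I := itg_cas x (itg_edecay e0); split => //.
apply: (@L2_itg_bounded _ 2) => //; first exact: itg_meas I.
move=> w; rewrite normrM ger0_norm ?edecay_ge0 //; apply: le_trans (cas_bound (2 * pi * x * w)).
by rewrite ler_piMl // edecay_le1 // ltW.
Qed.

Lemma L2_poisson e (x : R) : 0 < e -> L2 (fun y => poisson e (x - y)).
Proof.
move=> e0; have [I _] := poisson_int x e0.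
have E : (fun y => poisson e (x - y)) = (fun y => poisson e (y - x)).
  by apply/funext => y; exact: poissonC.
rewrite E; apply: (@L2_itg_bounded _ (2 / e)) => //; first exact: itg_meas I.
by move=> y; rewrite ger0_norm ?poisson_ge0 //; exact: poisson_le.
Qed.

(** Self-adjointness moves the transform onto the damped kernel, whose transform is the Poisson
    kernel. *)
Lemma poisson_dual e (x : R) v : 0 < e -> itg v -> L2 (hartley v) ->
  dot (fun w => edecay e w * cas (2 * pi * x * w)) (hartley v) = conv_poisson e v x.
Proof.
move=> e0 Iv Lv; have [I _] := L2_edecay_cas x e0.
have [_ E] := hartley_mult I Iv; rewrite /dot E; apply: Int_ext => y.
congr (_ * _); rewrite /hartley -(edecay_cas x y e0); apply: Int_ext => w.
by rewrite -mulrA; congr (_ * (_ * _)).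
Qed.

(* A continuous function whose L2 transform [a] vanishes off the band is the
   inverse transform of [a]: Poisson-regularise the inversion integral. *)
Lemma BL_of_transform W g a : continuous g -> L2 g -> L2 a ->
  nrm (fun w => a w - \1_(band W) w * a w) = 0 ->
  (forall e, 0 < e -> exists v, [/\ itg v, L2 v, L2 (hartley v),
     nrm (fun x => v x - g x) <= e & nrm (fun w => hartley v w - a w) <= e]) ->
  BL W g.
Proof.
move=> cg Lg La a0 H; pose a' (w : R) : R := \1_(band W) w * a w.
have La' : L2 a' by apply: L2_indic => //; exact: measurable_band.
have Va' : in_band W a' by split=> // w Bw; rewrite /a' indic_out // mul0r.
have Ia' := in_band_itg Va'.
(* Regularised inversion holds for the approximants [v]; both sides are continuous in L2, the left
   in the transform and the right in [v], so it passes to [g] and [a]. *)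
have key e x : 0 < e -> dot (fun w => edecay e w * cas (2 * pi * x * w)) a' = conv_poisson e g x.
  move=> e0; set phi := fun w => _; have [Iphi Lphi] := L2_edecay_cas x e0.
  rewrite -/phi in Iphi Lphi; have Lp := L2_poisson x e0.
  pose K := nrm phi + nrm (fun y => poisson e (x - y)).
  suff S eta : 0 < eta -> `|dot phi a' - conv_poisson e g x| <= K * eta.
    apply/eqP; rewrite -subr_eq0 -normr_le0; apply/ler_addgt0Pr => eta eta0.
    have K0 : 0 <= K by rewrite addr_ge0 // nrm_ge0.
    have K1 : 0 < K + 1 by rewrite ltr_wpDl.
    apply: le_trans (S _ (divr_gt0 eta0 K1)) _; rewrite add0r mulrA ler_pdivrMr // mulrC.
    by rewrite ler_wpM2l ?(ltW eta0) // lerDl.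
  move=> eta0; have [v [Iv Lv Lhv n1 n2]] := H _ eta0.
  have E1 : dot phi a' = dot phi a.
    apply/eqP; rewrite eq_sym -subr_eq0 -dotBr // -normr_le0.
    apply: le_trans (cauchy_schwarz Lphi (L2B La La')) _.
    by rewrite (_ : nrm (fun x => a x - a' x) = 0) ?mulr0.
  have E2 : conv_poisson e g x = dot (fun y => poisson e (x - y)) g by [].
  have E3 : conv_poisson e v x = dot (fun y => poisson e (x - y)) v by [].
  have E4 := poisson_dual x e0 Iv Lhv; rewrite -/phi in E4.
  have -> : dot phi a' - conv_poisson e g x = (dot phi a - dot phi (hartley v)) +
     (dot (fun y => poisson e (x - y)) v - dot (fun y => poisson e (x - y)) g).
    by rewrite E1 E2 E4 E3 addrA subrK.
  rewrite -dotBr // -dotBr //; apply: le_trans (ler_normD _ _) _.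
  rewrite mulrDl; apply: lerD.
    apply: le_trans (cauchy_schwarz Lphi (L2B La Lhv)) _.
    by apply: ler_wpM2l; [exact: nrm_ge0|rewrite nrm_distC].
  apply: le_trans (cauchy_schwarz Lp (L2B Lv Lg)) _.
  by apply: ler_wpM2l => //; exact: nrm_ge0.
exists a' => //; apply/funext => x.
have C1 := conv_poisson_cvg Lg (cg x).
have [||||_ C2] := @Rint_dct _ (fun n w => edecay (eps n) w * cas (2 * pi * x * w) * a' w)
  (fun w => a' w * cas (2 * pi * x * w)) (fun w => 2 * `|a' w|).
- move=> n; have [_ L] := L2_edecay_cas x (eps_gt0 n).
  by apply: measurable_funM; [exact: L.1|exact: La'.1].
- by apply: itgZ; exact: itg_norm.
- move=> w; have -> : a' w * cas (2 * pi * x * w) = 1 * cas (2 * pi * x * w) * a' w by rewrite mul1r mulrC.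
  apply: cvgMl; apply: cvgMl.
  have -> : 1 = edecay 0 w by rewrite /edecay mul0r oppr0 expR0.
  have Hc : (fun n => - (eps n * `|w|)) @ \oo --> - (0 * `|w|).
    by apply: cvgN; apply: cvgMl; exact: eps_cvg.
  exact: (cvg_comp _ _ Hc (@continuous_expR R _)).
- move=> n w; rewrite !normrM ler_wpM2r // -[leRHS]mul1r; apply: ler_pM => //; last exact: cas_bound.
  by rewrite ger0_norm ?edecay_ge0 // edecay_le1 // ltW // eps_gt0.
apply: (cvg_unique (@Rhausdorff R) C1).
rewrite (_ : _ \o eps = (fun n => \int[mu]_w (edecay (eps n) w * cas (2 * pi * x * w) * a' w))) //.
by apply/funext => n /=; rewrite -key ?eps_gt0.
Qed.

Lemma re_im_meas_fourier u : itg (re u) -> itg (im u) ->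
  measurable_fun [set: R] (re (fourier u)) /\ measurable_fun [set: R] (im (fourier u)).
Proof.
move=> I1 I2.
have m1 := hartley_meas I1; have m2 := hartley_meas I2.
have mN : measurable_fun [set: R] (fun w : R => - w) by apply: cont_meas => w; exact: opp_continuous.
have m1' := measurableT_comp m1 mN; have m2' := measurableT_comp m2 mN.
rewrite (_ : re (fourier u) = (fun w => (hartley (re u) w + hartley (re u) (- w)) / 2 +
                     (hartley (im u) w - hartley (im u) (- w)) / 2)); last first.
  by apply/funext => w; case: (fourierE w I1 I2).
rewrite (_ : im (fourier u) = (fun w => (hartley (im u) w + hartley (im u) (- w)) / 2 -
                     (hartley (re u) w - hartley (re u) (- w)) / 2)); last first.
  by apply/funext => w; case: (fourierE w I1 I2).
split; [apply: measurable_funD|apply: measurable_funB]; apply: measurable_funM => //;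
  by [apply: measurable_funD|apply: measurable_funB].
Qed.

Lemma nrm_ae0 p : L2 p -> {ae mu, forall w, p w = 0} -> nrm p = 0.
Proof.
move=> Lp p0; rewrite /nrm /dot (_ : \int[mu]_x _ = 0) ?sqrtr0 //.
rewrite /Rintegral (@ae_eq_integral _ _ _ mu setT (fun=> 0%E)) ?integral0 //.
- by apply/measurable_EFinP; apply: measurable_funM; exact: Lp.1.
- have FA : Filter (almost_everywhere mu) := ae_filter_ringOfSetsType mu.
  by apply: (@filterS _ _ FA _ _ _ p0) => w /= -> _; rewrite mulr0.
Qed.

Lemma ae_neq (c : R) : {ae mu, forall w, w <> c}.
Proof.
exists [set c]; split; [exact: measurable_set1|exact: lebesgue_measure_set1|].
by move=> w /= /contrapT ->.
Qed.

(** The support condition concerns the closed interval whereas [band] is open; the two end points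
    form a null set. *)
Lemma nrm_off_band W F p : p = re F \/ p = im F -> L2 p ->
  {ae mu, forall w, ~ `[- W, W]%classic w -> F w = 0} ->
  nrm (fun w => p w - \1_(band W) w * p w) = 0.
Proof.
move=> pF Lp F0; apply: nrm_ae0.
  by apply: L2B => //; apply: L2_indic => //; exact: measurable_band.
have n1 := ae_neq W; have n2 := ae_neq (- W).
have FA : Filter (nbhs (almost_everywhere mu)) := ae_filter_ringOfSetsType mu.
near=> w; have [Bw|Bw] := pselect (band W w); first by rewrite indic_in // mul1r subrr.
rewrite indic_out // mul0r subr0.
have Fw : F w = 0.
  have : ~ `[- W, W]%classic w -> F w = 0 by near: w.
  apply => /=; rewrite in_itv /= => /andP[w1 w2]; apply: Bw; rewrite /band /= in_itv /=.
  have w3 : w <> W by near: w.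
  have w4 : w <> - W by near: w.
  by rewrite !lt_neqAle w1 w2 !andbT; apply/andP; split; apply/eqP => // e; exact: w4.
by case: pF => ->; rewrite /re /im Fw.
Unshelve. all: by end_near.
Qed.

Lemma fourier_mix_off_band W p r : L2 p -> L2 r ->
  nrm (fun w => p w - \1_(band W) w * p w) = 0 -> nrm (fun w => r w - \1_(band W) w * r w) = 0 ->
  nrm (fun w => fourier_mix p r w - \1_(band W) w * fourier_mix p r w) = 0.
Proof.
move=> Lp Lr p0 r0; have mB := measurable_band W.
have [_ H] := fourier_mix_L2 (L2B Lp (L2_indic mB Lp)) (L2B Lr (L2_indic mB Lr)).
move: H; rewrite p0 r0 addr0 => H; apply/eqP; rewrite eq_le nrm_ge0 andbT; move: H; congr (nrm _ <= _).
apply/funext => w; rewrite /fourier_mix.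
have -> : \1_(band W) (- w) = \1_(band W) w :> R.
  by have [Bw|Bw] := pselect (band W w); [rewrite !indic_in //; exact/bandN|rewrite !indic_out // => /bandN].
by move: (\1_ _ _) => b; field.
Qed.

(** The approximants in [fourierL2] serve as the functions [v] of [BL_of_transform]; [fourier_mix]
    carries convergence of the Fourier transforms over to the Hartley transforms. *)
Lemma bandlimited_BL sigma (f' : R -> complex R) : bandlimited sigma f' ->
  BL (sigma / (2 * pi)) (re f') /\ BL (sigma / (2 * pi)) (im f').
Proof.
set W := sigma / (2 * pi) => -[[c1 c2] [/Lfun2_L2 L1 /Lfun2_L2 L2'] [F [[/Lfun2_L2 F1 /Lfun2_L2 F2] [u [Lu Cu CF]]] F0]].
have Iu n : itg (re (u n)) /\ itg (im (u n)).
  by have [[/Lfun1_integrable a1 /Lfun1_integrable a2] _] := Lu n.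
have Lu2 n : L2 (re (u n)) /\ L2 (im (u n)).
  by have [_ [/Lfun2_L2 a1 /Lfun2_L2 a2]] := Lu n.
pose Fu n := fourier (u n).
have mF n := re_im_meas_fourier (Iu n).1 (Iu n).2.
have reB (h1 h2 : R -> complex R) : re (fun w => h1 w - h2 w) = (fun w => re h1 w - re h2 w).
  by apply/funext => w; rewrite /re; case: (h1 w) => a b; case: (h2 w).
have imB (h1 h2 : R -> complex R) : im (fun w => h1 w - h2 w) = (fun w => im h1 w - im h2 w).
  by apply/funext => w; rewrite /im; case: (h1 w) => a b; case: (h2 w).
have D1 : forall e, 0 < e -> \forall n \near \oo, [/\ L2 (fun w => re (Fu n) w - re F w),
    L2 (fun w => im (Fu n) w - im F w), nrm (fun w => re (Fu n) w - re F w) <= e &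
    nrm (fun w => im (Fu n) w - im F w) <= e].
  move=> e e0; have := L2norm_cvg0_inv _ CF e0; under eq_near do rewrite reB imB; apply => n.
  rewrite reB imB; split; apply: measurable_funB; by [exact: (mF n).1|exact: (mF n).2|exact: F1.1|exact: F2.1].
have D2 : forall e, 0 < e -> \forall n \near \oo, [/\ L2 (fun w => re (u n) w - re f' w),
    L2 (fun w => im (u n) w - im f' w), nrm (fun w => re (u n) w - re f' w) <= e &
    nrm (fun w => im (u n) w - im f' w) <= e].
  move=> e e0; have := L2norm_cvg0_inv _ Cu e0; under eq_near do rewrite reB imB; apply => n.
  rewrite reB imB; split; apply: measurable_funB; by [exact: (Lu2 n).1.1|exact: (Lu2 n).2.1|exact: L1.1|exact: L2'.1].
have z1 := @nrm_off_band W F (re F) (or_introl erefl) F1 F0.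
have z2 := @nrm_off_band W F (im F) (or_intror erefl) F2 F0.
have z1' : nrm (fun w => - re F w - \1_(band W) w * - re F w) = 0.
  rewrite -[RHS]z1 -[RHS]nrmN; congr nrm; apply/funext => w; by rewrite mulrN opprB addrC opprK.
have F1' := L2N F1.
split.
- apply: (@BL_of_transform W (re f') (fourier_mix (re F) (im F))) => //.
  + by case: (fourier_mix_L2 F1 F2).
  + exact: fourier_mix_off_band.
  move=> e e0; have e2 : 0 < e / 2 by rewrite divr_gt0.
  have [N _ NP] := filterI (D1 _ e2) (D2 _ e0); have [[A1 A2 A3 A4] [B1 B2 B3 B4]] := NP N (leqnn N).
  have E : (fun w => hartley (re (u N)) w - fourier_mix (re F) (im F) w) =
      fourier_mix (fun w => re (Fu N) w - re F w) (fun w => im (Fu N) w - im F w).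
    by apply/funext => w; rewrite (hartley_mix w (Iu N).1 (Iu N).2).1 /fourier_mix /Fu; field.
  have [M1 M2] := fourier_mix_L2 A1 A2.
  exists (re (u N)); split; [exact: (Iu N).1|exact: (Lu2 N).1| |exact: B3|].
    have [M3 _] := fourier_mix_L2 F1 F2; have := L2D M1 M3; rewrite -E.
    by under eq_fun do rewrite subrK.
  by rewrite E (le_trans M2) // (splitr e) lerD.
- apply: (@BL_of_transform W (im f') (fourier_mix (im F) (fun w => - re F w))) => //.
  + by case: (fourier_mix_L2 F2 F1').
  + exact: fourier_mix_off_band.
  move=> e e0; have e2 : 0 < e / 2 by rewrite divr_gt0.
  have [N _ NP] := filterI (D1 _ e2) (D2 _ e0); have [[A1 A2 A3 A4] [B1 B2 B3 B4]] := NP N (leqnn N).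
  have E : (fun w => hartley (im (u N)) w - fourier_mix (im F) (fun w => - re F w) w) =
      fourier_mix (fun w => im (Fu N) w - im F w) (fun w => - (re (Fu N) w - re F w)).
    by apply/funext => w; rewrite (hartley_mix w (Iu N).1 (Iu N).2).2 /fourier_mix /Fu; field.
  have [M1 M2] := fourier_mix_L2 A2 (L2N A1).
  exists (im (u N)); split; [exact: (Iu N).2|exact: (Lu2 N).2| |exact: B4|].
    have [M3 _] := fourier_mix_L2 F2 F1'; have := L2D M1 M3; rewrite -E.
    by under eq_fun do rewrite subrK.
  by rewrite E (le_trans M2) // nrmN (splitr e) lerD.
Qed.

End Bridge.

(** * From the real transform back to the complex one *)

Section RealBandlimited.
Context {R : realType}.
Notation mu := (@lebesgue_measure R).

Definition of_real (g : R -> R) : R -> complex R := fun t => Complex (g t) 0.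

Lemma hartley0 (w : R) : hartley (fun=> 0) w = 0.
Proof.
rewrite /hartley (_ : (fun x => _) = (fun=> 0)); last by apply/funext => x; rewrite mul0r.
by rewrite /Rintegral integral0.
Qed.

Lemma nrm0 : nrm (fun=> 0 : R) = 0.
Proof.
rewrite /nrm /dot (_ : (fun x => _) = (fun=> 0)); last by apply/funext => x; rewrite mul0r.
by rewrite /Rintegral integral0 sqrtr0.
Qed.

Lemma of_real_fourier g (w : R) : itg g ->
  re (fourier (of_real g)) w = (hartley g w + hartley g (- w)) / 2 /\
  im (fourier (of_real g)) w = - ((hartley g w - hartley g (- w)) / 2).
Proof.
move=> Ig; have [-> ->] := @fourierE _ (of_real g) w Ig itg0.
have -> : im (of_real g) = (fun=> 0) by [].
by rewrite !hartley0 addr0 subr0 mul0r addr0 add0r.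
Qed.

(** For [g = hartley a] the damped functions [v n] are integrable and tend to [g] in L2, and their
    Hartley transforms, the Poisson means of [a], tend to [a] in L2. *)
Lemma BL_bandlimited (sigma : R) g : 0 < sigma -> BL (sigma / (2 * pi)) g -> bandlimited sigma (of_real g).
Proof.
move=> s0; set W := sigma / (2 * pi) => Bg; have [a Va ga] := Bg.
have W0 : 0 <= W by rewrite ltW // divr_gt0 // mulr_gt0 // pi_gt0.
have cg : continuous g by exact: BL_continuous W0 Bg.
have Lg := BL_L2 Bg; have La := in_band_L2 Va; have La' := L2_reflect La.
have Ia := in_band_itg Va.
have B0 : L2 (fun=> 0 : R) := L2_0.
split.
- by split=> //= x; exact: cst_continuous.
- by split; apply/Lfun2_L2.
(* The even part of [a] minus i times its odd part: the Fourier transform of a real function in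
   terms of its Hartley transform. *)
exists (fun w => Complex ((a w + a (- w)) / 2) (- ((a w - a (- w)) / 2))); last first.
  have FA : Filter (almost_everywhere mu) := ae_filter_ringOfSetsType mu.
  apply: (@aeW _ _ _ mu) => w Bw.
  have Nw : ~ band W w.
    by move=> /=; rewrite /band /= in_itv /= => /andP[w1 w2]; apply: Bw; rewrite /= in_itv /= !ltW.
  by rewrite !(Va.2) ?addr0 ?subr0 ?mul0r ?oppr0 // => /bandN.
split.
  split; apply/Lfun2_L2 => /=.
    have := L2Z 2^-1 (L2D La La'); congr L2; apply/funext => w; by rewrite mulrC.
  have := L2Z (- 2^-1) (L2B La La'); congr L2; apply/funext => w.
  by rewrite /im /= mulNr mulrC.
pose v n (x : R) := edecay (eps n) x * g x.
have Iv n : itg (v n) by rewrite /v ga; case: (edecay_hartley 0 (eps_gt0 n) Ia).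
have Hv n w : hartley (v n) w = conv_poisson (eps n) a w.
  by rewrite /v ga; case: (edecay_hartley w (eps_gt0 n) Ia).
have vg n x : `|v n x| <= `|g x|.
  rewrite /v normrM ger0_norm ?edecay_ge0 // ler_piMl // edecay_le1 //.
  by rewrite ltW // eps_gt0.
have Lv n : L2 (v n) by apply: L2_dom Lg => //; exact: itg_meas (Iv n).
have Lc n : L2 (conv_poisson (eps n) a) by case: (conv_poisson_meas (eps_gt0 n) Ia La).
have Lh n : L2 (fun w => conv_poisson (eps n) a w - a w) by exact: L2B.
exists (fun n => of_real (v n)); split.
- move=> n; split; split; try exact/Lfun1_integrable/itg0; try exact/Lfun2_L2/B0.
    by apply/Lfun1_integrable; exact: (Iv n).
  by apply/Lfun2_L2; exact: (Lv n).
- apply: L2norm_cvg0.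
  + move=> n; rewrite (_ : re _ = (fun x => v n x - g x)) // (_ : im _ = (fun=> 0 - 0)) //.
    by rewrite subrr; split=> //; exact: L2B.
  + rewrite (_ : (fun n => _) = (fun n => Num.sqrt (\int[mu]_x (v n x - g x) ^+ 2))); last first.
      apply/funext => n; rewrite (_ : re _ = (fun x => v n x - g x)) // /nrm /dot; congr Num.sqrt.
    have [||||_ C] := @Rint_dct _ (fun n x => (v n x - g x) ^+ 2) (fun=> 0) (fun x => g x ^+ 2).
    * by move=> n; apply: meas_sq; case: (L2B (Lv n) Lg).
    * exact: Lg.2.
    * move=> x; have Hc : (fun n => v n x) @ \oo --> g x.
        rewrite /v -[X in _ --> X]mul1r; apply: cvgMl.
        have -> : 1 = edecay 0 x by rewrite /edecay mul0r oppr0 expR0.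
        have Hc : (fun n => - (eps n * `|x|)) @ \oo --> - (0 * `|x|).
          by apply: cvgN; apply: cvgMl; exact: eps_cvg.
        exact: (cvg_comp _ _ Hc (@continuous_expR R _)).
      have -> : (0 : R) = (g x - g x) ^+ 2 by rewrite subrr expr0n.
      have Hd : (fun n => v n x - g x) @ \oo --> g x - g x.
        by apply: (@cvgB _ R^o); [exact: Hc|exact: cvg_cst].
      exact: (cvg_comp _ _ Hd (@exprn_continuous R 2 _)).
    * move=> n x; rewrite normrX -[leRHS]real_normK ?num_real //; apply: lerXn2r; rewrite ?nnegrE //.
      have e1 := edecay_le1 x (ltW (eps_gt0 n)); have e0 := edecay_ge0 (eps n) x.
      rewrite /v -{2}[g x]mul1r -mulrBl normrM ler_piMl //.
      by rewrite distrC ger0_norm ?subr_ge0 // lerBlDr lerDl.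
    have E0 : \int[mu]_(t in [set: R]) (0 : R) = 0 by rewrite /Rintegral integral0.
    rewrite E0 in C; rewrite -[X in _ --> X]sqrtr0.
    exact: (cvg_comp _ _ C (@sqrt_continuous R 0)).
  + rewrite (_ : (fun n => _) = (fun=> 0)); first exact: cvg_cst.
    apply/funext => n; rewrite (_ : im _ = (fun=> 0 - 0)) // subrr; exact: nrm0.
pose h n (w : R) := conv_poisson (eps n) a w - a w.
have Lhr n := L2_reflect (Lh n).
have Er n : re (fun w => fourier (of_real (v n)) w - Complex ((a w + a (- w)) / 2) (- ((a w - a (- w)) / 2))) =
    (fun w => 2^-1 * (h n w + h n (- w))).
  apply/funext => w; have [r _] := of_real_fourier w (Iv n).
  transitivity (re (fourier (of_real (v n))) w - (a w + a (- w)) / 2).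
    by rewrite /re; case: (fourier _ _).
  by rewrite r !Hv /h; field.
have Ei n : im (fun w => fourier (of_real (v n)) w - Complex ((a w + a (- w)) / 2) (- ((a w - a (- w)) / 2))) =
    (fun w => 2^-1 * (h n (- w) - h n w)).
  apply/funext => w; have [_ r] := of_real_fourier w (Iv n).
  transitivity (im (fourier (of_real (v n))) w - (- ((a w - a (- w)) / 2))).
    by rewrite /im; case: (fourier _ _).
  by rewrite r !Hv /h; field.
have C0 := conv_poisson_cvgL2 Va; rewrite -/h in C0.
have half (p : nat -> R -> R) : (forall n, nrm (p n) <= nrm (h n) + nrm (h n)) ->
    (forall n, L2 (p n)) -> (fun n => nrm (fun w => 2^-1 * p n w)) @ \oo --> 0.
  move=> ph Lp; apply: (@squeeze_cvgr _ _ _ _ (fun=> 0) (fun n => nrm (h n))).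
  - near=> n; rewrite nrm_ge0 /= nrmZ // ger0_norm ?invr_ge0 //.
    rewrite ler_pdivrMl //; apply: le_trans (ph n) _; move: (nrm _) => z; lra.
  - exact: cvg_cst.
  - exact: C0.
apply: L2norm_cvg0.
- move=> n; rewrite Er Ei; split; apply: L2Z; [exact: (L2D (Lh n) (Lhr n))|exact: (L2B (Lhr n) (Lh n))].
- under eq_fun do rewrite Er; apply: half => n; last exact: (L2D (Lh n) (Lhr n)).
  by apply: le_trans (nrmD (Lh n) (Lhr n)) _; rewrite (nrm_reflect (Lh n)).
- under eq_fun do rewrite Ei; apply: half => n; last exact: (L2B (Lhr n) (Lh n)).
  by apply: le_trans (nrmB (Lhr n) (Lh n)) _; rewrite (nrm_reflect (Lh n)).
Unshelve. all: by end_near.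
Qed.

Lemma inner_of_real f (g : R -> R) : inner f (of_real g) = Complex (dot (re f) g) (dot (im f) g).
Proof.
rewrite /inner /cintegral /dot; congr Complex; apply: Int_ext => x;
  rewrite /re /im /of_real /=; case: (f x) => a b /=; ring.
Qed.

End RealBandlimited.

(** * Assembly for complex-valued functions *)

Section Assembly.
Context {R : realType}.
Notation mu := (@lebesgue_measure R).
Notation normc := ComplexField.Normc.normc.

(** The Bessel sum runs over arbitrary finite sets of pairs; these are enlarged to full rows, for
    which [frame_bessel] applies. *)
Lemma sum_pairs_le k (r : seq (int * 'I_k)) (F : int -> nat -> R) : (forall i l, 0 <= F i l) ->
  uniq r -> \sum_(p <- r) F p.1 p.2 <= \sum_(i <- undup (map fst r)) \sum_(l < k) F i l.
Proof.
move=> F0 ur; set s := undup _.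
have -> : \sum_(i <- s) \sum_(l < k) F i l =
    \sum_(p <- [seq (i, l) | i <- s, l <- index_enum 'I_k]) F p.1 (nat_of_ord p.2).
  by rewrite big_allpairs.
rewrite [leRHS](@sum_diff _ _ (fun p => F p.1 (nat_of_ord p.2)) r) //.
- by rewrite lerDl; apply: sumr_ge0.
- by apply: allpairs_uniq; [exact: undup_uniq|exact: index_enum_uniq|move=> [a b] [c e] _ _ /= [-> ->]].
- move=> [i l] ilr; apply: allpairs_f; last by rewrite mem_index_enum.
  by rewrite mem_undup; apply/mapP; exists (i, l).
Qed.

Lemma Re_sum (I : Type) (r : seq I) (F : I -> complex R) :
  complex.Re (\sum_(i <- r) F i) = \sum_(i <- r) complex.Re (F i) /\
  complex.Im (\sum_(i <- r) F i) = \sum_(i <- r) complex.Im (F i).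
Proof.
elim: r => [|i r [IH1 IH2]]; first by rewrite !big_nil.
by rewrite !big_cons -IH1 -IH2; case: (F i) (\sum_(j <- r) F j) => a b [c e].
Qed.

(** The functions [G i l] are real, so the same family reconstructs the real and imaginary parts of
    [f] separately. *)
Lemma sampling_residual k x (f : R -> complex R) (G : int -> nat -> R -> R) (A : {fset int}) (t : R) :
  cderiven (k - 1) f t - partial_sum (fun i : int => \sum_(l < k) cderiven l f (x i) * of_real (G i l) t) A =
  Complex (top_der k (re f) t - comb k G (jets x (re f)) A t) (top_der k (im f) t - comb k G (jets x (im f)) A t).
Proof.
have -> : partial_sum (fun i : int => \sum_(l < k) cderiven l f (x i) * of_real (G i l) t) A =
    \sum_(i <- A) \sum_(l < k) cderiven l f (x i) * of_real (G i l) t by rewrite [RHS]big_seq_fsetE.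
set S := \sum_(i <- _) _.
have [E1 E2] : complex.Re S = comb k G (jets x (re f)) A t /\ complex.Im S = comb k G (jets x (im f)) A t.
  rewrite /S !(Re_sum _ _).1 !(Re_sum _ _).2 /comb /jets; split; apply: eq_bigr => i _;
    rewrite ?(Re_sum _ _).1 ?(Re_sum _ _).2; apply: eq_bigr => l _;
    rewrite /cderiven /of_real /= !mulr0 ?subr0 ?add0r //.
move: E1 E2; rewrite /cderiven subn1 /top_der; case: S => a b /= <- <-; by [].
Qed.

(** [d] is the supremum itself, which is finite because it lies between a gap and [c]. *)
Lemma separated_gaps (x : int -> R) (c : R) : (forall i : int, x i < x (i + 1)) -> separated_nodes x ->
  (ereal_sup (range (fun i : int => (x (i + 1) - x i)%:E)) < c%:E)%E ->
  exists g d, gaps x g d /\ d < c.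
Proof.
move=> inc [g g0 gs]; set S := ereal_sup _ => Sc.
have Sx i : ((x (i + 1) - x i)%:E <= S)%E by apply: ereal_sup_ubound; exists i.
have Sf : S \is a fin_num.
  rewrite fin_numE; apply/andP; split; apply/eqP => SE.
    by have := Sx 0; rewrite SE leeNy_eq.
  by move: Sc; rewrite SE.
exists g, (fine S); rewrite -lte_fin fineK //; split=> //; split=> // i; split.
  have := gs (i + 1) i; rewrite gtr0_norm ?subr_gt0 //; apply; lia.
by rewrite -lee_fin fineK.
Qed.

Lemma derive1n_FTC (W : R) f m (a t : R) : 0 <= W -> BL W f ->
  derive1n m f t = (if a <= t then \int[mu]_(s in `[a, t]) derive1n m.+1 f s
    else - \int[mu]_(s in `[t, a]) derive1n m.+1 f s) + derive1n m f a.
Proof.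
move=> W0 Bf; have d (s : R) : is_derive s 1 (derive1n m f) (derive1n m.+1 f s) by exact: BL_is_derive W0 Bf.
have c : continuous (derive1n m.+1 f) := BL_continuous W0 (BL_derive1n m.+1 W0 Bf).
case: (leP a t) => at_; first by rewrite (FTC_itv at_ c d) subrK.
by rewrite (FTC_itv (ltW at_) c d) opprB subrK.
Qed.

Lemma Complex_if_add (c : bool) (a b p1 p2 q1 q2 a' b' : R) :
  a = (if c then p1 else - q1) + a' -> b = (if c then p2 else - q2) + b' ->
  Complex a b = (if c then Complex p1 p2 else - Complex q1 q2) + Complex a' b'.
Proof. by case: c => -> ->. Qed.

Section Frame.
Context (k : nat) (x : int -> R) (g d lam W sigma : R).
Context (k0 : (0 < k)%N) (G : gaps x g d) (lam0 : 0 < lam) (W0 : 0 <= W)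
  (Wi : wirtinger k lam d) (Wlam : (2 * pi * W) ^+ 2 < lam) (s0 : 0 < sigma)
  (WE : W = sigma / (2 * pi)).
Let fr (i : int) (l : 'I_k) : R -> complex R := of_real (frame k x W i l).

Lemma frame_bessel_sequence : bessel_sequence (bandlimited sigma) (fun p : (int * 'I_k)%type => fr p.1 p.2).
Proof.
have BF := frame_BL k0 G lam0 W0 Wi Wlam.
split=> [p|]; first by apply: BL_bandlimited => //; rewrite -WE; exact: BF.
(* Adding 1 makes the Bessel constant strictly positive. *)
exists (frame_const k g d lam W ^+ 2 + 1); first by rewrite ltr_wpDl // sqr_ge0.
move=> f Hf; have [B1 B2] := bandlimited_BL Hf; rewrite -WE in B1 B2.
have n0 : 0 <= nrm (re f) ^+ 2 + nrm (im f) ^+ 2 by rewrite addr_ge0 // sqr_ge0.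
rewrite (L2norm_L2 (BL_L2 B1) (BL_L2 B2)) -EFin_expe sqr_sqrtr // -EFinM.
apply: ge_ereal_sup => _ [A [finA _] <-].
rewrite fsbig_finite // sumEFin lee_fin.
pose Fp i l := dot (re f) (frame k x W i l) ^+ 2 + dot (im f) (frame k x W i l) ^+ 2.
rewrite (eq_bigr (fun p => Fp p.1 (nat_of_ord p.2))); last first.
  by move=> p _; rewrite /fr inner_of_real normc_sqr.
have Fp0 i l : 0 <= Fp i l by rewrite addr_ge0 // sqr_ge0.
apply: le_trans (sum_pairs_le Fp0 (fset_uniq _)) _.
set s := undup _; have us : uniq s by exact: undup_uniq.
rewrite (eq_bigr (fun i => \sum_(l < k) dot (re f) (frame k x W i l) ^+ 2 +
  \sum_(l < k) dot (im f) (frame k x W i l) ^+ 2)); last by move=> i _; rewrite -big_split.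
rewrite big_split /=.
have := frame_bessel k0 G lam0 W0 Wi Wlam B1 us; have := frame_bessel k0 G lam0 W0 Wi Wlam B2 us.
rewrite /energy; move: (\sum_(i <- s) _) (\sum_(i <- s) _) => p q'.
move: (frame_const _ _ _ _ _ ^+ 2) (nrm (re f) ^+ 2) (nrm (im f) ^+ 2) n0 => C a b n0 h1 h2.
by rewrite mulrDl mul1r; lra.
Qed.

Lemma frame_nrm_cvg f : BL W f ->
  (fun A : {fset int} => nrm (fun t => top_der k f t - comb k (frame k x W) (jets x f) A t)) @ totally --> (0 : R).
Proof.
move=> Bf; have FT : ProperFilter (@totally int) := totally_filter.
apply/cvgrPdist_le => e e0.
have [N NP] := frame_reconstruction k0 G lam0 W0 Wi Wlam Bf e0.
exists [fset i in int_ball N]%fset => //= A NA; rewrite sub0r normrN ger0_norm ?nrm_ge0 //.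
apply: NP; first exact: fset_uniq.
by move=> i iN; apply: (fsubsetP NA); rewrite !inE.
Qed.

(** Convergence in norm comes from [frame_reconstruction]; pointwise convergence follows from it
    because the remainders are band-limited and evaluation is bounded by [Kband W]. *)
Lemma frame_expansion f : bandlimited sigma f ->
  (forall t : R, (fun A : {fset int} => normc (cderiven (k - 1) f t
      - partial_sum (fun i : int => \sum_(l < k) cderiven l f (x i) * fr i l t) A)) @ totally --> (0 : R)) /\
  (fun A : {fset int} => L2norm (fun t : R => cderiven (k - 1) f t
      - partial_sum (fun i : int => \sum_(l < k) cderiven l f (x i) * fr i l t) A)) @ totally --> 0%E.
Proof.
move=> Hf; have [B1 B2] := bandlimited_BL Hf; rewrite -WE in B1 B2.
have FT : ProperFilter (@totally int) := totally_filter.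
have BF := frame_BL k0 G lam0 W0 Wi Wlam.
pose res h (A : {fset int}) t := top_der k h t - comb k (frame k x W) (jets x h) A t.
have Bres h A : BL W h -> BL W (res h A).
  by move=> Bh; apply: BLB; [exact: BL_derive1n|exact: comb_BL].
have C1 := frame_nrm_cvg B1; have C2 := frame_nrm_cvg B2.
have E A t := @sampling_residual k x f (frame k x W) A t.
split=> [t|].
  have C : (fun A : {fset int} => Kband W * (nrm (res (re f) A) + nrm (res (im f) A))) @ totally --> 0.
    rewrite -[X in _ --> X](mulr0 (Kband W)) -[X in _ * X](addr0 0).
    by apply: cvgMr; apply: (@cvgD _ R^o).
  apply: (@squeeze_cvgr _ _ _ _ (fun=> 0) _) C; last exact: cvg_cst.
  near=> A; rewrite E; apply/andP; split; first exact: sqrtr_ge0.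
  apply: le_trans (normc_le _) _; rewrite mulrDr.
  by apply: lerD; [exact: (@BL_sup _ W _ t (Bres _ A B1))|exact: (@BL_sup _ W _ t (Bres _ A B2))].
have -> : (fun A : {fset int} => L2norm (fun t : R => cderiven (k - 1) f t
      - partial_sum (fun i : int => \sum_(l < k) cderiven l f (x i) * fr i l t) A)) =
   (fun A : {fset int} => L2norm (fun t => Complex (res (re f) A t) (res (im f) A t))).
  by apply/funext => A; congr L2norm; apply/funext => t; exact: E.
apply: L2norm_cvg0; [|exact: C1|exact: C2].
by move=> A; split; apply: BL_L2; exact: Bres.
Unshelve. all: by end_near.
Qed.

End Frame.
End Assembly.

Local Open Scope complex_scope.

(** The series is summed along the finite sets of nodes, hence unconditionally, and its sum is
    identified both at every point and in L2, the two senses in which an equality in the space can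
    be read. *)
Theorem corollary4p1 (R : realType) (sigma : R) (hsigma : 0 < sigma)
    (k : nat) (hk : (1 <= k)%N) (x : int -> R)
    (hx_incr : forall i : int, x i < x (i + 1))
    (hx_sep : separated_nodes x)
    (hdelta : (ereal_sup (range (fun i : int => (x (i + 1) - x i)%:E))
               < (wirtinger_cimmino R k / sigma)%:E)%E) :
  (exists g : int -> 'I_k -> R -> R[i],
     bessel_sequence (bandlimited sigma)
       (fun p : (int * 'I_k)%type => g p.1 p.2) /\
     forall f, bandlimited sigma f ->
       (forall t : R,
          (fun A : {fset int} => ComplexField.Normc.normc
             (cderiven (k - 1) f t
              - partial_sum (fun i : int =>
                  \sum_(l < k) cderiven l f (x i) * g i l t) A))
          @ totally --> (0 : R)) /\
       (fun A : {fset int} => L2norm (fun t : R =>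
             cderiven (k - 1) f t
              - partial_sum (fun i : int =>
                  \sum_(l < k) cderiven l f (x i) * g i l t) A))
       @ totally --> 0%E) /\
  (forall f, bandlimited sigma f ->
     forall (l : nat) (i : int) (t : R), (1 <= l <= k - 1)%N ->
       cderiven (l - 1) f t =
         cintegral_from_to (x i) t (cderiven l f) + cderiven (l - 1) f (x i)).
Proof.
have [g [d [G dnu]]] := separated_gaps hx_incr hx_sep hdelta.
have p0 := pi_gt0 R.
pose W : R := sigma / (2 * pi).
have W0 : 0 <= W by rewrite ltW // divr_gt0 // mulr_gt0.
have WE : 2 * pi * W = sigma by rewrite mulrC divfK // gt_eqF // mulr_gt0.
split.
  have [lam slam Wi] := wirtinger_cimmino_ineq hk hsigma (gaps_d G) dnu.
  have lam0 : 0 < lam by apply: le_lt_trans slam; exact: sqr_ge0.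
  rewrite -{1}WE in slam.
  exists (fun i l => of_real (frame k x W i l)); split.
    exact: (@frame_bessel_sequence _ k x g d lam W sigma).
  by move=> f Hf; exact: (@frame_expansion _ k x g d lam W sigma).
move=> f Hf [//|m] i t _; have [B1 B2] := bandlimited_BL Hf.
rewrite subn1 -[m.+1.-1]/m /cintegral_from_to /cintegral.
have -> : re (cderiven m.+1 f) = derive1n m.+1 (re f) by [].
have -> : im (cderiven m.+1 f) = derive1n m.+1 (im f) by [].
rewrite /cderiven.
exact: Complex_if_add (derive1n_FTC m (x i) t W0 B1) (derive1n_FTC m (x i) t W0 B2).
Qed.
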